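(* Let $n>2$ be an integer, let $i,j\in\{1,\dots,n\}$, and let $q\in(-1,0)$ be the number such that $q+q^{-1}=-n$. Then the circular density of the variable $w=\sqrt{n+2}\,u_{ij}\in A_o(n)$ (with respect to the Haar functional of $A_o(n)$) is given by $$F(z)=\frac12\left(G(z)+G(z^{-1})\right),\qquad z\in\mathbb T,$$ $$G(z)=(1-q^2)(1-z^4)\sum_{k=0}^\infty \frac{q^{2k}(1-q^{2k+1}z^2)}{(1+q^{2k}z^2)(1+q^{2k+1}z^2)(1+q^{2k+2}z^2)}.$$
   Context: $A_o(n)$ is the universal unital $C^*$-algebra generated by $n^2$ self-adjoint elements $u_{ij}$ ($1\le i,j\le n$) subject to the relations $uu^t=u^tu=1$, where $u=(u_{ij})$ and $u^t=(u_{ji})$. It is a compact quantum group algebra in the sense of Woronowicz, with comultiplication $\Delta(u_{ij})=\sum_k u_{ik}\otimes u_{kj}$. The Haar functional, denoted $\int$, is the unique state on $A_o(n)$ that is left and right invariant: $(\mathrm{id}\otimes\int)\Delta(a)=(\int\otimes\,\mathrm{id})\Delta(a)=\left(\int a\right)1$ for all $a$. $\mathbb T$ is the unit circle in $\mathbb C$. A (self-adjoint) variable $w$ is said to have circular density $F$ if $\int\phi(w)=\int_{\mathbb T}F(z)\,\phi(z+z^{-1})\,\frac{dz}{2\pi i z}$ for any continuous function $\phi$, and $F(z)=F(z^{-1})$ for all $z\in\mathbb T$. With $z=e^{it}$ this reads $\int\phi(w)=\frac1\pi\int_0^\pi F(e^{it})\phi(2\cos t)\,dt$. In the $k=0$ term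 of $G$, the zero of the denominator at $z^2=-1$ is cancelled by the factor $1-z^4$ (removable singularity). *)

(* Defs.v *)
From HB Require Import structures.
From mathcomp Require Import all_boot all_order all_algebra.
From mathcomp Require Import all_classical all_reals all_analysis.
From mathcomp Require Import complex.
Set Implicit Arguments.
Unset Strict Implicit.
Unset Printing Implicit Defensive.
Import Order.TTheory GRing.Theory Num.Theory.
Import numFieldNormedType.Exports.
Local Open Scope classical_set_scope.
Local Open Scope complex_scope.
Local Open Scope ring_scope.

(* The norm is bundled on top of [algType] because the library has no join of
   its normed modules with its algebras. *)
HB.mixin Record isCStarAlgebra (R : realType) A of GRing.Algebra R[i] A := {
  star : A -> A ;
  cnorm : A -> R ;
  starK : forall x, star (star x) = x ;
  starD : forall x y, star (x + y) = star x + star y ;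
  starZ : forall (c : R[i]) x, star (c *: x) = c^*%C *: star x ;
  starM : forall x y, star (x * y) = star y * star x ;
  cnorm0_eq0 : forall x, cnorm x = 0 -> x = 0 ;
  cnormZ : forall (c : R[i]) x, cnorm (c *: x) = complex.Re `|c| * cnorm x ;
  cnormD : forall x y, cnorm (x + y) <= cnorm x + cnorm y ;
  cnormM : forall x y, cnorm (x * y) <= cnorm x * cnorm y ;
  cnorm_star : forall x, cnorm (star x * x) = cnorm x ^+ 2 ;
  cnorm_complete : forall a : nat -> A,
    (forall e, 0 < e -> exists N, forall m p,
       (N <= m)%N -> (N <= p)%N -> cnorm (a m - a p) < e) ->
    exists l, forall e, 0 < e -> exists N, forall m,
       (N <= m)%N -> cnorm (a m - l) < e
}.

#[short(type="cstarAlgType")]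
HB.structure Definition CStarAlgebra (R : realType) :=
  {A of isCStarAlgebra R A & GRing.Algebra R[i] A}.

Section CStar.
Context {R : realType}.
Implicit Types A B T : cstarAlgType R.

(* Unitality is part of [{lrmorphism A -> B}]. *)
Definition star_preserving A B (f : A -> B) : Prop :=
  forall x, f (star x) = star (f x).

Definition norm_closure A (S : set A) : set A :=
  [set x | forall e, 0 < e -> exists2 y, S y & cnorm (x - y) < e].

Definition bounded_linear A B (E : {linear A -> B}) : Prop :=
  exists M : R, forall x, cnorm (E x) <= M * cnorm x.

Definition cstar_subalgebra A (S : set A) : Prop :=
  [/\ norm_closure S `<=` S, S 1,
      forall x y, S x -> S y -> S (x + y) /\ S (x * y),
      forall (c : R[i]) x, S x -> S (c *: x) &
      forall x, S x -> S (star x)].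

Definition is_state A (h : {scalar A}) : Prop :=
  h 1 = 1 /\ forall a, 0 <= h (star a * a).

Definition lin_indep A m (a : 'I_m -> A) : Prop :=
  forall c : 'I_m -> R[i], \sum_(k < m) c k *: a k = 0 -> forall k, c k = 0.

(* [T] is the completion of the algebraic tensor product of [A] and [B] for
   some C*-norm, [tens a b] being the elementary tensor of [a] and [b].
   The field [tens_inj] says that the algebraic tensor product embeds. *)
Record is_cstar_tensor A B T (tens : A -> B -> T) : Prop := {
  tens_linl : forall (c : R[i]) a a' b,
    tens (c *: a + a') b = c *: tens a b + tens a' b ;
  tens_linr : forall (c : R[i]) a b b',
    tens a (c *: b + b') = c *: tens a b + tens a b' ;
  tens1 : tens 1 1 = 1 ;
  tensM : forall a a' b b', tens a b * tens a' b' = tens (a * a') (b * b') ;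
  tens_star : forall a b, star (tens a b) = tens (star a) (star b) ;
  tens_inj : forall m (a : 'I_m -> A) (b : 'I_m -> B),
    lin_indep a -> \sum_(k < m) tens (a k) (b k) = 0 -> forall k, b k = 0 ;
  tens_dense : norm_closure [set x | exists m (a : 'I_m -> A) (b : 'I_m -> B),
    x = \sum_(k < m) tens (a k) (b k)] = setT
}.

Definition is_min_tensor A B T (tens : A -> B -> T) : Prop :=
  is_cstar_tensor tens /\
  forall (T' : cstarAlgType R) (tens' : A -> B -> T'), is_cstar_tensor tens' ->
  forall m (a : 'I_m -> A) (b : 'I_m -> B),
    cnorm (\sum_(k < m) tens (a k) (b k)) <=
    cnorm (\sum_(k < m) tens' (a k) (b k)).

(* [E] is the slice map id (x) h, resp. h (x) id. *)
Definition is_rslice A B T (tens : A -> B -> T) (h : {scalar B})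
    (E : {linear T -> A}) : Prop :=
  bounded_linear E /\ forall a b, E (tens a b) = h b *: a.

Definition is_lslice A B T (tens : A -> B -> T) (h : {scalar A})
    (E : {linear T -> B}) : Prop :=
  bounded_linear E /\ forall a b, E (tens a b) = h a *: b.

Definition orth_relations n A (u : 'M[A]_n) : Prop :=
  [/\ forall i j, star (u i j) = u i j,
      u *m u^T = 1%:M & u^T *m u = 1%:M].

Record is_Ao n A (u : 'M[A]_n) : Prop := {
  Ao_relations : orth_relations u ;
  Ao_generated : forall S : set A,
    cstar_subalgebra S -> (forall i j, S (u i j)) -> S = setT ;
  Ao_universal : forall (B : cstarAlgType R) (v : 'M[B]_n), orth_relations v ->
    exists f : {lrmorphism A -> B},
      star_preserving f /\ forall i j, f (u i j) = v i j
}.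

Definition is_comultiplication n A T (u : 'M[A]_n) (tens : A -> A -> T)
    (Delta : {lrmorphism A -> T}) : Prop :=
  star_preserving Delta /\
  forall i j, Delta (u i j) = \sum_(k < n) tens (u i k) (u k j).

Definition is_Haar A T (tens : A -> A -> T) (Delta : A -> T)
    (h : {scalar A}) : Prop :=
  [/\ is_state h,
      exists E : {linear T -> A},
        is_rslice tens h E /\ forall a, E (Delta a) = h a *: 1 &
      exists E : {linear T -> A},
        is_lslice tens h E /\ forall a, E (Delta a) = h a *: 1].

(* The spectrum of a self-adjoint element is real, so only its real points
   are recorded. *)
Definition spectrum A (w : A) : set R :=
  [set x | ~ exists b : A, b * (x%:C%:A - w) = 1 /\ (x%:C%:A - w) * b = 1].

(* [Phi] is the isometric unital *-homomorphism C(spectrum w) -> A sending the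
   identity function to [w]; an element of C(spectrum w) is represented by any
   total function which is continuous on [spectrum w]. *)
Record is_functional_calculus A (w : A) (Phi : (R -> R[i]^o) -> A) : Prop := {
  fc_id : Phi (fun x => x%:C) = w ;
  fc_1 : Phi (fun=> 1) = 1 ;
  fc_lin : forall (c : R[i]) (f g : R -> R[i]^o),
    {within spectrum w, continuous f} -> {within spectrum w, continuous g} ->
    Phi (fun x => c * f x + g x) = c *: Phi f + Phi g ;
  fc_M : forall f g : R -> R[i]^o,
    {within spectrum w, continuous f} -> {within spectrum w, continuous g} ->
    Phi (fun x => f x * g x) = Phi f * Phi g ;
  fc_star : forall f : R -> R[i]^o, {within spectrum w, continuous f} ->
    Phi (fun x => (f x)^*%C) = star (Phi f) ;
  fc_norm : forall f : R -> R[i]^o, {within spectrum w, continuous f} ->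
    cnorm (Phi f) = sup [set complex.Re `|f x| | x in spectrum w]
}.

(* The integral of g(z) dz / (2 pi i z) over the unit circle, z = exp(i t). *)
Definition circle_integral (g : R[i] -> R[i]) : R[i] :=
  let g' (t : R) := g (cos t +i* sin t) in
  ((2 * pi)^-1)%:C *
  ((\int[lebesgue_measure]_(t in `[0, 2 * pi]) complex.Re (g' t)) +i*
   (\int[lebesgue_measure]_(t in `[0, 2 * pi]) complex.Im (g' t))).

(* [z + z^-1] is real for z on the unit circle. *)
Definition has_circular_density A (h : {scalar A}) (w : A) (F : R[i] -> R[i])
    : Prop :=
  [/\ star w = w,
      forall z : R[i], `|z| = 1 -> F z = F z^-1 &
      forall Phi, is_functional_calculus w Phi ->
      forall phi : R -> R[i]^o, continuous phi ->
        h (Phi phi) =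
        circle_integral (fun z => F z * phi (complex.Re (z + z^-1)))].

(* At z^2 = -1, the summand k = 0 multiplied by 1 - z^4 is
   (1 - z^2)(1 - q z^2) / ((1 + q z^2)(1 + q^2 z^2)) by continuity, and the
   summands k > 0 multiplied by 1 - z^4 vanish. *)
Definition G (q : R) (z : R[i]) : R[i] :=
  let Q m : R[i] := (q ^+ m)%:C in
  if z ^+ 2 == -1 then
    (1 - Q 2%N) * ((1 - z ^+ 2) * (1 - Q 1%N * z ^+ 2) /
                   ((1 + Q 1%N * z ^+ 2) * (1 + Q 2%N * z ^+ 2)))
  else
    (1 - Q 2%N) * (1 - z ^+ 4) *
    limn (series (fun k : nat =>
      Q (2 * k)%N * (1 - Q (2 * k + 1)%N * z ^+ 2) /
      ((1 + Q (2 * k)%N * z ^+ 2) * (1 + Q (2 * k + 1)%N * z ^+ 2)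
        * (1 + Q (2 * k + 2)%N * z ^+ 2)) : R[i]^o)).

Definition F (q : R) (z : R[i]) : R[i] := 2^-1 * (G q z + G q z^-1).

End CStar.

(* Main.v *)
(* Write xi(k) for the Haar state of u_{k_1 j} ... u_{k_m j}. Slicing the
   invariance of the Haar state and applying the universal property shows that
   xi is fixed by every orthogonal matrix v with entries in a C*-algebra:
   sum_w xi(w) v_{k_1 w_1} ... v_{k_m w_m} = xi(k) 1. For v diagonal
   with involutive permutation matrices as entries, this shows that xi vanishes
   off the words that are trivial in the free product of n copies of Z/2; for v a
   scalar rotation of a coordinate plane, that the derivatives of xi under these
   rotations vanish. The two properties are shared by the tensors of noncrossing
   pairings, and on words in two letters a highest weight argument for sl_2 shows
   that they force xi to agree with such a tensor. Hence xi pairs to 0 with the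
   Jones-Wenzl projections of the powers of a basis vector. The Jones-Wenzl
   recursion turns this into a three-term recurrence for the moments of
   w = sqrt(n+2) u_ij, with recurrence coefficients c_r c_{r+1} where
   c_r = (1 - q^r) / (1 + q^r).

   On the analytic side, G is a Lambert series in -z^2, which gives the Fourier
   coefficients of F; the orthogonal polynomials with the same recurrence have an
   explicit cosine expansion, and their orthogonality for the density F is a
   telescoping sum. So F has the moments of w, and positivity of the state with
   Weierstrass approximation on the spectrum passes from polynomials to continuous
   functions. *)
Require Import Defs.
From HB Require Import structures.
From mathcomp Require Import all_boot all_order all_algebra.
From mathcomp Require Import all_classical all_reals all_analysis.
From mathcomp Require Import complex.
From mathcomp Require Import ring lra zify.
Set Implicit Arguments.
Unset Strict Implicit.
Unset Printing Implicit Defensive.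
Import Order.TTheory GRing.Theory Num.Theory.
Import numFieldNormedType.Exports.
Local Open Scope complex_scope.
Local Open Scope ring_scope.

(** * Highest weight vectors for sl_2 *)

(** The classical route computes all intertwiners of the powers of [u] by Tannaka-Krein duality;
    here a single pairing per degree is wanted, and explicit test matrices do. Neither family of
    them is enough alone: support on trivial words does not give rotation invariance, and rotations
    allow crossing pairings too. sl_2 enters because the Cayley graph of Z/2 * Z/2 is a line: a word
    in two letters is a path on it, trivial exactly when closed, and the rotation of the two letters
    becomes a lowering plus a raising operator, which the weights separate. A weight 0 vector killed
    by the lowering operator is determined by its values on Dyck paths. The obstacle is that the
    contractions in a Jones-Wenzl projection sum over all letters and so leave the words in two
    letters; rotations mixing in the third letter show that its contributions vanish too. Sums of
    squares are used, so the argument runs on the real and imaginary parts of xi separately. On the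
    analytic side, the estimates are uniform up to z^2 = -1 because 1 - z^4 is multiplied in before
    passing to the limit. *)

Section WordSum.
Variables (V : nmodType) (I : finType).

(** Recursion on the first letter, instead of a sum over tuples, follows the recursion of the word
    functions that get summed. *)
Fixpoint wsum (m : nat) (f : seq I -> V) : V :=
  if m is m'.+1 then \sum_x wsum m' (fun w => f (x :: w)) else f [::].

Lemma eq_wsum m (f g : seq I -> V) :
  (forall w, size w = m -> f w = g w) -> wsum m f = wsum m g.
Proof.
elim: m f g => [|m IH] f g fg /=; first exact: fg.
by apply: eq_bigr => x _; apply: IH => w wm; apply: fg; rewrite /= wm.
Qed.

Lemma wsumD m (f g : seq I -> V) :
  wsum m (fun w => f w + g w) = wsum m f + wsum m g.
Proof.
elim: m f g => [//|m IH] f g /=.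
by rewrite -big_split; apply: eq_bigr => x _; rewrite IH.
Qed.

Lemma wsum0 m : wsum m (fun=> 0) = 0.
Proof. by elim: m => [//|m IH] /=; rewrite big1. Qed.

End WordSum.

Lemma raddf_wsum (U V : nmodType) (I : finType) (h : {additive U -> V}) m
    (f : seq I -> U) : h (wsum m f) = wsum m (fun w => h (f w)).
Proof.
elim: m f => [//|m IH] f /=.
by rewrite raddf_sum; apply: eq_bigr => x _; rewrite IH.
Qed.

Section SignedFlips.
Variable R : realFieldType.
Implicit Types (s : R) (t : seq bool -> R) (u : seq bool) (m : nat).

(* The sl_2 action on words is twisted: the sign alternates with the position,
   starting from [s]. *)
Fixpoint dn s t u : R :=
  if u is b :: u' then
    (if b then 0 else s * t (true :: u')) + dn (- s) (fun w => t (b :: w)) u'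
  else 0.

Fixpoint up s t u : R :=
  if u is b :: u' then
    (if b then s * t (false :: u') else 0) + up (- s) (fun w => t (b :: w)) u'
  else 0.

Fixpoint wt u : int :=
  if u is b :: u' then (if b then 1 else -1) + wt u' else 0.

Notation bsum m f := (@wsum R bool m f).

Lemma bsumS m (f : seq bool -> R) :
  bsum m.+1 f = bsum m (fun w => f (true :: w)) + bsum m (fun w => f (false :: w)).
Proof. by rewrite /= big_bool. Qed.

Lemma bsumZ m (c : R) f : bsum m (fun w => c * f w) = c * bsum m f.
Proof.
elim: m f => [//|m IH] f /=.
by rewrite mulr_sumr; apply: eq_bigr => x _; rewrite IH.
Qed.

Lemma bsum_ge0 m (f : seq bool -> R) : (forall w, 0 <= f w) -> 0 <= bsum m f.
Proof.
elim: m f => [|m IH] f f0 /=; first exact: f0.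
by apply: sumr_ge0 => x _; apply: IH.
Qed.

Lemma bsum_eq0 m (f : seq bool -> R) : (forall w, 0 <= f w) ->
  bsum m f = 0 -> forall w, size w = m -> f w = 0.
Proof.
elim: m f => [|m IH] f f0 /=; first by move=> h [].
rewrite big_bool => h.
have p b : 0 <= bsum m (fun w => f (b :: w)) by apply: bsum_ge0.
have e b : bsum m (fun w => f (b :: w)) = 0.
  by move/eqP: h; rewrite paddr_eq0 ?p // => /andP[/eqP h1 /eqP h2]; case: b.
by case=> [//|b w] [wm]; apply: (IH (fun w => f (b :: w))).
Qed.

(** At each position the two operators exchange the same two letters in opposite directions and with
    the same sign. *)
Lemma dn_up_adjoint m s t1 t2 :
  bsum m (fun w => t1 w * dn s t2 w) = bsum m (fun w => t2 w * up s t1 w).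
Proof.
elim: m s t1 t2 => [|m IH] s t1 t2; first by rewrite /= !mulr0.
rewrite !bsumS /=.
under eq_wsum do rewrite add0r.
under [X in _ + X = _]eq_wsum do rewrite mulrDr mulrCA.
under [X in _ = X + _]eq_wsum do rewrite mulrDr mulrCA.
under [X in _ = _ + X]eq_wsum do rewrite add0r.
rewrite !wsumD !IH !bsumZ.
have -> : bsum m (fun w => t1 (false :: w) * t2 (true :: w)) =
          bsum m (fun w => t2 (true :: w) * t1 (false :: w)).
  by apply: eq_wsum => w _; rewrite mulrC.
by ring.
Qed.

(* The relation [E, F] = H of sl_2, paired with the vector itself. *)
Lemma dn_up_norm m s t : s ^+ 2 = 1 ->
  bsum m (fun w => dn s t w ^+ 2) - bsum m (fun w => up s t w ^+ 2) =
  bsum m (fun w => (wt w)%:~R * t w ^+ 2).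
Proof.
elim: m s t => [|m IH] s t s1; first by rewrite /= expr0n mul0r subr0.
rewrite !bsumS /=.
have s1' : (- s) ^+ 2 = 1 by rewrite sqrrN.
have e1 : bsum m (fun w => (s * t (true :: w) + dn (- s) (fun w0 => t (false :: w0)) w) ^+ 2)
  = bsum m (fun w => t (true :: w) ^+ 2)
  + (2 * s) * bsum m (fun w => t (true :: w) * dn (- s) (fun w0 => t (false :: w0)) w)
  + bsum m (fun w => dn (- s) (fun w0 => t (false :: w0)) w ^+ 2).
  rewrite -bsumZ -!wsumD; apply: eq_wsum => w _.
  by rewrite sqrrD exprMn s1 mul1r -mulr_natl; ring.
have e2 : bsum m (fun w => (s * t (false :: w) + up (- s) (fun w0 => t (true :: w0)) w) ^+ 2)
  = bsum m (fun w => t (false :: w) ^+ 2)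
  + (2 * s) * bsum m (fun w => t (false :: w) * up (- s) (fun w0 => t (true :: w0)) w)
  + bsum m (fun w => up (- s) (fun w0 => t (true :: w0)) w ^+ 2).
  rewrite -bsumZ -!wsumD; apply: eq_wsum => w _.
  by rewrite sqrrD exprMn s1 mul1r -mulr_natl; ring.
(* By adjointness the cross terms of the two squares coincide and cancel in the difference. *)
rewrite e1 e2 dn_up_adjoint.
under [X in X + _ - _]eq_wsum do rewrite add0r.
under [X in _ - (_ + X)]eq_wsum do rewrite add0r.
have h b : bsum m (fun w => ((if b then 1 else -1 : int) + wt w)%:~R * t (b :: w) ^+ 2)
  = (if b then 1 else -1) * bsum m (fun w => t (b :: w) ^+ 2) +
    (bsum m (fun w => dn (- s) (fun w0 => t (b :: w0)) w ^+ 2) -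
     bsum m (fun w => up (- s) (fun w0 => t (b :: w0)) w ^+ 2)).
  rewrite IH // -bsumZ -wsumD; apply: eq_wsum => w _.
  by rewrite intrD mulrDl; case: b.
have := h true; have := h false => /= -> ->.
by ring.
Qed.

Fixpoint nonneg_path (j : nat) u : bool :=
  if u is b :: u' then
    if b then nonneg_path j.+1 u' else if j is j'.+1 then nonneg_path j' u' else false
  else true.

(** Induction on the first letter. [t (true :: _)] inherits the hypotheses with [j.+1]; once it is
    0, [t (false :: _)] is killed by [dn] as well and inherits them with [j.-1]. Only [j = 0] leaves
    the nonnegative paths: there [t (false :: _)] has weight 1 and is killed by [dn], so by
    [dn_up_norm] its squared norm is minus that of its image under [up], hence 0. *)
Lemma highest_weight_eq0 m (j : nat) s t : s ^+ 2 = 1 ->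
  (forall u, size u = m -> wt u != - j%:Z -> t u = 0) ->
  (forall u, size u = m -> dn s t u = 0) ->
  (forall u, size u = m -> nonneg_path j u -> t u = 0) ->
  forall u, size u = m -> t u = 0.
Proof.
elim: m j s t => [|m IH] j s t s1 hw hd hp.
  by case=> [|//] _; apply: hp.
have s1' : (- s) ^+ 2 = 1 by rewrite sqrrN.
have tT : forall u, size u = m -> t (true :: u) = 0.
  apply: (IH j.+1 (- s) (fun w => t (true :: w))) => //= u um.
  - by move=> h; apply: hw; rewrite /= ?um //; apply: contra h; lia.
  - by have := hd (true :: u); rewrite /= add0r um; apply.
  - by move=> h; apply: hp; rewrite /= ?um.
have dF : forall u, size u = m -> dn (- s) (fun w => t (false :: w)) u = 0.
  by move=> u um; have := hd (false :: u); rewrite /= tT // mulr0 add0r um; apply.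
case=> [//|[] u] [um]; first exact: tT.
case: j hw hp => [|j] hw hp; last first.
  apply: (IH j (- s) (fun w => t (false :: w))) => //= w wm.
  - by move=> h; apply: hw; rewrite /= ?wm //; apply: contra h; lia.
  - by move=> h; apply: hp; rewrite /= ?wm.
have hn := dn_up_norm m (fun w => t (false :: w)) s1'.
rewrite (@eq_wsum _ _ m (fun w => dn _ _ w ^+ 2) (fun=> 0)) in hn; last first.
  by move=> w wm; rewrite dF // expr0n.
rewrite wsum0 sub0r in hn.
have e : bsum m (fun w => (wt w)%:~R * t (false :: w) ^+ 2) =
         bsum m (fun w => t (false :: w) ^+ 2).
  apply: eq_wsum => w wm; have [->|h] := eqVneq (wt w) 1; first by rewrite mul1r.
  by rewrite (hw (false :: w)) /= ?wm ?expr0n ?mulr0 //; apply: contra h; lia.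
rewrite e in hn.
have p1 : 0 <= bsum m (fun w => t (false :: w) ^+ 2).
  by apply: bsum_ge0 => w; apply: sqr_ge0.
have p2 : 0 <= bsum m (fun w => up (- s) (fun w0 => t (false :: w0)) w ^+ 2).
  by apply: bsum_ge0 => w; apply: sqr_ge0.
have h0 : bsum m (fun w => t (false :: w) ^+ 2) = 0 by lra.
have := bsum_eq0 (fun w => sqr_ge0 (t (false :: w))) h0 um.
by move/eqP; rewrite sqrf_eq0 => /eqP.
Qed.

End SignedFlips.

(** * Trivial words and noncrossing tensors *)

Section Words.
Variable I : finType.
Implicit Types (x y a b c : I) (k st w : seq I).

(** Left multiplication by a generator on reduced words. The normal form of [k] is obtained by
    letting [k] act on the empty word, so no confluence of a rewriting system has to be shown. *)
Definition push x st := if st is y :: st' then if x == y then st' else x :: st else [:: x].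
Definition act k st := foldr push st k.
Definition red k := act k [::].
(* [trivword k]: the product of the letters of [k] is trivial in the free
   product of copies of Z/2 indexed by [I]. *)
Definition trivword k := red k == [::].
Definition reduced st := sorted (fun x y => x != y) st.

Lemma act_cat k1 k2 st : act (k1 ++ k2) st = act k1 (act k2 st).
Proof. by rewrite /act foldr_cat. Qed.

Lemma reduced_push x st : reduced st -> reduced (push x st).
Proof.
case: st => [//|y st] /=; case: eqVneq => [_|xy] h; last by rewrite /reduced /= xy.
exact: path_sorted h.
Qed.

Lemma reduced_act k st : reduced st -> reduced (act k st).
Proof. by elim: k => [//|x k IH] h; apply/reduced_push/IH. Qed.

Lemma pushK x st : reduced st -> push x (push x st) = st.
Proof.
case: st => [|y st] /=; first by rewrite eqxx.
case: eqVneq => [->|xy] h /=; last by rewrite eqxx.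
by case: st h => [//|z st] /=; case: eqVneq.
Qed.

Lemma act_red k st : reduced st -> act (red k) st = act k st.
Proof.
move=> h; elim: k => [//|x k IH].
rewrite /red /= -/(red k) -IH; move: (reduced_act k (isT : reduced [::])).
rewrite -/(red k); case: (red k) => [//|y r] rr /=.
case: eqVneq => [->|//].
by rewrite pushK // reduced_act.
Qed.

Lemma act_revK k st : reduced st -> act (rev k) (act k st) = st.
Proof.
elim: k st => [//|x k IH] st h.
by rewrite rev_cons -cats1 act_cat /= pushK ?IH ?reduced_act.
Qed.

Lemma trivwordP k : reflect (forall st, reduced st -> act k st = st) (trivword k).
Proof.
apply: (iffP eqP) => [h st hst|h]; last by rewrite /red h.
by rewrite -act_red // h.
Qed.

(** The reversed word acts as the inverse, so when [k ++ k'] is trivial, [k'] and [rev k] have the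
    same normal form. *)
Lemma trivword_catC k1 k2 : trivword (k1 ++ k2) = trivword (k2 ++ k1).
Proof.
suff h k k' : trivword (k ++ k') -> trivword (k' ++ k) by apply/idP/idP; apply: h.
rewrite /trivword /red !act_cat => /eqP h.
have e : red k' = red (rev k).
  rewrite {1}/red -[LHS](act_revK k) ?reduced_act //.
  by rewrite h.
apply/eqP; rewrite -act_red ?reduced_act // e act_red ?reduced_act //.
exact: act_revK.
Qed.

Lemma trivword_insert k1 k2 k : trivword k -> trivword (k1 ++ k ++ k2) = trivword (k1 ++ k2).
Proof.
move/trivwordP => h; rewrite /trivword /red !act_cat h // reduced_act //.
Qed.

Lemma trivword_pair x : trivword [:: x; x].
Proof. by rewrite /trivword /red /= eqxx. Qed.

Lemma mem_act k st x : x \in act k st -> (x \in k) || (x \in st).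
Proof.
elim: k => [->//|y k IH] /=; rewrite in_cons -orbA => h.
have [//|xy] := eqVneq x y; apply: IH; move: h.
case: (act k st) => [|z r] /=; first by rewrite inE (negbTE xy).
case: (y == z); first by rewrite inE => ->; rewrite orbT.
by rewrite in_cons (negbTE xy).
Qed.

Lemma act_fresh c k st : c \notin k -> act k (c :: st) = red k ++ c :: st.
Proof.
elim: k => [//|x k IH] /=; rewrite inE negb_or => /andP[cx ck].
rewrite IH // /red /= -/(red k); case: (red k) => [|y r] /=.
  by rewrite eq_sym (negbTE cx).
by case: (x == y).
Qed.

(** The two displayed [c] are the only ones, so they must cancel each other, and for this everything
    between them must have cancelled before. *)
Lemma trivword_fresh_pair c k1 k k2 :
  c \notin k1 -> c \notin k -> trivword (k1 ++ c :: k ++ c :: k2) -> c \notin k2 -> trivword k.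
Proof.
move=> c1 c0 h c2; apply: contraLR h => h.
rewrite /trivword /red act_cat /= act_cat /= -/(red k2).
have -> : push c (red k2) = c :: red k2.
  move: (@mem_act k2 [::] c); rewrite -/(red k2); case: (red k2) => [//|y r] /=.
  by case: eqVneq => [<-|//]; rewrite mem_head (negbTE c2) => /(_ isT).
rewrite act_fresh //; move: (@mem_act k [::] c); rewrite -/(red k).
move: h; rewrite /trivword; case: (red k) => [//|y r] _ hm.
rewrite cat_cons /=.
move: hm; case: (eqVneq c y) => [<-|cy _]; first by rewrite mem_head (negbTE c0) => /(_ isT).
by rewrite act_fresh //; case: (red k1).
Qed.

Lemma trivword_single c k1 k2 : c \notin k1 -> c \notin k2 -> ~~ trivword (k1 ++ c :: k2).
Proof.
move=> h1 h2; rewrite trivword_catC /=; apply: contraT; rewrite negbK.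
rewrite /trivword /red /= -/(red (k2 ++ k1)).
move: (@mem_act (k2 ++ k1) [::] c); rewrite -/(red _) mem_cat (negbTE h1) (negbTE h2).
case: (red _) => [//|y r].
by rewrite /push; case: (eqVneq c y) => [<-|//]; rewrite mem_head => /(_ isT).
Qed.

Variable R : realFieldType.
Implicit Types f g T : seq I -> R.

(* The derivative at the identity of the rotations of the plane of [a] and [b],
   acting on tensors. *)
Fixpoint X a b f k : R :=
  if k is x :: k' then
    (if x == a then f (b :: k') else if x == b then - f (a :: k') else 0)
    + X a b (fun w => f (x :: w)) k'
  else 0.

Lemma X_cat a b f k1 k2 :
  X a b f (k1 ++ k2) = X a b (fun w => f (w ++ k2)) k1 + X a b (fun w => f (k1 ++ w)) k2.
Proof.
elim: k1 f => [|x k1 IH] f /=; first by rewrite add0r.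
by rewrite IH addrA.
Qed.

Lemma eq_X a b f g k : (forall w, size w = size k -> f w = g w) -> X a b f k = X a b g k.
Proof.
elim: k f g => [//|x k IH] f g h /=; rewrite !h //.
congr (_ + _); apply: IH => w wk; apply: h => /=; by rewrite wk.
Qed.

Lemma X_lin a b (c : R) f g k :
  X a b (fun w => f w + c * g w) k = X a b f k + c * X a b g k.
Proof.
elim: k f g => [|x k IH] f g /=; first by rewrite mulr0 addr0.
rewrite IH; case: eqP => _; first by ring.
by case: eqP => _; ring.
Qed.

Lemma X_sum (J : finType) a b (F : J -> seq I -> R) k :
  X a b (fun w => \sum_j F j w) k = \sum_j X a b (F j) k.
Proof.
rewrite /index_enum; elim: (Finite.enum J) => [|j s IH].
  rewrite big_nil; under eq_X do rewrite big_nil.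
  elim: k {F} => [//|x k IH] /=; rewrite IH oppr0 addr0.
  by case: eqP => // _; case: eqP.
rewrite big_cons -IH -[X in _ = _ + X]mul1r -X_lin.
by apply: eq_X => w _; rewrite big_cons mul1r.
Qed.

(** What is retained of the invariance of xi. The class is stable under [cap] and [ins], so its
    members can be contracted and compared with noncrossing tensors. At a nontrivial word,
    invariance under all finite rotations says that a polynomial in the tangent of the angle
    vanishes identically; the second condition is its linear coefficient. *)
Definition inF f : Prop :=
  (forall k, ~~ trivword k -> f k = 0) /\
  (forall a b k, a != b -> ~~ trivword k -> X a b f k = 0).

(** Contraction of the slots [l] and [l.+1] with the invariant bilinear form. Its adjoint [ins]
    inserts the invariant vector at these slots; they are the caps and cups of the Temperley-Lieb
    calculus. *)
Definition cap l f k : R := \sum_x f (take l k ++ x :: x :: drop l k).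

Definition ins l T k : R :=
  if drop l k is x :: y :: k' then if x == y then T (take l k ++ k') else 0 else 0.

Lemma inF_lin (c : R) f g : inF f -> inF g -> inF (fun w => f w + c * g w).
Proof.
move=> [f1 f2] [g1 g2]; split=> [k h|a b k ab h]; first by rewrite f1 ?g1 // mulr0 addr0.
by rewrite X_lin f2 ?g2 // mulr0 addr0.
Qed.

Lemma eq_cap l f g k : (forall w, size w = (size k).+2 -> f w = g w) -> cap l f k = cap l g k.
Proof.
move=> h; apply: eq_bigr => x _; apply: h.
by rewrite size_cat /= !addnS -size_cat cat_take_drop.
Qed.

(** Rotations preserve the form that is contracted: the derivative of the pair [x :: x], summed over
    [x], is 0 ([h0]). *)
Lemma X_cap a b l f k : a != b ->
  X a b (cap l f) k = \sum_x X a b f (take l k ++ x :: x :: drop l k).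
Proof.
move=> ab.
pose k1 := take l k; pose k2 := drop l k.
have -> : X a b (cap l f) k =
  \sum_x (X a b (fun w => f (w ++ x :: x :: k2)) k1 +
          X a b (fun w => f (k1 ++ x :: x :: w)) k2).
  rewrite big_split /= -!X_sum -{1}(cat_take_drop l k) X_cat.
  congr (_ + _); apply: eq_X => w wk; apply: eq_bigr => x _.
    have e : size w = minn l (size k) by rewrite wk size_take_min.
    have [lk|kl] := leqP l (size k).
      have ew : size w = l by rewrite e; apply/minn_idPl.
      by rewrite take_cat drop_cat ew ltnn subnn take0 drop0 cats0.
    have ew : size w = size k by rewrite e; apply/minn_idPr/ltnW.
    have e2 : k2 = [::] by apply/size0nil; rewrite size_drop; lia.
    have e3 : drop l k = [::] by [].
    by rewrite e3 e2 cats0 take_oversize ?drop_oversize // ew ltnW.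
  have [lk|kl] := leqP l (size k).
    have ew : size (take l k) = l by rewrite size_takel.
    by rewrite take_cat drop_cat ew ltnn subnn take0 drop0 cats0.
  have ew : size w = 0%N by rewrite wk size_drop; lia.
  rewrite (size0nil ew) cats0 take_oversize ?drop_oversize //.
    by rewrite size_take_min; lia.
  by rewrite size_take_min; lia.
have h0 : \sum_x ((if x == a then f (k1 ++ b :: x :: k2)
                   else if x == b then - f (k1 ++ a :: x :: k2) else 0) +
          (if x == a then f (k1 ++ x :: b :: k2)
           else if x == b then - f (k1 ++ x :: a :: k2) else 0)) = 0.
  rewrite (bigD1 a) //= (bigD1 b) 1?eq_sym //= big1 => [|x /andP[/negbTE-> /negbTE->]].
    by rewrite !eqxx eq_sym (negbTE ab) addr0; ring.
  by rewrite addr0.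
rewrite -[LHS]addr0 -[X in _ + X]h0 -big_split /=; apply: eq_bigr => x _.
rewrite -/k1 -/k2 X_cat /= -!addrA; congr (_ + _).
by rewrite addrC -addrA.
Qed.

Lemma inF_cap l f : inF f -> inF (cap l f).
Proof.
move=> [f1 f2]; have h x k : trivword (take l k ++ x :: x :: drop l k) = trivword k.
  rewrite -[x :: x :: _]/([:: x; x] ++ _) trivword_insert ?trivword_pair //.
  by rewrite cat_take_drop.
split=> [k hk|a b k ab hk]; first by apply: big1 => x _; rewrite f1 // h.
by rewrite X_cap //; apply: big1 => x _; rewrite f2 // h.
Qed.

Lemma ins_catE l T k1 k2 : size k1 = l ->
  ins l T (k1 ++ k2) = if k2 is x :: y :: k' then if x == y then T (k1 ++ k') else 0 else 0.
Proof. by move=> <-; rewrite /ins drop_size_cat // take_size_cat. Qed.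

Lemma ins_short l T k : (size k < l.+2)%N -> ins l T k = 0.
Proof.
move=> h; rewrite /ins; have : (size (drop l k) < 2)%N by rewrite size_drop; lia.
by case: (drop l k) => [|x [|y w]].
Qed.

Lemma X_zero a b f k : (forall w, size w = size k -> f w = 0) -> X a b f k = 0.
Proof.
elim: k f => [//|x k IH] f h /=; rewrite !h // oppr0 IH ?addr0.
  by case: eqP => // _; case: eqP.
by move=> w wk; apply: h; rewrite /= wk.
Qed.

(** Dual to [X_cap]: the Kronecker delta at the two slots is rotation invariant. Its derivative
    vanishes term by term when the two letters agree, and by cancellation when they differ. *)
Lemma inF_ins l T : inF T -> inF (ins l T).
Proof.
move=> [T1 T2]; split=> [k hk|a b k ab hk].
  rewrite /ins; move: hk; rewrite -{1}(cat_take_drop l k).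
  case: (drop l k) => [//|x [//|y k']]; case: eqVneq => [->|//] hk.
  by apply: T1; rewrite -(trivword_insert _ _ (trivword_pair y)).
have [lk|] := leqP l.+2 (size k); last first.
  by move=> h; apply: X_zero => w wk; rewrite ins_short // wk.
have [k1 [k2 [ek s1 s2]]] : exists k1 k2, [/\ k = k1 ++ k2, size k1 = l & (1 < size k2)%N].
  exists (take l k), (drop l k); rewrite cat_take_drop size_drop.
  by split; rewrite ?size_takel //; lia.
subst k; case: k2 s2 hk {lk} => [|x [|y k2]] // _ hk.
rewrite X_cat /=.
rewrite (@eq_X _ _ _ (fun w => if x == y then T (w ++ k2) else 0)); last first.
  by move=> w ws; rewrite ins_catE // ws.
rewrite !ins_catE //.
rewrite [X in _ + (_ + (_ + X))](@eq_X _ _ _ (fun w => if x == y then T (k1 ++ w) else 0)); last first.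
  by move=> w ws; rewrite ins_catE.
case: (eqVneq x y) => [xy|xy].
  subst y; have hT : X a b T (k1 ++ k2) = 0.
    by apply: T2 => //; rewrite -(trivword_insert _ _ (trivword_pair x)).
  rewrite X_cat in hT; case: (eqVneq x a) => [xa|xa].
    by rewrite xa eq_sym (negbTE ab) !add0r.
  case: (eqVneq x b) => [xb|xb]; last by rewrite !add0r.
  by rewrite oppr0 !add0r.
rewrite !X_zero // !addr0 add0r.
case: (eqVneq x a) => [xa|xa].
  rewrite xa in xy *; rewrite [y == a]eq_sym (negbTE xy) [b == y]eq_sym.
  by case: (y == b); rewrite ?subrr ?addr0.
case: (eqVneq x b) => [xb|xb].
  rewrite xb in xy *; rewrite [y == b]eq_sym (negbTE xy) [a == y]eq_sym.
  by case: (y == a); rewrite ?addNr ?oppr0 ?addr0.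
by rewrite add0r; case: (y == a) => //; case: (y == b); rewrite ?oppr0.
Qed.

End Words.

(** * Weights of words *)

Section WeightSupport.
Variable R : realFieldType.
Implicit Types (t : seq bool -> R) (u w : seq bool).

Lemma dn_weight (z : int) s t u :
  (forall w, size w = size u -> wt w != z -> t w = 0) -> wt u != z - 2 -> dn s t u = 0.
Proof.
elim: u z s t => [//|d u IH] z s t h hu /=.
rewrite (IH (z - (if d then 1 else -1))) ?addr0.
- case: d h hu => //= h hu; rewrite h ?mulr0 //=; apply: contra hu; lia.
- by move=> w wu hw; apply: h; rewrite /= ?wu //; apply: contra hw; case: (d); lia.
- by apply: contra hu => /=; case: (d); lia.
Qed.

Lemma up_weight (z : int) s t u :
  (forall w, size w = size u -> wt w != z -> t w = 0) -> wt u != z + 2 -> up s t u = 0.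
Proof.
elim: u z s t => [//|d u IH] z s t h hu /=.
rewrite (IH (z - (if d then 1 else -1))) ?addr0.
- case: d h hu => //= h hu; rewrite h ?mulr0 //=; apply: contra hu; lia.
- by move=> w wu hw; apply: h; rewrite /= ?wu //; apply: contra hw; case: (d); lia.
- by apply: contra hu => /=; case: (d); lia.
Qed.

Lemma wt_cat u1 u2 : wt (u1 ++ u2) = wt u1 + wt u2.
Proof. by elim: u1 => [|d u1 IH] /=; rewrite ?add0r // IH addrA. Qed.

Lemma odd_wt u : odd `|wt u| = odd (size u).
Proof. by elim: u => [//|[] u /=]; lia. Qed.

Lemma nonneg_path_wt j u : nonneg_path j u -> 0 <= j%:Z + wt u.
Proof.
elim: u j => [|d u IH] j /=; first by lia.
by case: d => [|]; [move/IH; lia|case: j => [//|j] /IH; lia].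
Qed.

Lemma nonneg_path_catl j u1 u2 : nonneg_path j (u1 ++ u2) -> nonneg_path j u1.
Proof.
elim: u1 j => [//|d u1 IH] j /=; case: d => [|]; first exact: IH.
by case: j => [//|j]; apply: IH.
Qed.

Lemma last_step_down (z : int) (d : bool) :
  z + ((if d then 1 else -1) + 0) = 0 -> 0 <= 0%:Z + z -> d = false /\ z = 1.
Proof. by case: d; lia. Qed.

End WeightSupport.

(** * Words in two letters as paths on a line *)

Section TwoLetters.
Variables (I : finType) (R : realFieldType) (a b : I).
Hypothesis ab : a != b.
Implicit Types (k : seq I) (f g : seq I -> R) (u : seq bool).

(* On the line of reduced words in [a] and [b], [tw] turns directions into
   letters: the edge to the right is [a] at even vertices and [b] at odd ones. *)
Fixpoint tw (c : bool) u : seq I :=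
  if u is d :: u' then (if d == c then a else b) :: tw (~~ c) u' else [::].

Lemma size_tw c u : size (tw c u) = size u.
Proof. by elim: u c => [//|d u IH] c /=; rewrite IH. Qed.

Lemma tw_cat c u1 u2 : tw c (u1 ++ u2) = tw c u1 ++ tw (c (+) odd (size u1)) u2.
Proof.
elim: u1 c => [|d u1 IH] c /=; first by rewrite addbF.
by rewrite IH addbN addNb.
Qed.

Lemma all_tw c u : all (pred2 a b) (tw c u).
Proof.
elim: u c => [//|d u IH] c /=; rewrite IH andbT.
by case: (d == c); rewrite eqxx ?orbT.
Qed.

Lemma tw_surj c k : all (pred2 a b) k -> exists2 u, size u = size k & tw c u = k.
Proof.
elim: k c => [|x k IH] c /=; first by exists [::].
case/andP => hx /(IH (~~ c)) [u su eu].
exists ((if x == a then c else ~~ c) :: u); first by rewrite /= su.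
rewrite /= eu; case/orP: hx => /eqP ->; first by rewrite !eqxx.
by rewrite [b == a]eq_sym (negbTE ab); case: (c).
Qed.

(** Cancelling two equal letters removes a backtrack of the path; what remains is the straight path
    to its endpoint [wt u]. *)
Lemma red_tw c u : red (tw c u) = tw c (nseq `|wt u| (0 < wt u)).
Proof.
elim: u c => [//|d u IH] c.
rewrite [LHS]/= /red /= -/(red (tw (~~ c) u)) IH.
have h (w w' : int) : w' = (if d then 1 else -1) + w ->
    push (if d == c then a else b) (tw (~~ c) (nseq `|w| (0 < w))) =
    tw c (nseq `|w'| (0 < w')).
  move=> ew; case: (ltrgtP w 0) => hw.
  - have -> : `|w|%N = (`|w|.-1).+1%N by lia.
    case: d ew => ew /=.
      have -> : `|w'|%N = `|w|.-1 by lia.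
      have [e|hn] := eqVneq (`|w|.-1)%N 0%N; first by rewrite e; case: c => /=; rewrite ?eqxx.
      have -> : (0 < w') = false by lia.
      by case: c => /=; rewrite ?eqxx.
    have -> : (0 < w') = false by lia.
    have -> : `|w'|%N = (`|w|.-1).+2 by lia.
    by case: c => /=; rewrite ?[b == a]eq_sym ?(negbTE ab).
  - have -> : `|w|%N = (`|w|.-1).+1%N by lia.
    case: d ew => ew /=.
      have -> : (0 < w') = true by lia.
      have -> : `|w'|%N = (`|w|.-1).+2 by lia.
      by case: c => /=; rewrite ?[b == a]eq_sym ?(negbTE ab).
    have -> : `|w'|%N = `|w|.-1 by lia.
    have [e|hn] := eqVneq (`|w|.-1)%N 0%N; first by rewrite e; case: c => /=; rewrite ?eqxx.
    have -> : (0 < w') = true by lia.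
    by case: c => /=; rewrite ?eqxx.
  - by rewrite ew hw /=; case: d {ew}; case: c.
by rewrite (h _ _ erefl).
Qed.

Lemma trivword_tw c u : trivword (tw c u) = (wt u == 0).
Proof.
rewrite /trivword red_tw -size_eq0 size_tw size_nseq; lia.
Qed.

(** A rotation replaces [a] by [b] and [b] by [a] with opposite signs, and [tw] alternates which of
    the two is the step up; this is the source of the alternating sign in [dn] and [up]. *)
Lemma X_tw f c u : X a b f (tw c u) =
  dn (if c then -1 else 1) (fun w => f (tw c w)) u +
  up (if c then 1 else -1) (fun w => f (tw c w)) u.
Proof.
elim: u c f => [|d u IH] c f /=; first by rewrite addr0.
rewrite IH if_neg if_neg.
have -> : - (if c then -1 else 1) = (if c then 1 else -1) :> R by case: (c); rewrite ?opprK.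
have -> : - (if c then 1 else -1) = (if c then -1 else 1) :> R by case: (c); rewrite ?opprK.
by case: d; case: c => /=; rewrite ?eqxx ?[b == a]eq_sym ?(negbTE ab) ?add0r ?mul1r ?mulN1r; ring.
Qed.

(** For [f] of weight 0, the image under [dn] has weight -2 and the image under [up] has weight 2,
    so the derivative at words of weight -2 is [dn] alone. Then [highest_weight_eq0] applies with
    [j = 0]. *)
Lemma two_letter_eq0 m c f :
  (forall u, size u = m -> wt u != 0 -> f (tw c u) = 0) ->
  (forall u, size u = m -> wt u = -2 -> X a b f (tw c u) = 0) ->
  (forall u, size u = m -> wt u = 0 -> nonneg_path 0 u -> f (tw c u) = 0) ->
  forall u, size u = m -> f (tw c u) = 0.
Proof.
move=> hw hX hD.
apply: (@highest_weight_eq0 _ m 0 (if c then -1 else 1) (fun u => f (tw c u))).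
- by case: (c); rewrite ?sqrrN expr1n.
- by rewrite oppr0.
- move=> u um; have h w : size w = size u -> wt w != 0 -> f (tw c w) = 0.
    by rewrite um; apply: hw.
  have [hu|hu] := eqVneq (wt u) (-2); last by apply: (@dn_weight _ 0 _ (fun w => f (tw c w)) u h).
  by have := hX u um hu; rewrite X_tw (@up_weight _ 0 _ (fun w => f (tw c w)) u h) ?hu // addr0.
- by move=> u um hu; have [h|h] := eqVneq (wt u) 0; [apply: hD|apply: hw].
Qed.

Definition vanish2 m f := forall k, size k = m -> all (pred2 a b) k -> f k = 0.

Lemma X_zero_at c d f k : d \notin k ->
  (forall k1 k2, k = k1 ++ c :: k2 -> f (k1 ++ d :: k2) = 0) -> X c d f k = 0.
Proof.
elim: k f => [//|x k IH] f; rewrite inE negb_or => /andP[dx dk] h /=.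
rewrite [x == d]eq_sym (negbTE dx) (IH (fun w => f (x :: w))) // ?addr0.
  by case: (eqVneq x c) h => // -> h; apply: (h [::] k).
by move=> k1 k2 e; apply: (h (x :: k1) k2); rewrite e.
Qed.

(** Triviality of [k1 ++ c :: c :: k2] is that of [k2 ++ k1]. Read cyclically after the pair, [g]
    thus becomes a function [f] of words in [a] and [b] to which [two_letter_eq0] applies, and only
    Dyck paths [V2 ++ V1] remain. For these a rotation of [b] and [c] trades the pair [c :: c] for
    [b :: b], where [g] vanishes. *)
Lemma third_letter_pair_eq0 m c g k1 k2 : a != c -> b != c -> inF g -> vanish2 m.+2 g ->
  (size k1 + size k2)%N = m -> all (pred2 a b) k1 -> all (pred2 a b) k2 ->
  g (k1 ++ c :: c :: k2) = 0.
Proof.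
move=> ac bc [g1 g2] gv sk hk1 hk2.
have cN k : all (pred2 a b) k -> c \notin k.
  move=> h; apply/negP => /(allP h) /=.
  by rewrite eq_sym (negbTE ac) eq_sym (negbTE bc).
pose t := size k2; pose f W := g (drop t W ++ c :: c :: take t W).
have fE V1 V2 : size V2 = t -> f (V2 ++ V1) = g (V1 ++ c :: c :: V2).
  by move=> e; rewrite /f drop_size_cat // take_size_cat.
have Wcat u : size u = m -> exists V1 V2, [/\ tw true u = V2 ++ V1, size V2 = t,
    all (pred2 a b) V1 & all (pred2 a b) V2].
  move=> um; exists (drop t (tw true u)), (take t (tw true u)).
  have := all_tw true u; rewrite -{1}(cat_take_drop t (tw true u)) all_cat => /andP[h1 h2].
  by rewrite cat_take_drop size_takel // size_tw um -sk leq_addl.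
have cl V1 V2 : trivword (V1 ++ c :: c :: V2) = trivword (V2 ++ V1).
  rewrite -[c :: c :: V2]/([:: c; c] ++ V2) trivword_insert ?trivword_pair //.
  exact: trivword_catC.
suff F0 : forall u, size u = m -> f (tw true u) = 0.
  have hall : all (pred2 a b) (k2 ++ k1) by rewrite all_cat hk2.
  have [u su eu] := tw_surj true hall.
  by rewrite -fE // -eu F0 // su size_cat addnC.
apply: two_letter_eq0 => u um.
- have [V1 [V2 [e s2 _ _]]] := Wcat u um.
  by rewrite -(trivword_tw true) e => h; rewrite fE // g1 // cl.
- move=> hu; have [V1 [V2 [e s2 h1 h2]]] := Wcat u um.
  have nc : ~~ trivword (V1 ++ c :: c :: V2) by rewrite cl -e trivword_tw hu.
  have := g2 a b _ ab nc.
  rewrite e !X_cat /= ![c == _]eq_sym (negbTE ac) (negbTE bc) !add0r addrC => <-.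
  congr (_ + _); apply: eq_X => w sw; first by rewrite fE // sw.
  by rewrite fE.
- move=> hu pu; have [V1 [V2 [e s2 h1 h2]]] := Wcat u um; rewrite e fE //.
  (* The letter [c] occurs once here, so the derivative in the plane of [b] and [c] is 0. One of its
     terms is the value sought, one is [g] at a word in [a] and [b]; in the others a further [b] has
     become [c]. *)
  have nc : ~~ trivword (V1 ++ c :: b :: V2).
    by apply: trivword_single; rewrite ?inE ?negb_or ?[c == b]eq_sym ?bc /= cN.
  have := g2 b c _ bc nc; rewrite X_cat /= [c == b]eq_sym (negbTE bc) !eqxx.
  have -> : g (V1 ++ b :: b :: V2) = 0.
    apply: gv; last by rewrite all_cat /= h1 h2 eqxx orbT.
    rewrite size_cat /= !addnS -size_cat -[RHS]/(m.+2).
    by rewrite size_cat addnC -size_cat -e size_tw um.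
  rewrite !X_zero_at ?oppr0 ?add0r ?addr0 ?cN //.
    (* The further [b] lies in [V2]: between the two [c] stands [b :: k3], a step up followed by a
       prefix of a Dyck path. Its weight is positive, so the whole word is nontrivial. *)
    move=> k3 k4 e2; apply: g1; apply/negP => hc.
    have hb : trivword (b :: k3).
      move: h2; rewrite e2 all_cat /= => /and3P[h3 _ h4].
      apply: (@trivword_fresh_pair _ c V1 (b :: k3) k4) => //; try exact: cN.
      by apply: cN; rewrite /= eqxx orbT h3.
    pose u1 := take (size k3) u.
    have e3 : k3 = tw true u1.
      have := tw_cat true u1 (drop (size k3) u).
      rewrite cat_take_drop e e2 -catA => /eqP.
      rewrite eqseq_cat; first by case/andP => /eqP.
      rewrite size_tw size_takel // -(size_tw true) e e2 !size_cat; lia.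
    have := nonneg_path_wt (@nonneg_path_catl 0 u1 (drop (size k3) u) _).
    rewrite cat_take_drop => /(_ pu) hp.
    have := trivword_tw false (true :: u1); rewrite /= -e3 hb; lia.
  (* The further [b] lies in [V1]. If the word were trivial, [k4] would be a closed path, so the
     replaced step would go down from 1 to 0. But a step down from an odd vertex is coloured [a]. *)
  move=> k3 k4 e2; apply: g1; apply/negP => hc.
  have /andP[h3 h4] : all (pred2 a b) k3 && all (pred2 a b) k4.
    by move: h1; rewrite e2 all_cat /= => /and3P[-> _ ->].
  have hb : trivword k4.
    apply: (@trivword_fresh_pair _ c k3 k4 (b :: V2)); try exact: cN.
      by move: hc; rewrite -catA.
    by apply: cN; rewrite /= eqxx orbT h2.
  pose p := (size V2 + size k3)%N.
  have e3 := tw_cat true (take p u) (drop p u).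
  have sp : (p < size u)%N.
    have := congr1 size e; rewrite e2 size_tw !size_cat /= => ->.
    by rewrite /p addnA addnS ltnS leq_addr.
  move: e3; rewrite cat_take_drop e e2 catA size_takel 1?ltnW //.
  move/eqP; rewrite eqseq_cat; last first.
    by rewrite size_tw size_takel 1?ltnW // size_cat.
  case/andP => _ /eqP; case eu : (drop p u) => [|d u3] //= [eb e4].
  have hw : wt u3 = 0 by apply/eqP; rewrite -(trivword_tw (~~ ~~ odd p)) -e4.
  have hu' : wt (take p u) + ((if d then 1 else -1) + wt u3) = 0.
    by rewrite -hu -{2}(cat_take_drop p u) wt_cat eu.
  have := nonneg_path_wt (@nonneg_path_catl 0 (take p u) (drop p u) _).
  rewrite cat_take_drop => /(_ pu) hp.
  have ho := odd_wt (take p u); rewrite size_takel 1?ltnW // in ho.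
  rewrite hw in hu'; have [hd e1] := last_step_down hu' hp; rewrite hd in eb.
  by move: eb; rewrite -ho e1 /= => eb; move: ab; rewrite eb eqxx.
Qed.

(** In the contraction the letters [a] and [b] stay within two-letter words, and every other letter
    is covered by [third_letter_pair_eq0]. *)
Lemma vanish2_cap m l g : inF g -> vanish2 m.+2 g -> vanish2 m (cap l g).
Proof.
move=> gF gv k sk hk; apply: big1 => x _.
have /andP[h1 h2] : all (pred2 a b) (take l k) && all (pred2 a b) (drop l k).
  by rewrite -all_cat cat_take_drop.
have ss : (size (take l k) + size (drop l k))%N = m by rewrite -size_cat cat_take_drop.
have [hx|hx] := boolP (pred2 a b x).
  apply: gv; first by rewrite size_cat /= !addnS ss.
  by rewrite all_cat h1 /= h2 andbT; move: hx => /= ->.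
move: hx; rewrite /= negb_or ![x == _]eq_sym => /andP[xa xb].
exact: (third_letter_pair_eq0 xa xb gF gv ss).
Qed.

End TwoLetters.

(** * Noncrossing tensors on Dyck words *)

Section TemperleyLieb.
Variables (I : finType) (R : realFieldType).
Implicit Types (k w : seq I) (f g T : seq I -> R) (u v : seq bool).

(* The span of the tensors T_pi, pi a noncrossing pairing. *)
Inductive TL : (seq I -> R) -> Prop :=
| TL_nil : TL (fun k => (k == [::])%:R)
| TL_lin f g (c : R) : TL f -> TL g -> TL (fun w => f w + c * g w)
| TL_ins l T : TL T -> TL (ins l T).

Lemma TL_inF T : TL T -> inF T.
Proof.
elim=> [|f g c _ fF _ gF|l {}T _ TF]; [split=> [k|a b k _]|exact: inF_lin|exact: inF_ins].
  by case: k.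
by case: k => [//|x k] _; apply: X_zero; case.
Qed.

Lemma nonneg_path_nseq j l u : nonneg_path j (nseq l true ++ u) = nonneg_path (l + j) u.
Proof. by elim: l j => [//|l IH] j /=; rewrite IH addnS. Qed.

Lemma first_steps_up p u : (p <= find negb u)%N -> u = nseq p true ++ drop p u.
Proof.
elim: u p => [|d u IH] [|p] //=; case: d => //=.
by rewrite ltnS => /IH {1}->.
Qed.

Variables a b : I.
Hypothesis ab : a != b.

(** Since the colours alternate, two neighbouring letters are equal exactly when their steps go in
    opposite directions. *)
Lemma ins_tw l T d1 d2 v :
  ins l T (tw a b true (nseq l true ++ d1 :: d2 :: v)) =
  if d1 == d2 then 0 else T (tw a b true (nseq l true ++ v)).
Proof.
rewrite !tw_cat ins_catE ?size_tw ?size_nseq //= negbK.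
by case: d1; case: d2; case: (odd l) => /=;
  rewrite ?eqxx ?[b == a]eq_sym ?(negbTE ab).
Qed.

(* Every Dyck word is [nseq l true ++ [:: true; false] ++ v], and [ins l] does
   not affect Dyck words whose first peak comes later than [l]. *)
Lemma TL_dyck m (d : seq bool -> R) : exists T, TL T /\
  forall u, size u = m -> nonneg_path 0 u -> wt u = 0 -> T (tw a b true u) = d u.
Proof.
elim/ltn_ind: m d => m IHm d.
case: m IHm => [_|[_|m IHm]].
- exists (fun k => (k == [::])%:R + (d [::] - 1) * (k == [::])%:R).
  split; first by apply: TL_lin; apply: TL_nil.
  by case=> [|//] _ _ _ /=; rewrite mulr1 addrC subrK.
- exists (fun k => (k == [::])%:R); split; first exact: TL_nil.
  by case=> [//|[] [|//]].
(* [find negb u] is the height of the first peak. The bound on it descends by one at each stage, and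
   [T] is corrected by an [ins l S] with [S] taken from the induction on the length; at [L = 0] no
   word of length [m.+2] qualifies. *)
suff h L : (L <= m.+3)%N -> exists T, TL T /\
    forall u, size u = m.+2 -> nonneg_path 0 u -> wt u = 0 ->
    (m.+3 - L <= find negb u)%N -> T (tw a b true u) = d u.
  have [T [TT hT]] := h m.+3 (leqnn _).
  by exists T; split=> // u s n z; apply: hT; rewrite ?subnn.
elim: L => [|L IHL] hL.
  exists (fun k => (k == [::])%:R); split; first exact: TL_nil.
  by move=> u su _ _; have := find_size negb u; rewrite su; lia.
have [T [TT hT]] := IHL (ltnW hL).
have [e|Lm] := eqVneq L m.+2; first subst L.
  exists T; split=> // u su nu zu _; apply: hT => //.
  case: u su nu zu => [//|[] u] //= _ _ _; lia.
pose l := (m.+1 - L)%N; have lE : (m.+3 - L.+1)%N = l.+1 by rewrite /l; lia.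
have lE' : (m.+3 - L)%N = l.+2 by rewrite /l; lia.
have {}hT u : size u = m.+2 -> nonneg_path 0 u -> wt u = 0 ->
  (l.+2 <= find negb u)%N -> T (tw a b true u) = d u.
  by move=> *; apply: hT => //; rewrite lE'.
rewrite lE.
pose ex v := take l v ++ true :: false :: drop l v.
have [S [TS hS]] := IHm m (leqnSn _) (fun v => d (ex v) - T (tw a b true (ex v))).
exists (fun w => T w + 1 * ins l S w); split; first by apply: TL_lin => //; apply: TL_ins.
move=> u su nu zu fu.
have ul := first_steps_up fu.
have e1 : nseq l.+1 true = nseq l true ++ [:: true] by rewrite -addn1 nseqD.
case e2 : (drop l.+1 u) => [|d2 v].
  exfalso; move: zu; rewrite ul e2 cats0 => zu.
  have h p : wt (nseq p true) = p%:Z by elim: p => [//|p IH] /=; rewrite IH; lia.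
  by move: zu; rewrite h; lia.
move: ul; rewrite e2 e1 -catA /= => ul.
rewrite mul1r {2}ul ins_tw; case: d2 e2 ul => e2 ul /=; last first.
  have eu : ex (nseq l true ++ v) = u.
    by rewrite /ex take_size_cat ?drop_size_cat ?size_nseq.
  rewrite hS ?eu; first by rewrite addrC subrK.
  - by move: su; rewrite ul !size_cat /= !addnS => -[].
  - by move: nu; rewrite ul !nonneg_path_nseq.
  - by move: zu; rewrite ul !wt_cat /= => <-; ring.
rewrite addr0; apply: hT => //; rewrite ul.
have -> : nseq l true ++ [:: true, true & v] = nseq l.+2 true ++ v.
  by rewrite -addn2 nseqD -catA.
rewrite find_cat size_nseq; case: ifP => [|_]; last by rewrite leq_addr.
by rewrite has_nseq.
Qed.

End TemperleyLieb.

(** * Pairing with Jones-Wenzl projections *)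

Section JonesWenzl.
Variables (I : finType) (R : realFieldType) (i : I).
Implicit Types (k w : seq I) (f g T : seq I -> R).
Let N : R := #|I|%:R.
(** [br] is the sequence of q-integers for q + q^-1 = -N. [lam r] is the factor left when the first
    slot of the projected power of degree [r.+1] is contracted with the basis vector [i]
    ([E_delta]). *)
Variables (br lam : nat -> R).
Hypotheses (br0 : br 0 = 0) (br1 : br 1 = 1)
  (brSS : forall r, br r.+2 = - N * br r.+1 - br r)
  (br_neq0 : forall r, br r.+1 != 0).
Hypotheses (lam0 : lam 0 = 1)
  (lamS : forall r, lam r.+1 = 1 + lam r * (br r.+1 / br r.+2)).

(* Pairing of [f] with the projection of the [r]-th tensor power of the basis
   vector [i] onto the common kernel of the contractions of neighbours. *)
Fixpoint E r f : R :=
  match r with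
  | 0 => f [::]
  | r1.+1 => match r1 with
    | 0 => f [:: i]
    | r2.+1 => E r1 (fun w => f (i :: w)) +
        lam r2 * \sum_(s < r1) br (r2.+1 - s) / br r2.+2 * E r2 (cap s f)
    end
  end.

Lemma E_SS r f : E r.+2 f = E r.+1 (fun w => f (i :: w)) +
  lam r * \sum_(s < r.+1) br (r.+1 - s) / br r.+2 * E r (cap s f).
Proof. by []. Qed.

Lemma nat_ind2 (P : nat -> Prop) :
  P 0 -> P 1 -> (forall n, P n -> P n.+1 -> P n.+2) -> forall n, P n.
Proof.
move=> P0 P1 PSS n; suff [] : P n /\ P n.+1 by [].
by elim: n => [//|n [? ?]]; split=> //; apply: PSS.
Qed.

Lemma eq_E r f g : (forall w, size w = r -> f w = g w) -> E r f = E r g.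
Proof.
elim/nat_ind2: r f g => [|| r IH0 IH1] f g h; [exact: h|exact: h|].
rewrite !E_SS; congr (_ + _ * _).
  by apply: IH1 => w wr; apply: h; rewrite /= wr.
apply: eq_bigr => s _; congr (_ * _); apply: IH0 => w wr.
by apply: eq_cap => w' sw; apply: h; rewrite sw wr.
Qed.

Lemma E_lin r f g (c : R) : E r (fun w => f w + c * g w) = E r f + c * E r g.
Proof.
elim/nat_ind2: r f g => [//|//|r IH0 IH1] f g.
rewrite !E_SS IH1.
have -> : \sum_(s < r.+1) br (r.+1 - s) / br r.+2 * E r (cap s (fun w => f w + c * g w)) =
  \sum_(s < r.+1) br (r.+1 - s) / br r.+2 * E r (cap s f) +
  c * \sum_(s < r.+1) br (r.+1 - s) / br r.+2 * E r (cap s g).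
  rewrite mulr_sumr -big_split /=; apply: eq_bigr => s _.
  rewrite (@eq_E _ _ (fun w => cap s f w + c * cap s g w)) ?IH0; last first.
    by move=> w _; rewrite /cap mulr_sumr -big_split.
  by ring.
by ring.
Qed.

Lemma E0 r f : (forall w, size w = r -> f w = 0) -> E r f = 0.
Proof.
move=> h; rewrite (@eq_E _ _ (fun w => f w + (-1) * f w)) ?E_lin; last first.
  by move=> w wr; rewrite h // mulr0 addr0.
by rewrite mulN1r subrr.
Qed.

Lemma EZ r (c : R) f : E r (fun w => c * f w) = c * E r f.
Proof.
rewrite (@eq_E _ _ (fun w => 0 + c * f w)) ?E_lin; first by rewrite E0 // add0r.
by move=> w _; rewrite add0r.
Qed.

Definition delta T k : R := if k is x :: k' then if x == i then T k' else 0 else 0.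

Lemma cap0_delta T w : cap 0 (delta T) w = T (i :: w).
Proof.
rewrite /cap (bigD1 i) //= take0 drop0 /= eqxx big1 ?addr0 // => x xi.
by rewrite (negbTE xi).
Qed.

Lemma capS_delta s T w : (0 < size w)%N -> cap s.+1 (delta T) w = delta (cap s T) w.
Proof.
case: w => [//|y w] _; rewrite /cap /=; case: eqP => // _.
by rewrite big1.
Qed.

(** Contraction of slot 0 removes the leading [i], and the other contractions commute with it; the
    two contributions recombine into the recursion for [E] one degree lower. Comparing coefficients
    gives [lamS]. *)
Lemma E_delta r T : E r.+1 (delta T) = lam r * E r T.
Proof.
elim/nat_ind2: r T => [||r IH0 IH1] T.
- by rewrite /= eqxx lam0 mul1r.
- rewrite E_SS big_ord1 subn0 lamS lam0 br1.
  have -> : E 0 (cap (ord0 : 'I_1) (delta T)) = T [:: i] by apply: cap0_delta.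
  by rewrite /= eqxx; ring.
rewrite E_SS big_ord_recl subn0.
have -> : E r.+2 (fun w => delta T (i :: w)) = E r.+2 T.
  by apply: eq_E => w _ /=; rewrite eqxx.
rewrite (@eq_E _ (cap ord0 (delta T)) (fun w => T (i :: w))); last first.
  by move=> w _; apply: cap0_delta.
have -> : \sum_(s < r.+1) br (r.+2 - lift ord0 s) / br r.+3 *
    E r.+1 (cap (lift ord0 s) (delta T)) =
  br r.+2 / br r.+3 * (lam r * \sum_(s < r.+1) br (r.+1 - s) / br r.+2 * E r (cap s T)).
  rewrite !mulr_sumr; apply: eq_bigr => s _.
  rewrite (@eq_E _ _ (delta (cap s T))) ?IH0; last first.
    by move=> w wr; rewrite capS_delta ?wr.
  rewrite lift0 subSS; field.
  by rewrite !br_neq0.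
rewrite -mulrDr -E_SS (lamS r.+1).
by ring.
Qed.

(** The Temperley-Lieb relations between a cap and a cup: here the closed loop with value N;
    [cap_ins_next] and [cap_ins_prev] straighten a zigzag; [cap_ins_right] and [cap_ins_left]
    exchange distant ones. *)
Lemma cap_ins_eq l T w : (l <= size w)%N -> cap l (ins l T) w = N * T w.
Proof.
move=> lw; rewrite /cap (eq_bigr (fun=> T w)) => [|x _].
  by rewrite sumr_const mulr_natl.
by rewrite ins_catE ?size_takel // eqxx cat_take_drop.
Qed.

Lemma split_at l w : (l < size w)%N ->
  exists w1 y w2, w = w1 ++ y :: w2 /\ size w1 = l.
Proof.
move=> lw; exists (take l w), (nth i w l), (drop l.+1 w).
by rewrite -drop_nth // cat_take_drop size_takel // ltnW.
Qed.

Lemma cap_ins_next l T w : (l < size w)%N -> cap l.+1 (ins l T) w = T w.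
Proof.
case/split_at => w1 [y [w2 [-> s1]]]; rewrite /cap.
have e1 : take l.+1 (w1 ++ y :: w2) = w1 ++ [:: y].
  by rewrite take_cat s1 ltnNge leqnSn /= subSnn /= take0.
have e2 : drop l.+1 (w1 ++ y :: w2) = w2.
  by rewrite drop_cat s1 ltnNge leqnSn /= subSnn /= drop0.
rewrite e1 e2 (bigD1 y) //= big1 => [|x xy]; last first.
  by rewrite -catA ins_catE //= eq_sym (negbTE xy).
by rewrite -catA ins_catE //= eqxx addr0.
Qed.

Lemma cap_ins_prev l T w : (l < size w)%N -> cap l (ins l.+1 T) w = T w.
Proof.
case/split_at => w1 [y [w2 [-> s1]]]; rewrite /cap.
rewrite take_size_cat // drop_size_cat // (bigD1 y) //= big1 => [|x xy]; last first.
  by rewrite -cat1s catA ins_catE ?(negbTE xy) // size_cat s1 addn1.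
rewrite -cat1s catA ins_catE ?eqxx ?size_cat ?s1 ?addn1 //.
by rewrite -catA addr0.
Qed.

Lemma split_at2 l w : (l.+1 < size w)%N ->
  exists w1 y z w2, w = w1 ++ y :: z :: w2 /\ size w1 = l.
Proof.
move=> lw; exists (take l w), (nth i w l), (nth i w l.+1), (drop l.+2 w).
by rewrite -!drop_nth ?cat_take_drop ?size_takel // ltnW // ltnW.
Qed.

Lemma cap_ins_right l s T w : (l.+2 <= s)%N -> (s <= size w)%N ->
  cap s (ins l T) w = ins l (cap (s - 2) T) w.
Proof.
move=> ls sw; have /split_at2 [w1 [y [z [w2 [-> s1]]]]] : (l.+1 < size w)%N.
  exact: leq_trans sw.
rewrite ins_catE // /cap.
have es : s = (l + (s - 2 - l).+2)%N by lia.
have e1 : take s (w1 ++ y :: z :: w2) = w1 ++ y :: z :: take (s - 2 - l) w2.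
  by rewrite {1}es take_cat s1 ltnNge leq_addr /= addKn.
have e2 : drop s (w1 ++ y :: z :: w2) = drop (s - 2 - l) w2.
  by rewrite {1}es drop_cat s1 ltnNge leq_addr /= addKn.
have e3 : take (s - 2) (w1 ++ w2) = w1 ++ take (s - 2 - l) w2.
  by rewrite take_cat s1 ltnNge (_ : (l <= s - 2)%N) //; lia.
have e4 : drop (s - 2) (w1 ++ w2) = drop (s - 2 - l) w2.
  by rewrite drop_cat s1 ltnNge (_ : (l <= s - 2)%N) //; lia.
rewrite e1 e2 e3 e4; case: eqP => [yz|yz]; last first.
  by apply: big1 => x _; rewrite -catA ins_catE //=; case: eqP.
by apply: eq_bigr => x _; rewrite -!catA ins_catE //= yz eqxx.
Qed.

Lemma cap_ins_left l s T w : (s.+2 <= l)%N -> (l <= size w)%N ->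
  cap s (ins l T) w = ins (l - 2) (cap s T) w.
Proof.
move=> sl lw; have /split_at2 [w1 [y [z [w2 [-> s1]]]]] : ((l - 2).+1 < size w)%N by lia.
rewrite ins_catE // /cap.
have h V : take s (w1 ++ V) = take s w1.
  by rewrite take_cat s1; case: ltngtP => // [|->]; [lia|rewrite subnn take0 cats0 take_oversize // s1].
have h' V : drop s (w1 ++ V) = drop s w1 ++ V.
  rewrite drop_cat s1; case: ltngtP => // [|es]; first lia.
  by rewrite es subnn drop0 drop_oversize // s1.
rewrite !h !h'.
have e x V : take s w1 ++ x :: x :: (drop s w1 ++ V) =
  (take s w1 ++ x :: x :: drop s w1) ++ V by rewrite -catA.
have sz x : size (take s w1 ++ x :: x :: drop s w1) = l.
  by rewrite size_cat /= !addnS -size_cat cat_take_drop s1; lia.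
case: eqP => [yz|yz]; last first.
  by apply: big1 => x _; rewrite e ins_catE //; case: eqP.
by apply: eq_bigr => x _; rewrite !e ins_catE //= yz eqxx.
Qed.

(** The projection kills cups. In the recursion for [E], contractions far from [l] leave a cup and
    vanish by induction; those at [l] and its neighbours give N and 1, and their coefficients add up
    to 0 by the recurrence of [br]. For [l = 0] the left neighbour is missing: the sum is then -
    [br r.+2], compensated by the term [E r.+1 (delta T)]. *)
Lemma E_ins r l T : (l <= r)%N -> E r.+2 (ins l T) = 0.
Proof.
elim/ltn_ind: r l T => r IH l T lr.
have key (s : 'I_r.+1) : E r (cap s (ins l T)) =
    ((s == l :> nat)%:R * N + (s == l.+1 :> nat)%:R + (s.+1 == l)%:R) * E r T.
  have [sl|sl|sl] := ltngtP s l.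
  - have -> : (s == l.+1 :> nat) = false by lia.
    rewrite mul0r !add0r; have [e|ne] := eqVneq s.+1 l.
      rewrite mul1r; apply: eq_E => w wr; rewrite -e cap_ins_prev // wr; lia.
    rewrite mul0r; case: r IH lr s sl ne => [|[|r]] IH lr s sl ne; try lia.
    rewrite (@eq_E _ _ (ins (l - 2) (cap s T))); first by apply: IH; lia.
    by move=> w wr; apply: cap_ins_left; lia.
  - have -> : (s.+1 == l) = false by lia.
    rewrite mul0r add0r addr0; have [e|ne] := eqVneq (s : nat) l.+1.
      rewrite mul1r; apply: eq_E => w wr; rewrite e cap_ins_next // wr.
      by have := ltn_ord s; lia.
    rewrite mul0r; have := ltn_ord s.
    case: r IH lr s sl ne => [|[|r]] IH lr s sl ne sr; try lia.
    rewrite (@eq_E _ _ (ins l (cap (s - 2) T))); first by apply: IH; lia.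
    by move=> w wr; apply: cap_ins_right; lia.
  - have -> : (s == l.+1 :> nat) = false by lia.
    have -> : (s.+1 == l) = false by lia.
    rewrite mul1r !addr0 -EZ; apply: eq_E => w wr.
    by rewrite sl cap_ins_eq // wr.
have pick p (g : nat -> R) : \sum_(s < r.+1) g s * (s == p :> nat)%:R =
    if (p < r.+1)%N then g p else 0.
  have [pr|pr] := ltnP p r.+1.
    rewrite (bigD1 (Ordinal pr)) //= eqxx mulr1 big1 ?addr0 // => s.
    by rewrite -val_eqE /= => /negbTE->; rewrite mulr0.
  apply: big1 => s _; have -> : (s == p :> nat) = false by have := ltn_ord s; lia.
  by rewrite mulr0.
pose g s := br (r.+1 - s).
have sumE : \sum_(s < r.+1) br (r.+1 - s) / br r.+2 * E r (cap s (ins l T)) =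
   (N * g l + g l.+1 + (if l is l'.+1 then g l' else 0)) / br r.+2 * E r T.
  have -> : g l.+1 = if (l.+1 < r.+1)%N then g l.+1 else 0.
    case: ifP => // h; rewrite /g subSS; have -> : (r - l)%N = 0%N by lia.
    exact: br0.
  have -> : g l = if (l < r.+1)%N then g l else 0 by rewrite ltnS lr.
  have -> : (if l is l'.+1 then g l' else 0) =
            \sum_(s < r.+1) g s * (s.+1 == l)%:R.
    case: (l) lr => [|l'] lr; first by rewrite big1 // => s _; rewrite mulr0.
    under eq_bigr do rewrite eqSS.
    by rewrite pick ltnS ltnW.
  rewrite -!pick mulr_sumr -!big_split /= !mulr_suml.
  by apply: eq_bigr => s _; rewrite key /g; ring.
rewrite E_SS sumE; case: l lr {key sumE} => [|l] lr.
  rewrite (@eq_E _ (fun w => ins 0 T (i :: w)) (delta T)); last first.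
    by case=> [//|x w] _; rewrite /ins /= eq_sym.
  rewrite E_delta addr0 /g subn0 subSS subn0.
  have -> : N * br r.+1 + br r = - br r.+2 by rewrite brSS; ring.
  by rewrite mulNr divff ?br_neq0 // mulN1r mulrN subrr.
rewrite (@eq_E _ _ (ins l (fun w => T (i :: w)))); last first.
  by move=> w _; rewrite /ins /=.
case: r IH lr @g {pick} => [//|r] IH lr g.
rewrite IH // add0r /g.
have -> : (r.+2 - l)%N = (r - l).+2 by lia.
have -> : (r.+2 - l.+1)%N = (r - l).+1 by lia.
have -> : (r.+2 - l.+2)%N = (r - l)%N by lia.
have -> : N * br (r - l).+1 + br (r - l) + br (r - l).+2 = 0 by rewrite brSS; ring.
by rewrite !mul0r mulr0.
Qed.

Lemma E_TL r T : TL T -> (0 < r)%N -> E r T = 0.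
Proof.
move=> TT r0; elim: TT => [|f g c _ IHf _ IHg|l {}T _ _].
- by apply: E0 => -[|x w] //= h; rewrite -h in r0.
- by rewrite E_lin IHf IHg mulr0 addr0.
case: r r0 => [//|[|r]] _; first by apply: E0 => w wr; rewrite ins_short ?wr.
have [lr|lr] := leqP l r; first exact: E_ins.
by apply: E0 => w wr; rewrite ins_short // wr; lia.
Qed.

Definition shift t f w : R := f (nseq t i ++ w).

Lemma cap_shift s t f w : cap s (shift t f) w = shift t (cap (t + s) f) w.
Proof.
rewrite /cap /shift; apply: eq_bigr => x _.
rewrite take_cat drop_cat size_nseq ltnNge leq_addr /= addKn.
by rewrite -catA.
Qed.

Lemma E_shiftS r t f : E r (fun w => shift t f (i :: w)) = E r (shift t.+1 f).
Proof.
by apply: eq_E => w _; rewrite /shift -[t.+1]addn1 nseqD -catA.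
Qed.

(** Unfolded, [E] evaluates iterated contractions of [g] at powers of [i], and these contractions
    still vanish on words in [i] and [b] by [vanish2_cap]. [shift] records the letters [i] already
    split off. *)
Lemma E_vanish2 (b : I) r t g : i != b -> inF g -> vanish2 i b (t + r) g -> E r (shift t g) = 0.
Proof.
move=> ib; have h p : all (pred2 i b) (nseq p i) by rewrite all_nseq /= eqxx orbT.
elim/nat_ind2: r t g => [||r IH0 IH1] t g gF gv.
- by apply: gv; rewrite ?cats0 ?size_nseq ?addn0.
- by apply: gv; rewrite ?size_cat ?size_nseq // all_cat h /= eqxx.
rewrite E_SS E_shiftS IH1 // ?add0r; last by rewrite addSnnS.
rewrite big1 ?mulr0 // => s _.
rewrite (@eq_E _ _ (shift t (cap (t + s) g))); last by move=> w _; apply: cap_shift.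
rewrite IH0 ?mulr0 //; first exact: inF_cap.
by apply: vanish2_cap => //; rewrite -!addnS.
Qed.

(** The noncrossing tensor [T] is only known to agree with [f] on words in [i] and [b]; [E_vanish2]
    makes this enough for [E]. *)
Lemma E_inF (b : I) r f : i != b -> inF f -> (0 < r)%N -> E r f = 0.
Proof.
move=> ib fF r0; have [T [TT hT]] := TL_dyck ib r (fun u => f (tw i b true u)).
pose g w := f w + (-1) * T w.
have gF : inF g by apply: inF_lin => //; apply: TL_inF.
have gv : vanish2 i b r g.
  move=> k kr hk; have [u su <-] := tw_surj ib true hk.
  apply: (@two_letter_eq0 _ _ _ _ ib r true g); last by rewrite su.
  - by move=> v vr h; apply: (proj1 gF); rewrite trivword_tw.
  - by move=> v vr h; apply: (proj2 gF) => //; rewrite trivword_tw // h.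
  - by move=> v vr h1 h2; rewrite /g hT // mulN1r subrr.
rewrite (@eq_E _ _ (fun w => g w + 1 * T w)); last first.
  by move=> w _; rewrite /g mul1r mulN1r subrK.
rewrite E_lin (E_TL TT) // mulr0 addr0.
exact: (@E_vanish2 b r 0 g).
Qed.

Definition jw_coef r : R := lam r * \sum_(s < r.+1) br (r.+1 - s) / br r.+2.

(** A tensor that equals all its contractions turns the sum over [s] into a scalar. For xi this is
    the orthonormality of a column of [u]. *)
Lemma E_moment r t f : (forall l w, cap l f w = f w) ->
  E r.+2 (shift t f) = E r.+1 (shift t.+1 f) + jw_coef r * E r (shift t f).
Proof.
move=> hc; rewrite E_SS E_shiftS /jw_coef -mulrA mulr_suml.
congr (_ + _ * _); apply: eq_bigr => s _; congr (_ * _).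
by apply: eq_E => w _; rewrite cap_shift /shift hc.
Qed.

End JonesWenzl.

(** * The recurrence coefficients *)

Section QNumbers.
Variables (R : realFieldType) (q : R).
Hypothesis q_bounds : -1 < q < 0.

Lemma q_neq0 : q != 0.
Proof. by case/andP: q_bounds => _ h; rewrite lt_eqF. Qed.

Lemma q_norm_lt1 : `|q| < 1.
Proof. by case/andP: q_bounds => h1 h2; rewrite ltr_norml h1 (lt_trans h2). Qed.

Lemma expq_norm_lt1 r : `|q ^+ r.+1| < 1.
Proof. by rewrite normrX exprn_ilt1 // q_norm_lt1. Qed.

Lemma subr1_expq_neq0 r : 1 - q ^+ r.+1 != 0.
Proof.
rewrite subr_eq0; apply/eqP => h; have := expq_norm_lt1 r.
by rewrite -h normr1 ltxx.
Qed.

Lemma addr1_expq_neq0 r : 1 + q ^+ r != 0.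
Proof.
case: r => [|r]; first by rewrite expr0 -[1 + 1]/(2%:R) pnatr_eq0.
rewrite addrC addr_eq0; apply/eqP => h; have := expq_norm_lt1 r.
by rewrite h normrN normr1 ltxx.
Qed.

Definition qbr r : R := (q ^- r - q ^+ r) / (q^-1 - q).
(** The solution of [lamS]: the sum of the first [r.+1] q-integers divided by the last of them
    ([sum_qbr], [qlamE]). *)
Definition qlam r : R :=
  q / ((1 - q) * (1 - q ^+ 2)) * (1 - q ^+ r.+1) * (1 - q ^+ r.+2) * q ^- r.+1 / qbr r.+1.
(** Formally the hyperbolic tangent of -r log(q) / 2, whence the addition law [qtanhD]. *)
Definition qtanh r : R := (1 - q ^+ r) / (1 + q ^+ r).

Lemma subq_neq0 : 1 - q != 0.
Proof. exact: (subr1_expq_neq0 0). Qed.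

Lemma addq_neq0 : 1 + q != 0.
Proof. exact: (addr1_expq_neq0 1). Qed.

Lemma sub1q2E : 1 - q ^+ 2 = (1 - q) * (1 + q).
Proof. by ring. Qed.

Lemma sub1qq_neq0 : 1 - q * q != 0.
Proof. by have := subr1_expq_neq0 1; rewrite expr2. Qed.

Lemma qbrE r : qbr r = q * (1 - q ^+ r * q ^+ r) / (q ^+ r * (1 - q ^+ 2)).
Proof.
rewrite /qbr; have q0 := q_neq0; have h := sub1qq_neq0.
have x0 : q ^+ r != 0 by rewrite expf_neq0.
rewrite sub1q2E; move: (q ^+ r) x0 => x x0.
by field; rewrite q0 x0 subq_neq0 addq_neq0 /= ?mulNr h.
Qed.

Lemma qbr_neq0 r : qbr r.+1 != 0.
Proof.
have e : q ^+ r.+1 * q ^+ r.+1 = q ^+ (2 * r.+1).-1.+1.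
  by rewrite -exprD addnn -mul2n.
rewrite qbrE e !mulf_neq0 ?invr_neq0 ?mulf_neq0 ?q_neq0 ?expf_neq0 ?q_neq0 //;
  exact: subr1_expq_neq0.
Qed.

Lemma qbr0 : qbr 0 = 0.
Proof. by rewrite qbrE expr0 mulr1 subrr mulr0 mul0r. Qed.

Lemma qbr1 : qbr 1 = 1.
Proof.
rewrite qbrE expr1 sub1q2E; field.
by rewrite q_neq0 subq_neq0 addq_neq0.
Qed.

Lemma qbrSS N r : q + q^-1 = - N -> qbr r.+2 = - N * qbr r.+1 - qbr r.
Proof.
move=> <-; rewrite !qbrE sub1q2E !exprS.
have x0 : q ^+ r != 0 by rewrite expf_neq0 ?q_neq0.
move: (q ^+ r) x0 => x x0; field.
by rewrite x0 q_neq0 subq_neq0 addq_neq0.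
Qed.

Definition qmu r : R := q / ((1 - q) * (1 - q ^+ 2)) * (1 - q ^+ r) * (1 - q ^+ r.+1) * q ^- r.

Lemma qmuS r : qmu r.+1 = qbr r.+1 + qmu r.
Proof.
rewrite /qmu qbrE sub1q2E !exprS.
have x0 : q ^+ r != 0 by rewrite expf_neq0 ?q_neq0.
move: (q ^+ r) x0 => x x0; field.
by rewrite x0 q_neq0 subq_neq0 addq_neq0.
Qed.

Lemma sum_qbr r : \sum_(s < r) qbr (r - s) = qmu r.
Proof.
elim: r => [|r IH]; first by rewrite big_ord0 /qmu expr0 subrr mulr0 !mul0r.
by rewrite big_ord_recl subn0 qmuS -IH; congr (_ + _).
Qed.

Lemma qlam0 : qlam 0 = 1.
Proof.
rewrite /qlam qbr1 !expr1 sub1q2E; field.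
by rewrite q_neq0 subq_neq0 addq_neq0.
Qed.

Lemma qlamE r : qlam r = qmu r.+1 / qbr r.+1.
Proof. by []. Qed.

Lemma qlamS r : qlam r.+1 = 1 + qlam r * (qbr r.+1 / qbr r.+2).
Proof. by rewrite !qlamE qmuS; field; rewrite !qbr_neq0. Qed.

(** The contraction sum and [lam] each contribute the factor [qmu r.+1], so the coefficient is its
    square over two consecutive q-integers, and this factors into values of [qtanh]. *)
Lemma qjw_coef N r : q + q^-1 = - N ->
  jw_coef qbr qlam r = - (qtanh r.+1 * qtanh r.+2) / (N + 2).
Proof.
move=> hN; rewrite /jw_coef -mulr_suml sum_qbr qlamE.
(* This is what makes sqrt(N + 2) the right normalisation of [w]. *)
have -> : N + 2 = - (1 - q) ^+ 2 / q.
  have -> : N = - (q + q^-1) by rewrite hN opprK.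
  by field; rewrite q_neq0.
rewrite /qtanh /qmu !qbrE sub1q2E.
have h1 := subr1_expq_neq0 r; have h2 := subr1_expq_neq0 r.+1.
have h3 := addr1_expq_neq0 r.+1; have h4 := addr1_expq_neq0 r.+2.
have x0 : q ^+ r.+1 != 0 by rewrite expf_neq0 ?q_neq0.
rewrite [q ^+ r.+2]exprS in h2 h4 *.
move: (q ^+ r.+1) x0 h1 h2 h3 h4 => x x0 h1 h2 h3 h4.
have e1 : 1 - x * x = (1 - x) * (1 + x) by ring.
have e2 : 1 - q * x * (q * x) = (1 - q * x) * (1 + q * x) by ring.
rewrite e1 e2; field.
by rewrite ?h1 ?h2 ?h3 ?h4 ?x0 ?q_neq0 ?subq_neq0 ?addq_neq0.
Qed.

End QNumbers.

(** To be read with [m t r] the integral of x^t P_r(x), where the monic P_r satisfy x P_(r+1) =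
    P_(r+2) - K_r P_r. The recurrence trades powers of x for the degree of P until [t = 0], so
    orthogonality of P_r to constants fixes all moments. *)
Lemma moment_unique (R : pzRingType) (K : nat -> R) (m1 m2 : nat -> nat -> R) :
  (forall t, m1 t.+1 0 = m1 t 1) -> (forall t r, m1 t.+1 r.+1 = m1 t r.+2 - K r * m1 t r) ->
  (forall t, m2 t.+1 0 = m2 t 1) -> (forall t r, m2 t.+1 r.+1 = m2 t r.+2 - K r * m2 t r) ->
  (forall r, m1 0 r = m2 0 r) -> forall t r, m1 t r = m2 t r.
Proof.
move=> a0 aS b0 bS h; elim=> [|t IH] // [|r]; first by rewrite a0 b0 IH.
by rewrite aS bS !IH.
Qed.

(** * Lambert series *)

Section LambertSeries.
Variables (C : numFieldType) (q : C).
Let rho := `|q|.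
Hypothesis rho_lt1 : rho < 1.
Implicit Types (y : C) (N K t i j : nat).

(** Expanding each term of [alt_sum] geometrically in y and summing over [i] first yields the series
    [lamb]. The rearrangement is carried out on finite sums, through the functional equation in y
    and q y, with explicit remainders. *)
Definition lamb_coef t := q ^+ t.+1 / (1 + q ^+ t.+1).
Definition lamb N y := - \sum_(t < N) (- y) ^+ t * lamb_coef t.
Definition alt_sum K y := \sum_(i < K) (- q) ^+ i.+1 / (1 + q ^+ i.+1 * y).

Lemma rho_ge0 : 0 <= rho. Proof. exact: normr_ge0. Qed.

Lemma sub_rho_gt0 : 0 < 1 - rho. Proof. by rewrite subr_gt0. Qed.

Lemma denom_ge i y : `|y| <= 1 -> 1 - rho <= `|1 + q ^+ i.+1 * y|.
Proof.
move=> y1; rewrite lerBlDr.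
have : `|1 : C| <= `|1 + q ^+ i.+1 * y| + `|q ^+ i.+1 * y|.
  by rewrite -{1}(addrK (q ^+ i.+1 * y) 1); apply: ler_normB.
rewrite normr1 => h; apply: le_trans h _; rewrite lerD2l normrM normrX exprS.
rewrite -[leRHS]mulr1 -mulrA; apply: ler_pM; rewrite ?normr_ge0 ?mulr_ge0 ?exprn_ge0 //.
by rewrite -[leRHS]mulr1; apply: ler_pM; rewrite ?normr_ge0 ?exprn_ge0 ?exprn_ile1 ?rho_ge0 // ltW.
Qed.

Lemma denom_neq0 i y : `|y| <= 1 -> 1 + q ^+ i.+1 * y != 0.
Proof.
move=> y1; rewrite -normr_eq0 gt_eqF //.
exact: lt_le_trans sub_rho_gt0 (denom_ge i y1).
Qed.

Lemma denom1_neq0 i : 1 + q ^+ i.+1 != 0.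
Proof. by have := @denom_neq0 i 1; rewrite mulr1 normr1; apply. Qed.

Lemma div_denom_le i y x : `|y| <= 1 -> `|x / (1 + q ^+ i.+1 * y)| <= `|x| / (1 - rho).
Proof.
move=> y1; rewrite normrM normfV; apply: ler_wpM2l => //.
by rewrite lef_pV2 ?posrE ?sub_rho_gt0 ?denom_ge // normr_gt0 denom_neq0.
Qed.

Lemma geometric_le N : \sum_(t < N) rho ^+ t.+1 <= (1 - rho)^-1.
Proof.
have -> : \sum_(t < N) rho ^+ t.+1 = rho * (1 - rho ^+ N) / (1 - rho).
  elim: N => [|N IH]; first by rewrite big_ord0 expr0 subrr mulr0 mul0r.
  by rewrite big_ord_recr /= IH exprS; field; rewrite gt_eqF ?sub_rho_gt0.
rewrite -[leRHS]mul1r; apply: ler_wpM2r; first by rewrite invr_ge0 ltW ?sub_rho_gt0.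
rewrite -[leRHS]mulr1; apply: ler_pM; rewrite ?rho_ge0 ?(ltW rho_lt1) //.
  by rewrite subr_ge0 exprn_ile1 ?rho_ge0 ?ltW.
by rewrite gerBl exprn_ge0 ?rho_ge0.
Qed.

Lemma lamb_coef_le t : `|lamb_coef t| <= rho ^+ t.+1 / (1 - rho).
Proof.
rewrite /lamb_coef -[in X in X <= _](mulr1 (q ^+ t.+1)) -[X in 1 + X]mulr1 -normrX.
by rewrite mulr1; apply: div_denom_le; rewrite normr1.
Qed.

Lemma lamb_le N y : `|y| <= 1 -> `|lamb N y| <= (1 - rho) ^- 2.
Proof.
move=> y1; rewrite normrN; apply: le_trans (ler_norm_sum _ _ _) _.
apply: (@le_trans _ _ (\sum_(t < N) rho ^+ t.+1 / (1 - rho))).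
  apply: ler_sum => t _; rewrite normrM -[leRHS]mul1r.
  apply: ler_pM; rewrite ?normr_ge0 ?lamb_coef_le //.
  by rewrite normrX normrN exprn_ile1.
rewrite -mulr_suml expr2 invfM; apply: ler_wpM2r; rewrite ?geometric_le //.
by rewrite invr_ge0 ltW ?sub_rho_gt0.
Qed.

(* [lamb_coef t * (1 + q ^+ t.+1) = q ^+ t.+1] turns [lamb N y + q * lamb N (q * y)]
   into a geometric sum. *)
Lemma lamb_shift N y : `|y| <= 1 ->
  - q / (1 + q * y) = lamb N y + q * lamb N (q * y) - q * (- (q * y)) ^+ N / (1 + q * y).
Proof.
move=> y1; have h : 1 + q * y != 0 by have := denom_neq0 0 y1; rewrite expr1.
have -> : lamb N y + q * lamb N (q * y) = - \sum_(t < N) q * (- (q * y)) ^+ t.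
  rewrite /lamb mulrN mulr_sumr -opprD -big_split /=; congr (- _).
  apply: eq_bigr => t _; rewrite -!mulrN [(q * - y) ^+ t]exprMn /lamb_coef exprS.
  have h1 := denom1_neq0 t; rewrite exprS in h1.
  by move: ((- y) ^+ t) (q ^+ t) h1 => a b h1; field.
have -> : - \sum_(t < N) q * (- (q * y)) ^+ t = - q * (1 - (- (q * y)) ^+ N) / (1 + q * y).
  elim: N => [|N IH]; first by rewrite big_ord0 expr0 subrr mulr0 mul0r oppr0.
  rewrite big_ord_recr /= opprD IH exprS.
  by move: ((- (q * y)) ^+ N) => a; field.
by move: ((- (q * y)) ^+ N) => a; field.
Qed.

(** [lamb_shift] at y, q y, ..., q^(K-1) y, telescoped with weights (-q)^i. *)
Lemma alt_sumE N K y : `|y| <= 1 ->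
  alt_sum K y = lamb N y - (- q) ^+ K * lamb N (q ^+ K * y)
    + \sum_(i < K) (- q) ^+ i.+1 * (- (q ^+ i.+1 * y)) ^+ N / (1 + q ^+ i.+1 * y).
Proof.
move=> y1; elim: K => [|K IH].
  by rewrite /alt_sum !big_ord0 !expr0 !mul1r subrr addr0.
rewrite /alt_sum !big_ord_recr /= -/(alt_sum K y) IH.
have yK : `|q ^+ K * y| <= 1.
  rewrite normrM normrX -[leRHS]mulr1; apply: ler_pM; rewrite ?exprn_ge0 ?normr_ge0 //.
  by rewrite exprn_ile1 ?rho_ge0 ?ltW.
have hK := denom_neq0 K y1.
have := lamb_shift N yK; rewrite mulrA -exprS => e.
have -> : (- q) ^+ K.+1 / (1 + q ^+ K.+1 * y) = (- q) ^+ K * (- q / (1 + q ^+ K.+1 * y)).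
  by rewrite exprSr; field.
rewrite e !exprSr; move: ((- q) ^+ K) (lamb _ _) (lamb _ _) (\sum_(i < K) _) => a b c d.
have -> : (- (q ^+ K * q * y)) ^+ N = (- (q ^+ K.+1 * y)) ^+ N by rewrite exprSr.
move: ((- (q ^+ K.+1 * y)) ^+ N) (lamb N (q ^+ K.+1 * y)) => x x'.
rewrite exprSr in hK *.
by field.
Qed.

Lemma alt_sum_lamb N K y : `|y| <= 1 ->
  `|alt_sum K y - lamb N y| <= (rho ^+ K + rho ^+ N) * (1 - rho) ^- 2.
Proof.
move=> y1; rewrite (alt_sumE N K y1).
have -> (a b c : C) : a - b + c - a = c - b by ring.
apply: le_trans (ler_normB _ _) _; rewrite addrC mulrDl; apply: lerD.
  rewrite normrM normrX normrN; apply: ler_wpM2l; first by rewrite exprn_ge0 ?rho_ge0.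
  apply: lamb_le; rewrite normrM normrX -[leRHS]mulr1.
  by apply: ler_pM; rewrite ?exprn_ge0 ?normr_ge0 ?exprn_ile1 ?rho_ge0 ?(ltW rho_lt1).
apply: le_trans (ler_norm_sum _ _ _) _.
apply: (@le_trans _ _ (\sum_(i < K) rho ^+ N * (rho ^+ i.+1 / (1 - rho)))).
  apply: ler_sum => i _; apply: le_trans (div_denom_le _ _ y1) _.
  rewrite mulrA; apply: ler_wpM2r; first by rewrite invr_ge0 ltW ?sub_rho_gt0.
  rewrite mulrC normrM !normrX !normrN normrM normrX; apply: ler_wpM2r.
    by rewrite exprn_ge0 ?rho_ge0.
  apply: lerXn2r; rewrite ?nnegrE ?mulr_ge0 ?exprn_ge0 ?normr_ge0 ?rho_ge0 //.
  rewrite -[leRHS]mulr1; apply: ler_pM; rewrite ?exprn_ge0 ?normr_ge0 //.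
  by rewrite exprS -[leRHS]mulr1 ler_wpM2l ?rho_ge0 // exprn_ile1 ?rho_ge0 ?(ltW rho_lt1).
rewrite -mulr_sumr; apply: ler_wpM2l; first by rewrite exprn_ge0 ?rho_ge0.
rewrite -mulr_suml expr2 invfM; apply: ler_wpM2r; rewrite ?geometric_le //.
by rewrite invr_ge0 ltW ?sub_rho_gt0.
Qed.

Definition tanhq i := (1 - q ^+ i) / (1 + q ^+ i).

(** As 1 - [tanhq t.+1] is twice [lamb_coef t], multiplication by 1 - y^2 produces differences of
    [tanhq] two apart, and 1 - y corrects the first two coefficients. At [j = 0] the truncated
    predecessor contributes [tanhq 0 = 0], the value required. The last two terms are the
    remainder. *)
Lemma lamb_poly N y :
  1 - y + 2 * (1 - y ^+ 2) * lamb N y =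
  \sum_(j < N) (- y) ^+ j * (tanhq j.+1 - tanhq j.-1)
  + (- y) ^+ N * (1 - tanhq N.-1) + (- y) ^+ N.+1 * (1 - tanhq N).
Proof.
elim: N => [|N IH].
  by rewrite /lamb !big_ord0 oppr0 mulr0 expr0 expr1 /tanhq expr0 subrr mul0r; ring.
rewrite big_ord_recr /= /lamb big_ord_recr /= opprD mulrDr addrA -/(lamb N y) IH.
have -> : lamb_coef N = (1 - tanhq N.+1) / 2.
  rewrite /lamb_coef /tanhq; have := denom1_neq0 N; move: (q ^+ N.+1) => x h.
  by field.
rewrite !exprS; move: ((- y) ^+ N) (\sum_(j < N) _) (tanhq _) (tanhq _) (tanhq _).
by move=> a b c d e; field.
Qed.

Lemma one_sub_tanhq_le i : `|1 - tanhq i| <= 2 * rho ^+ i / (1 - rho).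
Proof.
case: i => [|i].
  rewrite /tanhq expr0 subrr mul0r subr0 normr1 mulr1 ler_pdivlMr ?sub_rho_gt0 // mul1r.
  by rewrite lerBlDr -[leLHS]addr0 lerD ?ler1n // rho_ge0.
have -> : 1 - tanhq i.+1 = 2 * lamb_coef i.
  rewrite /lamb_coef /tanhq; have := denom1_neq0 i; move: (q ^+ i.+1) => x h.
  by field.
rewrite normrM ger0_norm // -mulrA; apply: ler_wpM2l => //.
exact: lamb_coef_le.
Qed.

Definition ell i y := q ^+ i / (1 + q ^+ i * y).

Definition summand k y := q ^+ (2 * k) * (1 - q ^+ (2 * k + 1) * y) /
  ((1 + q ^+ (2 * k) * y) * (1 + q ^+ (2 * k + 1) * y) * (1 + q ^+ (2 * k + 2) * y)).

(** The summand times (1 - q)^2 is the second difference ell(2k) - 2 ell(2k+1) + ell(2k+2); the sum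
    is therefore alternating up to its two ends. *)
Lemma sum_summand K y : `|y| <= 1 -> 1 + y != 0 ->
  (1 - q) ^+ 2 * \sum_(k < K) summand k y =
  ell 0 y + 2 * alt_sum (2 * K) y - ell (2 * K) y.
Proof.
move=> y1 hy; elim: K => [|K IH].
  by rewrite muln0 /alt_sum !big_ord0 !mulr0; ring.
rewrite big_ord_recr /= mulrDr IH mulnS add2n /alt_sum !big_ord_recr /= -/(alt_sum _ y).
have d i : 1 + q ^+ i * y != 0 by case: i => [|i]; rewrite ?expr0 ?mul1r // denom_neq0.
have h0 := d (2 * K)%N; have h1 := d (2 * K).+1; have h2 := d (2 * K).+2.
rewrite /summand /ell addn1 addn2 !exprSr.
rewrite !exprSr in h1 h2.
have e : (- q) ^+ (2 * K) = q ^+ (2 * K) by rewrite !exprM sqrrN.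
rewrite e; move: (alt_sum _ _) (q ^+ 0 / _) (q ^+ (2 * K)) h0 h1 h2 => s t x h0 h1 h2.
by field; rewrite h0 h1 h2.
Qed.

Lemma ell_le i y : `|y| <= 1 -> `|ell i.+1 y| <= rho ^+ i.+1 / (1 - rho).
Proof. by move=> y1; rewrite /ell -normrX; apply: div_denom_le. Qed.

End LambertSeries.

(** * Weierstrass approximation *)

Local Open Scope classical_set_scope.
Local Open Scope ring_scope.

Section Weierstrass.
Variable R : realType.
Implicit Types (f : R -> R) (g : nat -> R) (x y : R).

Lemma unif_continuous_itv f (a b e : R) : continuous f -> 0 < e ->
  exists2 d : R, 0 < d &
  forall x y, a <= x <= b -> `|x - y| < d -> `|f x - f y| < e.
Proof.
move=> cf e0.
pose P (d x : R) := forall y, `|x - y| < d -> `|f x - f y| < e.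
have /compact_near_coveringP hc := @segment_compact R a b.
have := hc R (0^'+)%classic P _.
case.
  move=> x _; have e2 : 0 < e / 2 by rewrite divr_gt0.
  have /cvgrPdist_lt /(_ _ e2) [r /= r0 hr] := cf x.
  have r2 : 0 < r / 2 by rewrite divr_gt0.
  exists (ball x (r / 2), [set d | d < r / 2]) => /=.
    split; first exact: nbhsx_ballx.
    exists (r / 2) => //= d; rewrite /= sub0r normrN => h d0.
    by apply: le_lt_trans h; apply: ler_norm.
  case=> x' d /= [hx hd] y hy.
  have h1 := hr x'; have h2 := hr y.
  have k1 : `|f x - f x'| < e / 2 by apply: h1; apply: lt_trans hx _; lra.
  have k2 : `|f x - f y| < e / 2.
    apply: h2; rewrite /=; have := ler_normD (x - x') (x' - y).
    have -> : x - x' + (x' - y) = x - y by ring.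
    move: hx; rewrite /ball /= => hx h; apply: le_lt_trans h _.
    by have := lt_trans hy hd; lra.
  have -> : f x' - f y = (f x - f y) - (f x - f x') by ring.
  by apply: le_lt_trans (ler_normB _ _) _; lra.
move=> d0 /= d0p hd; exists (d0 / 2); first by rewrite divr_gt0.
move=> x y hx hxy; apply: (hd (d0 / 2)) => //.
- by rewrite /= sub0r normrN ger0_norm; lra.
- by lra.
Qed.

(* [bern N g x] is the mean of [g] under the binomial law (N, x), defined by
   conditioning on the first trial. *)
Fixpoint bern N g x : R :=
  if N is N'.+1 then x * bern N' (fun k => g k.+1) x + (1 - x) * bern N' g x else g 0%N.

Fixpoint bern_poly N g : {poly R} :=
  if N is N'.+1 then
    'X * bern_poly N' (fun k => g k.+1) + (1 - 'X) * bern_poly N' g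
  else (g 0%N)%:P.

Lemma bern_polyE N g x : (bern_poly N g).[x] = bern N g x.
Proof.
elim: N g => [|N IH] g /=; first by rewrite hornerC.
by rewrite hornerD !hornerM hornerD hornerN hornerX hornerC !IH.
Qed.

Lemma bern_lin N g1 g2 (c : R) x :
  bern N (fun k => g1 k + c * g2 k) x = bern N g1 x + c * bern N g2 x.
Proof.
elim: N g1 g2 => [//|N IH] g1 g2 /=.
by rewrite (IH (fun k => g1 k.+1) (fun k => g2 k.+1)) IH; ring.
Qed.

Lemma bern_cst N (c x : R) : bern N (fun=> c) x = c.
Proof. elim: N => [//|N IH] /=; rewrite IH; ring. Qed.

Lemma bern_le N g1 g2 x : 0 <= x <= 1 -> (forall k, (k <= N)%N -> g1 k <= g2 k) ->
  bern N g1 x <= bern N g2 x.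
Proof.
move=> /andP[x0 x1]; elim: N g1 g2 => [|N IH] g1 g2 h /=; first exact: h.
apply: lerD; apply: ler_wpM2l; rewrite ?subr_ge0 //; apply: IH => k kN; apply: h => //.
exact: leqW.
Qed.

(** Variance plus squared bias of the binomial law; conditioning on a success replaces [a] by
    [a - 1]. *)
Lemma bern_sqr N (a x : R) :
  bern N (fun k => (k%:R - a) ^+ 2) x = N%:R * x * (1 - x) + (N%:R * x - a) ^+ 2.
Proof.
elim: N a => [|N IH] a /=; first by rewrite mulr0n; ring.
have -> : bern N (fun k => (k.+1%:R - a) ^+ 2) x = bern N (fun k => (k%:R - (a - 1)) ^+ 2) x.
  by congr bern; apply/funext => k; rewrite -natr1; ring.
by rewrite !IH -natr1; ring.
Qed.

(** A quadratic bound on the increments of [f] averages to the binomial variance, and x(1 - x) <= 1.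
    The two signs [c] are treated separately so that only monotonicity of [bern] is called upon. *)
Lemma bern_approx f (K e x : R) N : 0 <= x <= 1 -> 0 <= K ->
  (forall x y, 0 <= x <= 1 -> 0 <= y <= 1 -> `|f x - f y| <= e + K * (x - y) ^+ 2) ->
  `|f x - bern N.+1 (fun k => f (k%:R / N.+1%:R)) x| <= e + K / N.+1%:R.
Proof.
move=> hx K0 hf; set n := N.+1%:R : R.
have n0 : 0 < n by rewrite ltr0n.
have bound k : (k <= N.+1)%N ->
    `|f x - f (k%:R / n)| <= e + K / n ^+ 2 * (k%:R - n * x) ^+ 2.
  move=> kN; apply: le_trans (hf _ _ hx _) _.
    by rewrite divr_ge0 ?ler0n //= ler_pdivrMr // mul1r ler_nat.
  rewrite lerD2l [leRHS](_ : _ = K * (x - k%:R / n) ^+ 2) //.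
  by field; rewrite gt_eqF.
have e1 : bern N.+1 (fun k => e + K / n ^+ 2 * (k%:R - n * x) ^+ 2) x <= e + K / n.
  rewrite bern_lin bern_cst bern_sqr -/n subrr expr0n addr0 lerD2l.
  have -> : K / n ^+ 2 * (n * x * (1 - x)) = K / n * (x * (1 - x)) by field; rewrite gt_eqF.
  rewrite -[leRHS]mulr1; apply: ler_wpM2l; first by rewrite divr_ge0 // ltW.
  by case/andP: hx => x0 x1; nra.
have sgn (c : R) : c = 1 \/ c = -1 ->
    c * (f x - bern N.+1 (fun k => f (k%:R / n)) x) <= e + K / n.
  move=> hc.
  have -> : c * (f x - bern N.+1 (fun k => f (k%:R / n)) x) =
      bern N.+1 (fun k => c * f x + (- c) * f (k%:R / n)) x.
    by rewrite bern_lin bern_cst; ring.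
  apply: le_trans e1; apply: bern_le => // k kN.
  apply: le_trans (bound k kN); rewrite mulNr -mulrBr.
  by case: hc => ->; rewrite ?mul1r ?mulN1r ?ler_norm // -normrN ler_norm.
rewrite ler_norml lerNl; apply/andP; split.
  by rewrite -mulN1r; apply: sgn; right.
by rewrite -[leLHS]mul1r; apply: sgn; left.
Qed.

Lemma weierstrass01 f (e : R) : continuous f -> 0 < e ->
  exists p : {poly R}, forall x, 0 <= x <= 1 -> `|f x - p.[x]| <= e.
Proof.
move=> cf e0; have e2 : 0 < e / 2 by rewrite divr_gt0.
have [d d0 hd] := unif_continuous_itv 0 1 cf e2.
have [B hB] : exists B : R, forall x, 0 <= x <= 1 -> `|f x| <= B.
  have cN : {within `[0%R, 1%R : R], continuous (fun x => `|f x|)}.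
    by apply: continuous_subspaceT => x; apply: cvg_norm; apply: cf.
  have [c _ hc] := EVT_max ler01 cN.
  by exists `|f c| => x hx; apply: hc; rewrite in_itv.
have B0 : 0 <= B by apply: le_trans (hB 0 _); rewrite ?normr_ge0 ?lexx ?ler01.
(* For points at least [d] apart the quadratic term alone reaches 2 B, which bounds any increment of
   [f]. *)
pose K := 2 * B / d ^+ 2.
have K0 : 0 <= K by apply: divr_ge0; [apply: mulr_ge0|apply: exprn_ge0; apply: ltW].
have hf x y : 0 <= x <= 1 -> 0 <= y <= 1 -> `|f x - f y| <= e / 2 + K * (x - y) ^+ 2.
  move=> hx hy; have [h|h] := ltP `|x - y| d.
    apply: le_trans (ltW (hd x y hx h)) _.
    by rewrite lerDl mulr_ge0 ?sqr_ge0.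
  apply: (@le_trans _ _ (2 * B)).
    apply: le_trans (ler_normB _ _) _; have := hB _ hx; have := hB _ hy; lra.
  have : d ^+ 2 <= (x - y) ^+ 2.
    by rewrite -(real_normK (num_real (x - y))) lerXn2r ?nnegrE // ltW.
  move=> h2.
  apply: (@le_trans _ _ (K * d ^+ 2)).
    by rewrite /K divfK // expf_neq0 // gt_eqF.
  by have := ler_wpM2l K0 h2; lra.
pose N := Num.truncn (K / (e / 2)).
exists (bern_poly N.+1 (fun k => f (k%:R / N.+1%:R))) => x hx.
rewrite bern_polyE; apply: le_trans (bern_approx N hx K0 hf) _.
have : K / N.+1%:R <= e / 2.
  rewrite ler_pdivrMr ?ltr0n // mulrC -ler_pdivrMr //.
  by rewrite ltW // truncnS_gt.
by move=> h; rewrite [leRHS]splitr lerD2l.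
Qed.

Lemma weierstrass f (M e : R) : continuous f -> 0 < M -> 0 < e ->
  exists p : {poly R}, forall x, `|x| <= M -> `|f x - p.[x]| <= e.
Proof.
move=> cf M0 e0; pose h y := f (2 * M * y - M).
have ch : continuous h.
  move=> y; apply: continuous_comp; last exact: cf.
  by apply: cvgB; [apply: cvgMl_tmp; apply: cvg_id|apply: cvg_cst].
have [p hp] := weierstrass01 ch e0.
exists (p \Po (((2 * M)^-1)%:P * 'X + (2^-1)%:P)) => x hx.
rewrite horner_comp !hornerE.
have -> : f x = h ((2 * M)^-1 * x + 2^-1).
  by rewrite /h; congr f; field; rewrite gt_eqF.
apply: hp; move: hx; rewrite ler_norml => /andP[h1 h2].
have -> : (2 * M)^-1 * x + 2^-1 = (x + M) / (2 * M) by field; rewrite gt_eqF.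
have M2 : 0 < 2 * M by lra.
have -> /= : 0 <= (x + M) / (2 * M) by apply: divr_ge0; lra.
by rewrite ler_pdivrMr ?mulr_gt0 //; lra.
Qed.

End Weierstrass.

(** * Matrices as a C*-algebra *)

Section ComplexParts.
Variable R : realType.
Implicit Types z : R[i].

Lemma ReD z1 z2 : complex.Re (z1 + z2) = complex.Re z1 + complex.Re z2.
Proof. by case: z1; case: z2. Qed.

Lemma ImD z1 z2 : complex.Im (z1 + z2) = complex.Im z1 + complex.Im z2.
Proof. by case: z1; case: z2. Qed.

Lemma Re_sum (I : Type) (r : seq I) (P : pred I) (F : I -> R[i]) :
  complex.Re (\sum_(i <- r | P i) F i) = \sum_(i <- r | P i) complex.Re (F i).
Proof. by apply: (big_morph _ ReD). Qed.

Definition nz z : R := complex.Re z ^+ 2 + complex.Im z ^+ 2.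

Lemma nz_ge0 z : 0 <= nz z.
Proof. by rewrite addr_ge0 ?sqr_ge0. Qed.

Lemma nz_eq0 z : nz z = 0 -> z = 0.
Proof.
case: z => a b /eqP; rewrite paddr_eq0 ?sqr_ge0 // !sqrf_eq0 /=.
by case/andP => /eqP-> /eqP->.
Qed.

Lemma nzM z1 z2 : nz (z1 * z2) = nz z1 * nz z2.
Proof. by case: z1 => a b; case: z2 => c d; rewrite /nz /=; ring. Qed.

Lemma Re_norm z : complex.Re `|z| = Num.sqrt (nz z).
Proof. by rewrite normc_def. Qed.

Lemma Re_conj_mul z : complex.Re (z^*%C * z) = nz z.
Proof. by case: z => a b; rewrite /nz /=; ring. Qed.

Lemma real_CauchySchwarz (I : finType) (a b : I -> R) :
  (\sum_i a i * b i) ^+ 2 <= (\sum_i a i ^+ 2) * (\sum_i b i ^+ 2).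
Proof.
set A := \sum_i a i ^+ 2; set B := \sum_i b i ^+ 2; set c := \sum_i a i * b i.
have A0 : 0 <= A by apply: sumr_ge0 => i _; apply: sqr_ge0.
have [Az|An] := eqVneq A 0.
  have a0 i : a i = 0.
    move/eqP: Az; rewrite psumr_eq0 => [/allP /(_ i)|j _]; last exact: sqr_ge0.
    by rewrite mem_index_enum sqrf_eq0 => /(_ isT) /eqP.
  by rewrite Az mul0r /c big1 ?expr0n // => i _; rewrite a0 mul0r.
have : 0 <= \sum_i (A * b i - c * a i) ^+ 2 by apply: sumr_ge0 => i _; apply: sqr_ge0.
have -> : \sum_i (A * b i - c * a i) ^+ 2 = A * (A * B - c ^+ 2).
  have -> : \sum_i (A * b i - c * a i) ^+ 2 =
    \sum_i (A ^+ 2 * b i ^+ 2 + (- 2 * A * c * (a i * b i) + c ^+ 2 * a i ^+ 2)).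
    by apply: eq_bigr => i _; ring.
  rewrite !big_split /= -!mulr_sumr -/A -/B -/c; ring.
by rewrite pmulr_rge0 ?subr_ge0 // lt_def An.
Qed.

End ComplexParts.

Section MatrixNorm.
Variables (R : realType) (n : nat).
Notation C := R[i].
Implicit Types (x y : 'cV[C]_n.+1) (M : 'M[C]_n.+1).

Definition vsq x : R := \sum_i nz (x i 0).
Definition vnorm x : R := Num.sqrt (vsq x).
Definition rdot x y : R := complex.Re (\sum_i (x i 0)^*%C * y i 0).

Lemma vsq_ge0 x : 0 <= vsq x.
Proof. by apply: sumr_ge0 => i _; apply: nz_ge0. Qed.

Lemma sqr_vnorm x : vnorm x ^+ 2 = vsq x.
Proof. by rewrite sqr_sqrtr ?vsq_ge0. Qed.

Lemma vnorm_ge0 x : 0 <= vnorm x.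
Proof. exact: sqrtr_ge0. Qed.

(** The real Cauchy-Schwarz inequality, after splitting each complex coordinate into two real ones
    indexed by a boolean. *)
Lemma rdot_le x y : rdot x y <= vnorm x * vnorm y.
Proof.
pose f (z : 'cV[C]_n.+1) (p : 'I_n.+1 * bool) :=
  if p.2 then complex.Re (z p.1 0) else complex.Im (z p.1 0).
have e (g : 'I_n.+1 * bool -> R) : \sum_p g p = \sum_i (g (i, true) + g (i, false)).
  rewrite (eq_bigr (fun p => g (p.1, p.2))) => [|[] //].
  rewrite -(pair_bigA _ (fun i b => g (i, b))) /=.
  by apply: eq_bigr => i _; rewrite big_bool.
have e1 : rdot x y = \sum_p f x p * f y p.
  rewrite e /rdot Re_sum; apply: eq_bigr => i _ /=.
  by rewrite /f /=; case: (x i 0) => a b; case: (y i 0) => c d /=; ring.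
have e2 z : vsq z = \sum_p f z p ^+ 2 by rewrite e.
apply: le_trans (ler_norm _) _.
rewrite -(ler_pXn2r (ltn0Sn 1)) ?nnegrE ?mulr_ge0 ?vnorm_ge0 //.
by rewrite real_normK ?num_real // exprMn !sqr_vnorm e1 !e2 real_CauchySchwarz.
Qed.

Lemma vnormD x y : vnorm (x + y) <= vnorm x + vnorm y.
Proof.
rewrite -(ler_pXn2r (ltn0Sn 1)) ?nnegrE ?addr_ge0 ?vnorm_ge0 //.
have -> : vnorm (x + y) ^+ 2 = vnorm x ^+ 2 + vnorm y ^+ 2 + 2 * rdot x y.
  rewrite !sqr_vnorm /vsq /rdot Re_sum mulr_sumr -!big_split /=.
  apply: eq_bigr => i _; rewrite mxE /nz.
  by case: (x i 0) => a b; case: (y i 0) => c d /=; ring.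
have := rdot_le x y; rewrite sqrrD; nra.
Qed.

Lemma vnormZ (c : C) x : vnorm (c *: x) = complex.Re `|c| * vnorm x.
Proof.
rewrite Re_norm /vnorm -sqrtrM ?nz_ge0 // /vsq mulr_sumr.
by congr Num.sqrt; apply: eq_bigr => i _; rewrite mxE nzM.
Qed.

Lemma vnorm0 : vnorm 0 = 0.
Proof.
by rewrite /vnorm /vsq big1 ?sqrtr0 // => i _; rewrite mxE /nz /= expr0n addr0.
Qed.

Lemma vnorm_eq0 x : vnorm x = 0 -> x = 0.
Proof.
move=> h; have : vsq x = 0 by rewrite -sqr_vnorm h expr0n.
move/eqP; rewrite psumr_eq0 => [/allP h2|i _]; last exact: nz_ge0.
apply/colP => i; rewrite mxE; apply: nz_eq0; apply/eqP.
by have := h2 i; rewrite mem_index_enum; apply.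
Qed.

Lemma vnorm_coord x i : Num.sqrt (nz (x i 0)) <= vnorm x.
Proof.
rewrite ler_sqrt ?vsq_ge0 // /vsq (bigD1 i) //= lerDl.
by apply: sumr_ge0 => j _; apply: nz_ge0.
Qed.

Definition adj M : 'M[C]_n.+1 := (map_mx conjc M)^T.

Lemma rdot_adj M x y : rdot (M *m x) y = rdot x (adj M *m y).
Proof.
rewrite /rdot; congr complex.Re.
under eq_bigr => i _ do rewrite mxE rmorph_sum mulr_suml.
under [RHS]eq_bigr => i _ do rewrite mxE mulr_sumr.
rewrite exchange_big /=; apply: eq_bigr => j _; apply: eq_bigr => i _.
by rewrite !mxE rmorphM /=; ring.
Qed.

Lemma rdotxx x : rdot x x = vnorm x ^+ 2.
Proof.
by rewrite sqr_vnorm /rdot Re_sum; apply: eq_bigr => i _; rewrite Re_conj_mul.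
Qed.

Definition opset M : set R := [set vnorm (M *m x) | x in [set x | vnorm x <= 1]].
Definition opnorm M : R := sup (opset M).

Definition entry_sum M : R := \sum_i \sum_j Num.sqrt (nz (M i j)).

Lemma vnorm_sum (J : finType) (F : J -> 'cV[C]_n.+1) :
  vnorm (\sum_j F j) <= \sum_j vnorm (F j).
Proof.
apply: (big_ind2 (fun x r => vnorm x <= r)) => //; first by rewrite vnorm0.
by move=> x r y s h1 h2; apply: le_trans (vnormD _ _) _; apply: lerD.
Qed.

Lemma vnorm_delta (i : 'I_n.+1) : vnorm (delta_mx i 0) = 1.
Proof.
rewrite /vnorm /vsq (bigD1 i) //= big1 => [|j ji].
  by rewrite mxE !eqxx /nz /= expr1n expr0n !addr0 sqrtr1.
by rewrite mxE (negbTE ji) /nz /= expr0n addr0.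
Qed.

Lemma vnorm_mul_le M x : vnorm x <= 1 -> vnorm (M *m x) <= entry_sum M.
Proof.
move=> x1; have -> : M *m x = \sum_i \sum_j (M i j * x j 0) *: delta_mx i 0.
  apply/colP => i; rewrite mxE summxE [RHS](bigD1 i) //= summxE [X in _ = _ + X]big1 => [|k ki].
    by rewrite addr0; apply: eq_bigr => j _; rewrite !mxE !eqxx mulr1.
  by rewrite summxE big1 // => j _; rewrite !mxE eq_sym (negbTE ki) mulr0.
apply: le_trans (vnorm_sum _) _; apply: ler_sum => i _.
apply: le_trans (vnorm_sum _) _; apply: ler_sum => j _.
rewrite vnormZ vnorm_delta mulr1 Re_norm nzM sqrtrM ?nz_ge0 //.
by rewrite ler_piMr ?sqrtr_ge0 //; apply: le_trans x1; apply: vnorm_coord.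
Qed.

Lemma opset_sup M : has_sup (opset M).
Proof.
split; first by exists (vnorm (M *m 0)), 0 => //=; rewrite vnorm0.
by exists (entry_sum M) => r [x /= x1 <-]; apply: vnorm_mul_le.
Qed.

Lemma opnorm_ub M x : vnorm x <= 1 -> vnorm (M *m x) <= opnorm M.
Proof. by move=> x1; apply: ub_le_sup; [case: (opset_sup M)|exists x]. Qed.

Lemma opnorm_le M (r : R) : (forall x, vnorm x <= 1 -> vnorm (M *m x) <= r) -> opnorm M <= r.
Proof.
by move=> h; apply: ge_sup; [case: (opset_sup M)|move=> s [x /= x1 <-]; apply: h].
Qed.

Lemma opnorm_ge0 M : 0 <= opnorm M.
Proof.
by apply: le_trans (@opnorm_ub M 0 _); rewrite ?vnorm0 ?vnorm_ge0.
Qed.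

Lemma opnorm_mul M x : vnorm (M *m x) <= opnorm M * vnorm x.
Proof.
have [x0|x0] := eqVneq (vnorm x) 0.
  by rewrite (vnorm_eq0 x0) mulmx0 vnorm0 mulr0.
have xp : 0 < vnorm x by rewrite lt_def x0 vnorm_ge0.
rewrite -ler_pdivrMr // mulrC.
have nc : complex.Re `|((vnorm x)^-1)%:C| = (vnorm x)^-1.
  by rewrite normc_def /= expr0n addr0 sqrtr_sqr ger0_norm // invr_ge0 ltW.
rewrite -nc -vnormZ scalemxAr; apply: opnorm_ub.
by rewrite vnormZ nc mulVf.
Qed.

Lemma opnorm_eq0 M : opnorm M = 0 -> M = 0.
Proof.
move=> h; have hx x : M *m x = 0.
  apply: vnorm_eq0; apply/eqP; rewrite eq_le vnorm_ge0 andbT.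
  by have := opnorm_mul M x; rewrite h mul0r.
apply/matrixP => i j; have := hx (delta_mx j 0) => /colP /(_ i).
by rewrite !mxE (bigD1 j) //= big1 => [|k kj];
  rewrite ?mxE ?eqxx ?mulr1 ?addr0 // (negbTE kj) mulr0.
Qed.

Lemma opnormD M1 M2 : opnorm (M1 + M2) <= opnorm M1 + opnorm M2.
Proof.
apply: opnorm_le => x x1; rewrite mulmxDl.
by apply: le_trans (vnormD _ _) _; apply: lerD; apply: opnorm_ub.
Qed.

Lemma opnormZ_le (c : C) M : opnorm (c *: M) <= complex.Re `|c| * opnorm M.
Proof.
apply: opnorm_le => x x1; rewrite -scalemxAl vnormZ.
by apply: ler_wpM2l; [rewrite Re_norm sqrtr_ge0|apply: opnorm_ub].
Qed.

Lemma opnormZ (c : C) M : opnorm (c *: M) = complex.Re `|c| * opnorm M.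
Proof.
apply/eqP; rewrite eq_le opnormZ_le andTb.
have [->|c0] := eqVneq c 0.
  by rewrite Re_norm /nz /= expr0n addr0 sqrtr0 mul0r opnorm_ge0.
have cp : 0 < complex.Re `|c|.
  rewrite Re_norm sqrtr_gt0 lt_def nz_ge0 andbT.
  by apply: contra c0 => /eqP /nz_eq0 ->.
rewrite mulrC -ler_pdivlMr // mulrC.
have h : complex.Re `|c^-1| = (complex.Re `|c|)^-1.
  have e : complex.Re `|c^-1| * complex.Re `|c| = 1.
    rewrite !Re_norm -sqrtrM ?nz_ge0 // -nzM mulVf // /nz /=.
    by rewrite expr1n expr0n addr0 sqrtr1.
  by rewrite -[RHS]mul1r -e mulfK // gt_eqF.
by rewrite -h; apply: le_trans (opnormZ_le _ _); rewrite scalerA mulVf // scale1r.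
Qed.

Lemma opnormM M1 M2 : opnorm (M1 *m M2) <= opnorm M1 * opnorm M2.
Proof.
apply: opnorm_le => x x1; rewrite -mulmxA; apply: le_trans (opnorm_mul _ _) _.
by rewrite ler_wpM2l ?opnorm_ge0 ?opnorm_ub.
Qed.

Lemma adjK M : adj (adj M) = M.
Proof. by apply/matrixP => i j; rewrite !mxE conjcK. Qed.

(** The squared norm of M x is the inner product of x with [adj M *m M] applied to x. *)
Lemma opnorm_adj_sq M : opnorm M ^+ 2 <= opnorm (adj M *m M).
Proof.
have h x : vnorm x <= 1 -> vnorm (M *m x) ^+ 2 <= opnorm (adj M *m M).
  move=> x1; rewrite -rdotxx rdot_adj mulmxA; apply: le_trans (rdot_le _ _) _.
  rewrite -[leRHS]mul1r; apply: ler_pM; rewrite ?vnorm_ge0 ?opnorm_ub //.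
rewrite -[leRHS]sqr_sqrtr ?opnorm_ge0 // ler_pXn2r ?nnegrE ?opnorm_ge0 ?sqrtr_ge0 //.
apply: opnorm_le => x x1; rewrite -[leLHS]ger0_norm ?vnorm_ge0 // -sqrtr_sqr.
by rewrite ler_sqrt ?opnorm_ge0 ?h.
Qed.

Lemma opnorm_adj M : opnorm (adj M) = opnorm M.
Proof.
have h M' : opnorm M' <= opnorm (adj M').
  have := le_trans (opnorm_adj_sq M') (opnormM _ _); rewrite expr2.
  have [->|p] := eqVneq (opnorm M') 0; first by rewrite opnorm_ge0.
  by rewrite ler_pM2r // lt_def p opnorm_ge0.
by apply/eqP; rewrite eq_le h andbT -{2}(adjK M) h.
Qed.

Lemma opnorm_cstar M : opnorm (adj M *m M) = opnorm M ^+ 2.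
Proof.
apply/eqP; rewrite eq_le opnorm_adj_sq andbT.
by apply: le_trans (opnormM _ _) _; rewrite opnorm_adj expr2.
Qed.

Lemma opnorm_entry M i j : Num.sqrt (nz (M i j)) <= opnorm M.
Proof.
have -> : M i j = (M *m (delta_mx j 0 : 'cV[C]_n.+1)) i 0.
  rewrite mxE (bigD1 j) //= big1 => [|k kj]; first by rewrite mxE !eqxx mulr1 addr0.
  by rewrite mxE (negbTE kj) mulr0.
by apply: le_trans (vnorm_coord _ _) _; rewrite opnorm_ub // vnorm_delta.
Qed.

Lemma opnorm_le_entries M : opnorm M <= entry_sum M.
Proof. by apply: opnorm_le => x; apply: vnorm_mul_le. Qed.

End MatrixNorm.

Lemma real_cauchy_cvg (R : realType) (u : nat -> R) :
  (forall e, 0 < e -> exists N, forall m p, (N <= m)%N -> (N <= p)%N -> `|u m - u p| < e) ->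
  exists l, forall e, 0 < e -> exists N, forall m, (N <= m)%N -> `|u m - l| < e.
Proof.
move=> hu; have : cvgn u.
  apply/cauchy_cvgP/cauchy_exP => e e0; have [N hN] := hu e e0.
  by exists (u N), N => // m /= Nm; rewrite /ball /= hN.
move=> /cvg_ex [l /cvgrPdist_lt ul]; exists l => e e0.
have [N _ hN] := ul e e0; exists N => m Nm.
by rewrite distrC hN.
Qed.

Lemma common_rank (I : finType) (P : I -> nat -> Prop) :
  (forall i, exists N, forall m, (N <= m)%N -> P i m) ->
  exists N, forall i m, (N <= m)%N -> P i m.
Proof.
move=> /boolp.choice [N hN]; exists (\max_i N i)%N => i m h.
by apply: hN; apply: leq_trans h; apply: leq_bigmax.
Qed.

Lemma opnorm_complete (R : realType) (n : nat) (a : nat -> 'M[R[i]]_n.+1) :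
  (forall e : R, 0 < e -> exists N, forall m p,
     (N <= m)%N -> (N <= p)%N -> opnorm (a m - a p) < e) ->
  exists l, forall e : R, 0 < e -> exists N, forall m, (N <= m)%N -> opnorm (a m - l) < e.
Proof.
move=> ha.
have part (f : R[i] -> R) : (forall z1 z2, f (z1 - z2) = f z1 - f z2) ->
    (forall z, `|f z| <= Num.sqrt (nz z)) -> forall i j,
    exists l, forall e, 0 < e -> exists N, forall m, (N <= m)%N -> `|f (a m i j) - l| < e.
  move=> fB fle i j; apply: real_cauchy_cvg => e e0.
  have [N hN] := ha e e0; exists N => m p Nm Np.
  rewrite -fB; apply: le_lt_trans (hN m p Nm Np).
  apply: le_trans (fle _) _; apply: le_trans (opnorm_entry _ i j).
  by rewrite !mxE.
have pR : forall z1 z2 : R[i], complex.Re (z1 - z2) = complex.Re z1 - complex.Re z2.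
  by move=> [? ?] [? ?].
have pI : forall z1 z2 : R[i], complex.Im (z1 - z2) = complex.Im z1 - complex.Im z2.
  by move=> [? ?] [? ?].
have nR (z : R[i]) : `|complex.Re z| <= Num.sqrt (nz z).
  by rewrite -sqrtr_sqr ler_sqrt ?nz_ge0 // lerDl sqr_ge0.
have nI (z : R[i]) : `|complex.Im z| <= Num.sqrt (nz z).
  by rewrite -sqrtr_sqr ler_sqrt ?nz_ge0 // lerDr sqr_ge0.
have [lr hlr] := boolp.choice (fun p : 'I_n.+1 * 'I_n.+1 => part _ pR nR p.1 p.2).
have [li hli] := boolp.choice (fun p : 'I_n.+1 * 'I_n.+1 => part _ pI nI p.1 p.2).
exists (\matrix_(i, j) (lr (i, j) +i* li (i, j))) => e e0.
have [k [ek k0]] : exists k : R, n.+1%:R = k /\ 0 < k by exists n.+1%:R; rewrite ltr0n.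
(* There are k^2 entries; real and imaginary parts within [d] put each modulus below 3 d. *)
pose d : R := e / (k * k * 3).
have d0 : 0 < d by rewrite divr_gt0 // !mulr_gt0.
have [N1 hN1] := common_rank (fun p => hlr p d d0).
have [N2 hN2] := common_rank (fun p => hli p d d0).
exists (maxn N1 N2) => m; rewrite geq_max => /andP[m1 m2].
apply: le_lt_trans (opnorm_le_entries _) _.
have -> : e = \sum_(i < n.+1) \sum_(j < n.+1) (d * 3).
  rewrite sumr_const card_ord sumr_const card_ord -[RHS]mulr_natr -[X in _ = X * _]mulr_natr ek /d.
  by field; rewrite gt_eqF.
have h i j : Num.sqrt (nz ((a m - \matrix_(i, j) (lr (i, j) +i* li (i, j))) i j)) < d * 3.
  have p3 : 0 < d * 3 by apply: mulr_gt0.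
  have -> : d * 3 = Num.sqrt ((d * 3) ^+ 2) by rewrite sqrtr_sqr ger0_norm // ltW.
  rewrite ltr_sqrt ?exprn_gt0 //.
  have := hN1 (i, j) m m1; have := hN2 (i, j) m m2; rewrite /= !mxE.
  case: (a m i j) => x y /=; rewrite /nz /= !ltr_norml => /andP[? ?] /andP[? ?].
  have : (x - lr (i, j)) ^+ 2 < d ^+ 2 by nra.
  have : (y - li (i, j)) ^+ 2 < d ^+ 2 by nra.
  by have : 0 < d ^+ 2 by [rewrite exprn_gt0]; rewrite exprMn; nra.
have ne : has xpredT (index_enum 'I_n.+1).
  by apply/hasP; exists ord0; rewrite ?mem_index_enum.
by apply: ltr_sum => // i _; apply: ltr_sum.
Qed.

Lemma adjD (R : realType) (n : nat) (x y : 'M[R[i]]_n.+1) : adj (x + y) = adj x + adj y.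
Proof. by apply/matrixP => i j; rewrite !mxE rmorphD. Qed.

Lemma adjZ (R : realType) (n : nat) (c : R[i]) (x : 'M[R[i]]_n.+1) :
  adj (c *: x) = c^*%C *: adj x.
Proof. by apply/matrixP => i j; rewrite !mxE rmorphM. Qed.

Lemma adjM (R : realType) (n : nat) (x y : 'M[R[i]]_n.+1) : adj (x * y) = adj y * adj x.
Proof.
apply/matrixP => i j; rewrite !mxE rmorph_sum; apply: eq_bigr => k _.
by rewrite !mxE rmorphM mulrC.
Qed.

(** The universal property of A_o(n) speaks of C*-algebras, so the matrix algebras containing the
    test entries must carry this structure, completeness included. *)
HB.instance Definition _ (R : realType) (n : nat) :=
  isCStarAlgebra.Build R 'M[R[i]]_n.+1
    (@adjK R n) (@adjD R n) (@adjZ R n) (@adjM R n)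
    (@opnorm_eq0 R n) (@opnormZ R n) (@opnormD R n) (@opnormM R n)
    (@opnorm_cstar R n) (@opnorm_complete R n).

Lemma starE (R : realType) (n : nat) (x : 'M[R[i]]_n.+1) : star x = adj x.
Proof. by []. Qed.

(** * Invariance of the Haar state *)

Section WordEntries.
Variables (I : finType) (B : pzRingType).
Implicit Types (v : I -> I -> B) (k w : seq I).

Fixpoint entry v k w : B :=
  match k, w with
  | [::], [::] => 1
  | x :: k', y :: w' => v x y * entry v k' w'
  | _, _ => 0
  end.

Lemma eq_entry v1 v2 k w : (forall x y, v1 x y = v2 x y) -> entry v1 k w = entry v2 k w.
Proof. by move=> h; elim: k w => [|x k IH] [|y w] //=; rewrite h IH. Qed.

Lemma entry_diag (S : I -> B) k w :
  entry (fun x y => if x == y then S x else 0) k w =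
  if w == k then foldr (fun x b => S x * b) 1 k else 0.
Proof.
elim: k w => [|x k IH] [|y w] //=; rewrite IH eqseq_cons [y == x]eq_sym.
by case: (x == y); case: (w == k); rewrite ?mul0r ?mulr0.
Qed.

Lemma wsum_mull m (c : B) (F : seq I -> B) :
  c * wsum m F = wsum m (fun w => c * F w).
Proof.
elim: m F => [//|m IH] F /=; rewrite mulr_sumr.
by apply: eq_bigr => x _; rewrite IH.
Qed.

End WordEntries.

Lemma wsum_pick (I : finType) (V : nmodType) (k : seq I) (F : seq I -> V) :
  wsum (size k) (fun w => if w == k then F w else 0) = F k.
Proof.
elim: k F => [//|x k IH] F /=; rewrite (bigD1 x) //= [X in _ + X]big1 ?addr0 => [|y yx].
  rewrite -[RHS](IH (fun w => F (x :: w))); apply: eq_wsum => w _.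
  by rewrite eqseq_cons eqxx.
rewrite -[RHS](wsum0 V I (size k)); apply: eq_wsum => w _.
by rewrite eqseq_cons (negbTE yx).
Qed.

Section HaarWords.
Variables (R : realType) (n : nat) (j : 'I_n) (A : cstarAlgType R) (u : 'M[A]_n)
  (AA : cstarAlgType R) (tens : A -> A -> AA) (Delta : {lrmorphism A -> AA})
  (haar : {scalar A}).
Hypotheses (uAo : is_Ao u) (ts : is_cstar_tensor tens)
  (uD : is_comultiplication u tens Delta) (hH : is_Haar tens Delta haar).
Implicit Types (k w : seq 'I_n).

Fixpoint col_word k : A := if k is x :: k' then u x j * col_word k' else 1.

Definition xi k : R[i] := haar (col_word k).

Lemma col_word_cat k1 k2 : col_word (k1 ++ k2) = col_word k1 * col_word k2.
Proof. by elim: k1 => [|x k1 IH] /=; rewrite ?mul1r // IH mulrA. Qed.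

Lemma Delta_col_word k :
  Delta (col_word k) = wsum (size k) (fun w => tens (entry u k w) (col_word w)).
Proof.
elim: k => [|x k IH] /=; first by rewrite rmorph1 (tens1 ts).
rewrite rmorphM /= (proj2 uD) IH mulr_suml; apply: eq_bigr => y _.
by rewrite wsum_mull; apply: eq_wsum => w _; rewrite (tensM ts).
Qed.

Lemma xi_fixed_A k :
  wsum (size k) (fun w => xi w *: entry u k w) = xi k *: 1.
Proof.
have [_ [E [[_ hE] hEh]] _] := hH.
rewrite -hEh Delta_col_word raddf_wsum.
by apply: eq_wsum => w _; rewrite /= hE.
Qed.

Lemma xi_fixed (B : cstarAlgType R) (v : 'M[B]_n) : orth_relations v ->
  forall k, wsum (size k) (fun w => xi w *: entry v k w) = xi k *: 1.
Proof.
move=> hv k; have [f [_ hf]] := Ao_universal uAo hv.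
have := congr1 f (xi_fixed_A k); rewrite raddf_wsum linearZ rmorph1 => <-.
apply: eq_wsum => w _; rewrite /= linearZ; congr (_ *: _).
elim: k w => [|x k IH] [|y w] /=; rewrite ?rmorph1 ?raddf0 //.
by rewrite rmorphM /= hf IH.
Qed.

(** The squares of the entries of column [j] sum to 1, so they can be inserted anywhere in a column
    word. *)
Lemma xi_cap l k : \sum_x xi (take l k ++ x :: x :: drop l k) = xi k.
Proof.
have [_ _ /matrixP /(_ j j)] := Ao_relations uAo; rewrite !mxE eqxx mulr1n => h.
rewrite /xi -raddf_sum; congr (haar _).
rewrite -{3}(cat_take_drop l k) col_word_cat -{1}(mul1r (col_word (drop l k))) -h.
rewrite mulr_suml mulr_sumr; apply: eq_bigr => x _.
by rewrite col_word_cat /= mxE -!mulrA.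
Qed.

End HaarWords.

(* The path with vertices [0 .. p] and edges coloured by the letters of a
   reduced word of length [p]: each colour acts by an involution, and the word
   itself moves [0] to [p]. *)
Section PathAction.
Variables (I : finType) (r : seq I).
Hypothesis rr : reduced r.
Let p := size r.

Definition step (x : I) (v : nat) : nat :=
  if (v < p)%N && (nth x r v == x) then v.+1
  else if (0 < v)%N && (v <= p)%N && (nth x r v.-1 == x) then v.-1 else v.

Lemma nth_default_eq (x y : I) v : (v < p)%N -> nth x r v = nth y r v.
Proof. exact: set_nth_default. Qed.

Lemma reduced_neq (x : I) v : (v.+1 < p)%N -> nth x r v != nth x r v.+1.
Proof. by move=> h; have /sortedP := rr => /(_ x v h). Qed.

Lemma step_le x v : (v <= p)%N -> (step x v <= p)%N.
Proof. by rewrite /step; case: ifP => [/andP[]//|_]; case: ifP => // _; lia. Qed.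

(** [r] being reduced, neighbouring edges have different colours; each colour is thus a matching of
    the path and [step] swaps its matched vertices. *)
Lemma stepK x v : (v <= p)%N -> step x (step x v) = v.
Proof.
move=> vp; rewrite {2}/step; case: ifP => [/andP[h1 h2]|h1].
  rewrite /step /= h1 h2 /=; case: ifP => // /andP[h3 h4].
  by have := reduced_neq x h3; rewrite (eqP h2) (eqP h4) eqxx.
case: ifP => [/andP[/andP[h2 h3] h4]|h2]; last by rewrite /step h1 h2.
rewrite /step; have -> : (v.-1 < p)%N by lia.
by rewrite h4 /= prednK.
Qed.

Definition walk k (v : nat) := foldl (fun v x => step x v) v k.

Lemma walk_le k v : (v <= p)%N -> (walk k v <= p)%N.
Proof. by elim: k v => [//|x k IH] v h /=; apply/IH/step_le. Qed.

Lemma walk_red k v : (v <= p)%N -> walk (red k) v = walk k v.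
Proof.
elim: k v => [//|x k IH] v h /=; rewrite -IH ?step_le //.
rewrite /red /= -/(red k); case: (red k) => [//|y s] /=.
by case: eqVneq => [->|//]; rewrite stepK.
Qed.

Lemma walk_self_drop d v : (v + d = p)%N -> walk (drop v r) v = p.
Proof.
elim: d v => [|d IH] v h; first by rewrite addn0 in h; rewrite h drop_oversize.
have vp : (v < p)%N by lia.
case er : r => [|x0 r']; first by move: vp; rewrite /p er.
rewrite -er (drop_nth x0) //= /step vp (nth_default_eq _ x0 vp) eqxx /=.
by apply: IH; lia.
Qed.

Lemma walk_self : walk r 0 = p.
Proof. by have := walk_self_drop (add0n p); rewrite drop0. Qed.

End PathAction.

(** * Vanishing off trivial words *)

Section Support.
Variables (R : realType) (I : finType) (r : seq I).
Hypothesis rr : reduced r.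
Notation M := 'M[R[i]]_((size r).+1).

Definition step_mx (x : I) : M :=
  \matrix_(a, b) (step r x a == b :> nat)%:R.

Lemma step_ord (x : I) (a : 'I_(size r).+1) : (step r x a < (size r).+1)%N.
Proof. by rewrite ltnS step_le // -ltnS. Qed.

Lemma step_mx_mull (x : I) (N : M) a b :
  (step_mx x *m N) a b = N (Ordinal (step_ord x a)) b.
Proof.
rewrite mxE (bigD1 (Ordinal (step_ord x a))) //= mxE eqxx mul1r big1 ?addr0 // => c.
by rewrite -val_eqE /= => h; rewrite mxE eq_sym (negbTE h) mul0r.
Qed.

Lemma step_mxK (x : I) : step_mx x *m step_mx x = 1%:M.
Proof.
apply/matrixP => a b; rewrite step_mx_mull !mxE /= stepK // ?val_eqE //.
by rewrite -ltnS.
Qed.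

Lemma adj_step_mx (x : I) : adj (step_mx x) = step_mx x.
Proof.
apply/matrixP => a b; rewrite !mxE rmorph_nat; congr (_%:R : R[i]).
congr nat_of_bool; apply/eqP/eqP => <-; rewrite stepK // -ltnS //.
Qed.

Lemma step_prod k (a b : 'I_(size r).+1) :
  (foldr (fun x N => step_mx x *m N) 1%:M k : M) a b = (walk r k a == b :> nat)%:R.
Proof.
elim: k a => [|x k IH] a /=; first by rewrite mxE.
by rewrite step_mx_mull IH.
Qed.

End Support.

Section FixedSupport.
Variables (R : realType) (n : nat) (x0 : seq 'I_n -> R[i]).
Hypothesis fixedx : forall N (v : 'M['M[R[i]]_N.+1]_n), orth_relations v ->
  forall k, wsum (size k) (fun w => x0 w *: entry v k w) = x0 k *: 1.
Implicit Types (k w : seq 'I_n).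

Lemma fixed_trivword k : ~~ trivword k -> x0 k = 0.
Proof.
move=> nk; have rr : reduced (red k) by apply: reduced_act.
pose r := red k; pose S x := step_mx R r x.
pose v : 'M['M[R[i]]_((size r).+1)]_n := \matrix_(x, y) if x == y then S x else 0.
have S2 x : S x * S x = 1 by apply: step_mxK.
have hv : orth_relations v.
  split.
  - move=> x y; rewrite mxE; case: eqP => _; first exact: adj_step_mx.
    by rewrite starE; apply/matrixP => a b; rewrite !mxE rmorph0.
  - apply/matrixP => x y; rewrite !mxE (bigD1 x) //= big1 ?addr0 => [|z zx].
      by rewrite !mxE eqxx eq_sym; case: eqP => [->|_]; rewrite ?S2 ?mulr0.
    by rewrite !mxE eq_sym (negbTE zx) mul0r.
  - apply/matrixP => x y; rewrite !mxE (bigD1 x) //= big1 ?addr0 => [|z zx].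
      by rewrite !mxE eqxx; case: eqP => [->|_]; rewrite ?S2 ?mulr0.
    by rewrite !mxE (negbTE zx) mul0r.
have := fixedx hv k.
rewrite (@eq_wsum _ _ _ _ (fun w => if w == k then
    x0 k *: foldr (fun x N => S x * N) 1 k else 0)); last first.
  move=> w _; rewrite (@eq_entry _ _ _ (fun x y => if x == y then S x else 0)).
    by rewrite entry_diag; case: eqP => [->|]; rewrite ?scaler0.
  by move=> x y; rewrite mxE.
rewrite wsum_pick => /matrixP.
(* The identity is read at row 0 and the column of the endpoint of the walk. The product of
   permutation matrices has entry 1 there; the identity matrix has entry 0, since the normal form of
   [k] moves 0 to the other end of a path of positive length. *)
move=> /(_ ord0 (Ordinal (walk_le rr k (leq0n (size r)) : _ < (size r).+1)%N)).
rewrite !mxE step_prod //= eqxx mulr1 -val_eqE /=.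
have -> : walk r k 0 = size r by rewrite -(walk_red rr) // (walk_self rr).
have -> : (0 == size r) = false.
  by apply/negbTE; rewrite eq_sym size_eq0.
by rewrite mulr0n mulr0.
Qed.

End FixedSupport.

(** * Infinitesimal rotations *)

Section PlaneRotation.
Variables (R : realFieldType) (I : finType) (a b : I).
Hypothesis ab : a != b.
Implicit Types (k w : seq I) (f : seq I -> R) (x y z : I).

Definition rot (c s : R) x y : R :=
  if x == a then (if y == a then c else if y == b then s else 0)
  else if x == b then (if y == a then - s else if y == b then c else 0)
  else (x == y)%:R.

Lemma rot_sum c s x (F : I -> R) : \sum_y rot c s x y * F y =
  if x == a then c * F a + s * F b
  else if x == b then c * F b - s * F a else F x.
Proof.
have ba : (b == a) = false by rewrite eq_sym (negbTE ab).
rewrite /rot; case: (eqVneq x a) => [_|xa].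
  rewrite (bigD1 a) //= (bigD1 b) /=; last by rewrite ba.
  rewrite !eqxx ba big1 ?addr0 // => y /andP[ya yb].
  by rewrite (negbTE ya) (negbTE yb) mul0r.
case: (eqVneq x b) => [_|xb].
  rewrite (bigD1 a) //= (bigD1 b) /=; last by rewrite ba.
  rewrite !eqxx ba big1 ?addr0 => [|y /andP[ya yb]]; first by ring.
  by rewrite (negbTE ya) (negbTE yb) mul0r.
rewrite (bigD1 x) //= eqxx mul1r big1 ?addr0 // => y yx.
by rewrite eq_sym (negbTE yx) mul0r.
Qed.

Lemma rot_tr c s x y : rot c s x y = rot c (- s) y x.
Proof.
rewrite /rot opprK [y == x]eq_sym.
case: (eqVneq x a) => [xa|xa]; case: (eqVneq y a) => [ya|ya] //;
case: (eqVneq x b) => [xb|xb] //; case: (eqVneq y b) => [yb|yb] //.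
all: case: (eqVneq x y) => [e|//]; subst y; exfalso.
all: first [by case/eqP: ya|by case/eqP: yb|by case/eqP: xa|by case/eqP: xb].
Qed.

Lemma rot_orth c s x z : c ^+ 2 + s ^+ 2 = 1 ->
  \sum_y rot c s x y * rot c s z y = (x == z)%:R.
Proof.
move=> cs; have ba : (b == a) = false by rewrite eq_sym (negbTE ab).
rewrite rot_sum /rot !eqxx ba.
case: (eqVneq x a) => [->|xa].
  rewrite [a == z]eq_sym; case: (eqVneq z a) => [_|za]; first by rewrite mulr1n -cs; ring.
  rewrite mulr0n; case: (eqVneq z b) => [_|zb]; first by ring.
  by rewrite ?(negbTE za) ?(negbTE zb) ?mulr0n; ring.
case: (eqVneq x b) => [->|xb].
  rewrite [b == z]eq_sym; case: (eqVneq z a) => [->|za]; first by rewrite (negbTE ab) mulr0n; ring.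
  case: (eqVneq z b) => [_|zb]; first by rewrite mulr1n -cs; ring.
  by rewrite ?(negbTE za) ?(negbTE zb) ?mulr0n; ring.
case: (eqVneq z a) => [->|za]; first by rewrite (negbTE xa).
case: (eqVneq z b) => [->|zb]; first by rewrite (negbTE xb).
by rewrite eq_sym.
Qed.

(** With a factor c taken out for each letter in the plane, the rotated tensor is a polynomial in
    the tangent s / c. The derivative at the identity is then its linear coefficient, and no
    analysis is involved. *)
Fixpoint rot_poly k f : {poly R} :=
  if k is x :: k' then
    let P y := rot_poly k' (fun w => f (y :: w)) in
    if x == a then P a + 'X * P b else if x == b then P b - 'X * P a else P x
  else (f [::])%:P.

Lemma rot_poly_coef0 k f : (rot_poly k f)`_0 = f k.
Proof.
elim: k f => [|x k IH] f /=; first by rewrite coefC.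
case: (eqVneq x a) => [->|_]; first by rewrite coefD coefXM addr0 IH.
by case: (eqVneq x b) => [->|_]; rewrite ?coefB ?coefXM ?subr0 IH.
Qed.

Lemma rot_poly_coef1 k f : (rot_poly k f)`_1 = X a b f k.
Proof.
elim: k f => [|x k IH] f /=; first by rewrite coefC.
case: (eqVneq x a) => [->|_].
  by rewrite coefD coefXM /= IH rot_poly_coef0 addrC.
case: (eqVneq x b) => [->|_].
  by rewrite coefB coefXM /= IH rot_poly_coef0 addrC.
by rewrite IH add0r.
Qed.

Lemma rot_poly_horner c s k f : c != 0 ->
  wsum (size k) (fun w => entry (rot c s) k w * f w) =
  c ^+ count (pred2 a b) k * (rot_poly k f).[s / c].
Proof.
move=> c0; elim: k f => [|x k IH] f /=; first by rewrite hornerC expr0.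
have e y : wsum (size k) (fun w => rot c s x y * entry (rot c s) k w * f (y :: w)) =
  rot c s x y * wsum (size k) (fun w => entry (rot c s) k w * f (y :: w)).
  by rewrite wsum_mull; apply: eq_wsum => w _; rewrite mulrA.
rewrite (eq_bigr _ (fun y _ => e y)) rot_sum.
case: (eqVneq x a) => [_|xa].
  rewrite !IH add1n exprS hornerD hornerM hornerX.
  by move: (_ ^+ _) (horner _ _) (horner _ _) => r h1 h2; field.
case: (eqVneq x b) => [_|xb]; last by rewrite IH.
rewrite !IH add1n exprS hornerD hornerN hornerM hornerX.
by move: (_ ^+ _) (horner _ _) (horner _ _) => r h1 h2; field.
Qed.

End PlaneRotation.

Lemma poly_eq0_of_roots (R : realFieldType) (P : {poly R}) : (forall t, P.[t] = 0) -> P = 0.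
Proof.
move=> h; apply: (@roots_geq_poly_eq0 _ _ [seq i%:R | i <- iota 0 (size P)]).
- by apply/allP => t _; apply/rootP.
- by rewrite map_inj_uniq ?iota_uniq // => i i' /eqP; rewrite eqr_nat => /eqP.
- by rewrite size_map size_iota.
Qed.

Section FixedRotation.
Variables (R : realType) (n : nat) (x0 : seq 'I_n -> R[i]).
Hypothesis fixedx : forall N (v : 'M['M[R[i]]_(N.+1)]_n), orth_relations v ->
  forall k, wsum (size k) (fun w => x0 w *: entry v k w) = x0 k *: 1.
Implicit Types (k w : seq 'I_n).

Lemma fixed_rot (a b : 'I_n) (c s : R) k : a != b -> c ^+ 2 + s ^+ 2 = 1 ->
  wsum (size k) (fun w => (entry (rot a b c s) k w)%:C * x0 w) = x0 k.
Proof.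
move=> ab cs; pose v : 'M['M[R[i]]_1]_n := \matrix_(x, y) (rot a b c s x y)%:C%:M.
have hv : orth_relations v.
  split.
  - move=> x y; rewrite mxE starE; apply/matrixP => p p'.
    by rewrite !mxE eq_sym rmorphMn; congr (_ *+ _); apply: conjc_real.
  - apply/matrixP => x y; rewrite !mxE.
    rewrite (eq_bigr (fun z => ((rot a b c s x z * rot a b c s y z)%:C)%:M)) => [|z _].
      by rewrite -!raddf_sum /= rot_orth //; case: (x == y); rewrite /= ?raddf0.
    by rewrite !mxE -[_ * _]/(_ *m _) -scalar_mxM -rmorphM.
  - apply/matrixP => x y; rewrite !mxE.
    rewrite (eq_bigr (fun z => ((rot a b c (- s) x z * rot a b c (- s) y z)%:C)%:M)) => [|z _].
      by rewrite -!raddf_sum /= rot_orth ?sqrrN //; case: (x == y); rewrite /= ?raddf0.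
    by rewrite !mxE -[_ * _]/(_ *m _) -scalar_mxM -rmorphM ![rot a b c s _ _]rot_tr.
have := fixedx hv k => /matrixP /(_ ord0 ord0).
rewrite [RHS]mxE mxE eqxx mulr1n mulr1 => <-.
have -> (F : seq 'I_n -> 'M[R[i]]_1) m : (wsum m F) ord0 ord0 = wsum m (fun w => F w ord0 ord0).
  elim: m F => [//|m IH] F /=; rewrite summxE; apply: eq_bigr => x _; exact: IH.
apply: eq_wsum => w _; rewrite mxE mulrC; congr (_ * _).
elim: k w => [|x k IH] [|y w] /=; rewrite ?mxE //.
by rewrite big_ord1 mxE eqxx mulr1n -IH; apply: rmorphM.
Qed.

(** [part] stands for the real or the imaginary part: both commute with the real matrices used here,
    and the argument on words takes place over an ordered field. At a nontrivial word the rotation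
    polynomial vanishes at every [t]. *)
Lemma fixed_inF (part : R[i] -> R) : (forall z1 z2, part (z1 + z2) = part z1 + part z2) ->
  (forall (t : R) z, part (t%:C * z) = t * part z) -> inF (fun k => part (x0 k)).
Proof.
move=> pD pZ; have p0 : part 0 = 0 by have := pZ 0 0; rewrite !mul0r.
have supp k : ~~ trivword k -> part (x0 k) = 0 by move=> h; rewrite fixed_trivword.
split=> // a b k ab nk; rewrite -rot_poly_coef1.
suff -> : rot_poly a b k (fun w => part (x0 w)) = 0 by rewrite coef0.
apply: poly_eq0_of_roots => t.
(* The cosine of the angle with tangent [t], so that [s / c] takes every real value. *)
pose c : R := (Num.sqrt (1 + t ^+ 2))^-1.
have d0 : 0 < 1 + t ^+ 2 by rewrite ltr_pwDl ?sqr_ge0.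
have c0 : c != 0 by rewrite invr_eq0 sqrtr_eq0 -ltNge.
have cs : c ^+ 2 + (t * c) ^+ 2 = 1.
  rewrite exprMn -[X in X + _]mul1r -mulrDl /c exprVn sqr_sqrtr ?ltW //.
  by rewrite divff // gt_eqF.
have := fixed_rot k ab cs => /(congr1 part).
have hs m (F : seq 'I_n -> R[i]) : part (wsum m F) = wsum m (fun w => part (F w)).
  elim: m F => [//|m IH] F /=; rewrite (big_morph _ pD p0).
  by apply: eq_bigr => x _; apply: IH.
rewrite hs supp //.
under eq_wsum => w _ do rewrite pZ.
rewrite (rot_poly_horner ab _ _ _ c0) mulfK // => /eqP.
by rewrite mulf_eq0 expf_eq0 (negbTE c0) andbF /= => /eqP.
Qed.

End FixedRotation.

(** * Moments of the Haar state *)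

Section HaarMoments.
Variables (R : realType) (n : nat) (i j : 'I_n) (q : R)
    (A : cstarAlgType R) (u : 'M[A]_n)
    (AA : cstarAlgType R) (tens : A -> A -> AA) (Delta : {lrmorphism A -> AA})
    (haar : {scalar A}).
Hypotheses (n2 : (2 < n)%N) (hq : -1 < q < 0) (hn : q + q^-1 = - n%:R).
Hypotheses (uAo : is_Ao u) (ts : is_cstar_tensor tens)
  (uD : is_comultiplication u tens Delta) (hH : is_Haar tens Delta haar).
Let s : R := Num.sqrt (n%:R + 2).

Lemma part_moments (part : R[i] -> R) :
  (forall z1 z2, part (z1 + z2) = part z1 + part z2) ->
  (forall (t : R) z, part (t%:C * z) = t * part z) ->
  forall (m : nat -> nat -> R), (forall t, m t.+1 0 = m t 1) ->
  (forall t r, m t.+1 r.+1 = m t r.+2 - - (qtanh q r.+1 * qtanh q r.+2) * m t r) ->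
  (forall r, m 0 r = (r == 0)%:R * part 1) ->
  forall t, part (haar ((s%:C *: u i j) ^+ t)) = m t 0.
Proof.
move=> pD pZ m m0 mS mI t; pose f k := part (xi j u haar k).
have p0 : part 0 = 0 by have := pZ 0 0; rewrite !mul0r.
have fF : inF f.
  by apply: fixed_inF pD pZ => N v hv k; apply: (xi_fixed j uAo ts uD hH).
have fcap l w : cap l f w = f w.
  by rewrite /cap /f -(xi_cap j haar uAo l w) (big_morph _ pD p0).
have cN : #|'I_n|%:R = n%:R :> R by rewrite card_ord.
pose e := E i (qbr q) (qlam q).
have [b ib] : exists b : 'I_n, i != b.
  have : (0 < #|predC1 i|)%N by rewrite cardC1 card_ord; lia.
  by case/card_gt0P => b; rewrite inE eq_sym => ib; exists b.
have s2 : s ^+ 2 = n%:R + 2 by rewrite sqr_sqrtr // addr_ge0.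
(* This plays the part of the Haar state of w^t P_r(w) with P_r the orthogonal polynomials of [w];
   the powers of [s] carry the normalisation. *)
pose m1 t r := s ^+ (t + r) * e r (shift i t f).
have -> : part (haar ((s%:C *: u i j) ^+ t)) = m1 t 0.
  rewrite exprZn linearZ /= -rmorphXn pZ /m1 addn0 /e /E /= /shift cats0 /f /xi.
  congr (_ * part (haar _)).
  by elim: t => [//|t IH] /=; rewrite exprS IH.
apply: (@moment_unique _ (fun r => - (qtanh q r.+1 * qtanh q r.+2)) m1 m) => //.
- move=> t'; rewrite /m1 /e /E addn0 addn1 /= /shift cats0.
  by have := nseqD t' 1 i; rewrite addn1 /= => ->.
- move=> t' r; rewrite /m1 /e (@E_moment _ _ i (qbr q) (qlam q) r t' f fcap).
  rewrite (@qjw_coef _ _ hq n%:R r hn) addSn !addnS !exprS -s2.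
  have s0 : s != 0 by rewrite sqrtr_eq0 -ltNge ltr_wpDl.
  by move: (s ^+ (t' + r)) (E _ _ _ _ _) (E _ _ _ _ _) => x e1 e2; field.
- move=> r; rewrite mI /m1 /e add0n; case: r => [|r].
    rewrite expr0 mul1r /= /shift /= /f /xi /= mul1r.
    by have [[-> _] _ _] := hH.
  rewrite mul0r (@E_inF _ _ i (qbr q) (qlam q) _ _ _ _ _ _ b) ?mulr0 //.
  + exact: qbr0.
  + exact: qbr1.
  + by move=> k; rewrite cN; apply: qbrSS.
  + exact: qbr_neq0.
  + exact: qlam0.
  + exact: qlamS.
Qed.

Lemma haar_moments (m : nat -> nat -> R) : (forall t, m t.+1 0 = m t 1) ->
  (forall t r, m t.+1 r.+1 = m t r.+2 + qtanh q r.+1 * qtanh q r.+2 * m t r) ->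
  (forall r, m 0 r = (r == 0)%:R) ->
  forall t, haar ((s%:C *: u i j) ^+ t) = (m t 0)%:C.
Proof.
move=> m0 mS mI t; apply/eqP; rewrite eq_complex; apply/andP; split; apply/eqP.
  apply: part_moments => //.
  - exact: ReD.
  - by move=> x [y z] /=; ring.
  - by move=> t' r; rewrite mS mulNr opprK.
  - by move=> r; rewrite mI mulr1.
(* The imaginary parts satisfy the same recurrence from initial values 0. *)
apply: (@part_moments (@complex.Im R) _ _ (fun _ _ => 0)) => //.
- exact: ImD.
- by move=> x [y z] /=; ring.
- by move=> t' r; rewrite mulr0 subr0.
- by move=> r; rewrite mulr0.
Qed.

End HaarMoments.

(** * The circular density *)

Section ComplexLimits.
Variable R : realType.

Lemma normcE2 (z : R[i]) : `|z| = (Num.sqrt (nz z))%:C.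
Proof. by rewrite normc_def. Qed.

Lemma gt0_complexP (e : R[i]) : 0 < e -> exists2 r : R, e = r%:C & 0 < r.
Proof.
case: e => a b; rewrite ltcE /= => /andP[/eqP b0 a0].
by exists a => //; rewrite b0.
Qed.

Lemma complex_cauchy_cvg (u : nat -> R[i]) :
  (forall e : R, 0 < e -> exists N, forall m p, (N <= m)%N -> (N <= p)%N -> `|u m - u p| < e%:C) ->
  exists l : R[i], (u : nat -> R[i]^o) @ \oo --> (l : R[i]^o).
Proof.
move=> hu.
have part (f : R[i] -> R) : (forall z1 z2, f (z1 - z2) = f z1 - f z2) ->
    (forall z, `|f z| <= Num.sqrt (nz z)) ->
    exists l, forall e, 0 < e -> exists N, forall m, (N <= m)%N -> `|f (u m) - l| < e.
  move=> fB fle; apply: real_cauchy_cvg => e e0.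
  have [N hN] := hu e e0; exists N => m p Nm Np.
  rewrite -fB; apply: le_lt_trans (fle _) _.
  by have := hN m p Nm Np; rewrite normcE2 ltcR.
have [a ha] : exists l, forall e, 0 < e ->
    exists N, forall m, (N <= m)%N -> `|complex.Re (u m) - l| < e.
  apply: part; first by move=> [? ?] [? ?].
  by move=> z; rewrite -sqrtr_sqr ler_sqrt ?nz_ge0 // lerDl sqr_ge0.
have [b hb] : exists l, forall e, 0 < e ->
    exists N, forall m, (N <= m)%N -> `|complex.Im (u m) - l| < e.
  apply: part; first by move=> [? ?] [? ?].
  by move=> z; rewrite -sqrtr_sqr ler_sqrt ?nz_ge0 // lerDr sqr_ge0.
exists (a +i* b); apply/cvgrPdist_lt => e /gt0_complexP [r -> r0].
have r2 : 0 < r / 2 by rewrite divr_gt0.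
have [N1 hN1] := ha _ r2; have [N2 hN2] := hb _ r2.
exists (maxn N1 N2) => // m /=; rewrite geq_max => /andP[m1 m2].
have h1 := hN1 m m1; have h2 := hN2 m m2.
rewrite normcE2 ltcR.
have -> : r = Num.sqrt (r ^+ 2) by rewrite sqrtr_sqr ger0_norm // ltW.
rewrite ltr_sqrt ?exprn_gt0 //.
case: (u m) h1 h2 => x y /=; rewrite /nz /= !ltr_norml => /andP[? ?] /andP[? ?].
have : (a - x) ^+ 2 < (r / 2) ^+ 2 by nra.
have : (b - y) ^+ 2 < (r / 2) ^+ 2 by nra.
have r3 : 0 < r ^+ 2 by rewrite exprn_gt0.
by rewrite exprMn; nra.
Qed.

Lemma geometric_small (r D e : R) : 0 <= r < 1 -> 0 < e ->
  exists N, forall K, (N <= K)%N -> D * r ^+ K < e.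
Proof.
case/andP => r0 r1 e0.
have /cvgrPdist_lt h : (fun K => D * r ^+ K) @ \oo --> (0 : R).
  rewrite -[X in _ --> X](mulr0 D); apply: cvgMl_tmp; apply: cvg_expr.
  by rewrite ger0_norm.
have [N _ hN] := h e e0; exists N => K NK.
have := hN K NK; rewrite /= sub0r normrN => h2.
by apply: le_lt_trans h2; apply: ler_norm.
Qed.

End ComplexLimits.

(** * Uniform approximation of G on the circle *)

Section GApprox.
Variables (R : realType) (q : R).
Hypothesis q_bounds : -1 < q < 0.
Let c : R[i] := q%:C.
Let r : R := `|q|.
Implicit Types (z : R[i]).

Lemma norm_realC (x : R) : `|x%:C| = (`|x|)%:C :> R[i].
Proof. by rewrite normcE2 /nz /= expr0n addr0 sqrtr_sqr. Qed.

Lemma c_lt1 : `|c| < 1.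
Proof. by rewrite norm_realC -[1]/(1%:C) ltcR; exact: q_norm_lt1. Qed.

(** The coefficients of G as a power series in -z^2, as read off from [lamb_poly]; the factor is (1
    - c^2) / (1 - c)^2. *)
Definition Gcoef N : R[i] := (1 + c) / (1 - c) * (tanhq c N.+1 - tanhq c N.-1).
Definition Gpoly N z : R[i] := \sum_(k < N) (- z ^+ 2) ^+ k * Gcoef k.

Let e : R[i] := (1 - `|c|)^-1.
(** In [partial_sum_approx] the powers |c|^N and |c|^K come with coefficients 8 and 6, both below
    10. The share of [Gpoly_lamb] is 4, that is 2/5 of 10. *)
Let D : R[i] := 10 * `|(1 + c) / (1 - c)| * e ^+ 2.

Lemma e_ge1 : 1 <= e.
Proof.
have h := sub_rho_gt0 c_lt1.
by rewrite -[leLHS]invr1 lef_pV2 ?posrE ?ltr01 //.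
Qed.

Lemma D_ge0 : 0 <= D.
Proof. by rewrite !mulr_ge0 ?normr_ge0 ?exprn_ge0 // (le_trans _ e_ge1). Qed.

(** The term with 1 / (1 + z^2) has already been cancelled here, so the estimate also covers z^2 =
    -1, where [G_approx] takes it for the removable value. *)
Lemma Gpoly_lamb N z : `|z| = 1 ->
  `|(1 + c) / (1 - c) * (1 - z ^+ 2 + 2 * (1 - (z ^+ 2) ^+ 2) * lamb c N.+1 (z ^+ 2))
    - Gpoly N.+1 z| <= D * `|c| ^+ N * (2 / 5).
Proof.
move=> z1; have y1 : `|- z ^+ 2| = 1 by rewrite normrN normrX z1 expr1n.
rewrite lamb_poly ?c_lt1 //.
have -> : Gpoly N.+1 z = (1 + c) / (1 - c) *
    \sum_(j < N.+1) (- z ^+ 2) ^+ j * (tanhq c j.+1 - tanhq c j.-1).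
  by rewrite mulr_sumr; apply: eq_bigr => j _; rewrite /Gcoef; ring.
have -> (a x y w : R[i]) : a * (x + y + w) - a * x = a * (y + w) by ring.
rewrite normrM /D -!mulrA [10 * _]mulrC -!mulrA; apply: ler_wpM2l => //.
apply: le_trans (ler_normD _ _) _; rewrite !normrM !normrX y1 !expr1n !mul1r /=.
apply: (@le_trans _ _ (2 * `|c| ^+ N * e + 2 * `|c| ^+ N.+1 * e)).
  by apply: lerD; apply: one_sub_tanhq_le; apply: c_lt1.
have e1 := e_ge1; have n0 : 0 <= `|c| ^+ N by apply: exprn_ge0.
have e0 : 0 <= e by apply: le_trans e1.
have h1 : `|c| ^+ N.+1 <= `|c| ^+ N.
  by rewrite exprS -[leRHS]mul1r ler_wpM2r // ltW ?c_lt1.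
have h2 : e <= e ^+ 2 by rewrite expr2 -[leLHS]mul1r ler_wpM2r.
rewrite [leRHS](_ : _ = 2 * `|c| ^+ N * e ^+ 2 + 2 * `|c| ^+ N * e ^+ 2); last first.
  by move: (`|c| ^+ N) e => a b; field.
apply: lerD.
  by apply: ler_wpM2l; rewrite ?mulr_ge0.
by apply: ler_pM; rewrite ?mulr_ge0 ?exprn_ge0 // ler_wpM2l.
Qed.

Let S z K : R[i] := \sum_(k < K) summand c k (z ^+ 2).

Lemma partial_sum_approx N K z : `|z| = 1 -> 1 + z ^+ 2 != 0 ->
  `|(1 - c ^+ 2) * (1 - z ^+ 4) * S z K.+1 - Gpoly N.+1 z| <= D * (`|c| ^+ N + `|c| ^+ K).
Proof.
move=> z1 hy; have y1 : `|z ^+ 2| <= 1 by rewrite normrX z1 expr1n.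
have hS := sum_summand c_lt1 K.+1 y1 hy; rewrite -/(S z K.+1) in hS.
have hc : 1 - c != 0 by rewrite subr_eq0 eq_sym; apply/eqP => h; have := c_lt1; rewrite h normr1 ltxx.
set k := (1 + c) / (1 - c); set y := z ^+ 2; set T := _ * S z K.+1.
(* [ell 0] is 1 / (1 + y), the only part not bounded on the circle; multiplied by 1 - y^2 it becomes
   1 - y. *)
have -> : T = k * ((1 - y) + (1 - y ^+ 2) * (2 * alt_sum c (2 * K.+1) y - ell c (2 * K.+1) y)).
  have -> : T = k * (1 - y ^+ 2) * ((1 - c) ^+ 2 * S z K.+1).
    by rewrite /T /k /y -exprM; field.
  rewrite hS -/y /ell expr0 mul1r.
  by move: (alt_sum _ _ _) (_ / (1 + c ^+ _ * y)) => s t; field.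
have -> : k * (1 - y + (1 - y ^+ 2) * (2 * alt_sum c (2 * K.+1) y - ell c (2 * K.+1) y)) - Gpoly N.+1 z =
  k * ((1 - y ^+ 2) * (2 * (alt_sum c (2 * K.+1) y - lamb c N.+1 y) - ell c (2 * K.+1) y)) +
  (k * (1 - y + 2 * (1 - y ^+ 2) * lamb c N.+1 y) - Gpoly N.+1 z) by ring.
apply: le_trans (ler_normD _ _) _.
have h1 := Gpoly_lamb N z1; rewrite -/k -/y in h1.
have h2 := alt_sum_lamb c_lt1 N.+1 (2 * K.+1) y1; rewrite -/y in h2.
have h3 : `|ell c (2 * K.+1) y| <= `|c| ^+ (2 * K.+1) * e.
  by rewrite mulnS add2n; apply: ell_le; rewrite ?c_lt1.
have e1 := e_ge1; have e0 : 0 <= e by apply: le_trans e1.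
have h4 : e <= e ^+ 2 by rewrite expr2 -[leLHS]mul1r ler_wpM2r.
have n0 m : 0 <= `|c| ^+ m by apply: exprn_ge0.
have mono m p : (m <= p)%N -> `|c| ^+ p <= `|c| ^+ m.
  by move=> mp; apply: ler_wiXn2l; rewrite ?normr_ge0 ?ltW ?c_lt1.
have g1 := mono _ _ (leqnSn N); have g2 : `|c| ^+ (2 * K.+1) <= `|c| ^+ K by apply: mono; lia.
have yy : `|1 - y ^+ 2| <= 2.
  apply: le_trans (ler_normB _ _) _; rewrite normr1 normrX normrX z1 !expr1n.
  by rewrite -[leRHS]/(1 + 1).
have k0 : 0 <= `|k| by apply: normr_ge0.
have step1 : `|k * ((1 - y ^+ 2) * (2 * (alt_sum c (2 * K.+1) y - lamb c N.+1 y) - ell c (2 * K.+1) y))|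
    <= `|k| * (2 * (2 * ((`|c| ^+ K + `|c| ^+ N) * e ^+ 2) + `|c| ^+ K * e ^+ 2)).
  rewrite normrM; apply: ler_wpM2l => //; rewrite normrM; apply: ler_pM => //.
  apply: le_trans (ler_normB _ _) _; apply: lerD.
    rewrite normrM ger0_norm //; apply: ler_wpM2l => //; apply: le_trans h2 _.
    by rewrite -exprVn -/e; apply: ler_wpM2r; rewrite ?exprn_ge0 // lerD.
  by apply: le_trans h3 _; apply: ler_pM.
apply: le_trans (lerD step1 h1) _.
have -> : D * (`|c| ^+ N + `|c| ^+ K) =
  `|k| * (2 * (2 * ((`|c| ^+ K + `|c| ^+ N) * e ^+ 2) + `|c| ^+ K * e ^+ 2)) +
  D * `|c| ^+ N * (2 / 5) + `|k| * (e ^+ 2 * (4 * `|c| ^+ K + 2 * `|c| ^+ N)).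
  by rewrite /D -/k; field.
by rewrite lerDl !mulr_ge0 ?addr_ge0 ?mulr_ge0 ?exprn_ge0.
Qed.

Lemma expc_real N : `|c| ^+ N = (r ^+ N)%:C.
Proof. by rewrite norm_realC rmorphXn. Qed.

Lemma ge0_complexP (x : R[i]) : 0 <= x -> exists2 t : R, x = t%:C & 0 <= t.
Proof.
case: x => a b; rewrite lecE /= => /andP[/eqP b0 a0].
by exists a => //; rewrite b0.
Qed.

Lemma r_bounds : 0 <= r < 1.
Proof. by rewrite normr_ge0 q_norm_lt1. Qed.

Lemma norm_le_of_geometric (a : R[i]) (b d : R) :
  (forall K, `|a| <= (b + d * r ^+ K)%:C) -> `|a| <= b%:C.
Proof.
rewrite normcE2 lecR => h; apply/ler_addgt0Pr => t t0.
have [K hK] := geometric_small d r_bounds t0.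
have := h K; rewrite lecR => h1; apply: le_trans h1 _.
by rewrite lerD2l ltW ?hK.
Qed.

Lemma G_approx : exists2 D0 : R, 0 <= D0 &
  forall z N, `|z| = 1 -> `|G q z - Gpoly N.+1 z| <= (D0 * r ^+ N)%:C.
Proof.
have [D0 DE D00] := ge0_complexP D_ge0; exists D0 => // z N z1.
have psum M K : 1 + z ^+ 2 != 0 ->
    `|(1 - c ^+ 2) * (1 - z ^+ 4) * S z K.+1 - Gpoly M.+1 z| <= (D0 * r ^+ M + D0 * r ^+ K)%:C.
  move=> h; apply: le_trans (partial_sum_approx M K z1 h) _.
  by rewrite DE !expc_real -rmorphD -rmorphM mulrDr.
rewrite /G; case: eqP => [zN1|/eqP zN1].
  have hN := Gpoly_lamb N z1.
  have -> : (1 - (q ^+ 2)%:C) * ((1 - z ^+ 2) * (1 - (q ^+ 1)%:C * z ^+ 2) /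
      ((1 + (q ^+ 1)%:C * z ^+ 2) * (1 + (q ^+ 2)%:C * z ^+ 2))) =
     (1 + c) / (1 - c) * (1 - z ^+ 2 + 2 * (1 - (z ^+ 2) ^+ 2) * lamb c N.+1 (z ^+ 2)).
    rewrite zN1 !rmorphXn /= -/c sqrrN expr1n subrr mulr0 mul0r addr0 expr1.
    have hc : 1 - c != 0.
      by rewrite subr_eq0 eq_sym; apply/eqP => h; have := c_lt1; rewrite h normr1 ltxx.
    have hc2 : 1 + c != 0.
      rewrite addrC addr_eq0; apply/eqP => h.
      by have := c_lt1; rewrite h normrN normr1 ltxx.
    have -> : 1 - c ^+ 2 = (1 - c) * (1 + c) by ring.
    have -> : (1 + c * -1) * (1 + c ^+ 2 * -1) = (1 - c) * ((1 - c) * (1 + c)) by ring.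
    by field; rewrite hc hc2.
  apply: le_trans hN _; rewrite DE expc_real -rmorphM.
  rewrite -[leRHS]mulr1; apply: ler_wpM2l.
    by rewrite ler0c mulr_ge0 ?exprn_ge0 ?normr_ge0.
  by rewrite ler_pdivrMr ?mul1r ?ler_nat.
have hy : 1 + z ^+ 2 != 0 by rewrite addrC addr_eq0.
pose f (k : nat) : R[i]^o := summand c k (z ^+ 2).
have -> : (fun k : nat => (q ^+ (2 * k))%:C * (1 - (q ^+ (2 * k + 1))%:C * z ^+ 2) /
      ((1 + (q ^+ (2 * k))%:C * z ^+ 2) * (1 + (q ^+ (2 * k + 1))%:C * z ^+ 2)
        * (1 + (q ^+ (2 * k + 2))%:C * z ^+ 2)) : R[i]^o) = f.
  by apply/funext => k; rewrite /f /summand /c !rmorphXn.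
rewrite [(q ^+ 2)%:C]rmorphXn /= -/c.
have sE K : series f K = S z K by rewrite /series /= big_mkord.
(* Here z^2 = 1: the prefactor makes G vanish, and the estimate on partial sums bounds [Gpoly]
   itself. *)
have [z4|z4] := eqVneq (1 - z ^+ 4) 0.
  rewrite z4 mulr0 mul0r; apply: (@norm_le_of_geometric _ _ D0) => K.
  by have := psum N K hy; rewrite z4 mulr0 mul0r.
set v := (1 - c ^+ 2) * (1 - z ^+ 4) in psum *.
have v0 : v != 0.
  apply: mulf_neq0 => //; rewrite subr_eq0 eq_sym; apply/eqP => h.
  have := r_bounds => /andP[r0 r1].
  have : `|c ^+ 2| < 1 by rewrite normrX expc_real -[1]/(1%:C) ltcR exprn_ilt1.
  by rewrite h normr1 ltxx.
have [vn vE vn0] : exists2 t : R, `|v| = t%:C & 0 < t.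
  by apply: gt0_complexP; rewrite normr_gt0.
(* Convergence of the series: [v] times any late partial sum is close to one and the same polynomial
   [Gpoly M.+1 z]. *)
have [l hl] : exists l : R[i], (series f : nat -> R[i]^o) @ \oo --> (l : R[i]^o).
  apply: complex_cauchy_cvg => t t0.
  have [M hM] := geometric_small (4 * D0 / vn) r_bounds t0.
  exists M.+1 => -[//|m] [//|p] Mm Mp.
  have e1 : `|v| * `|series f m.+1 - series f p.+1| <= (4 * D0 * r ^+ M)%:C.
    rewrite -normrM mulrBr !sE.
    have -> : v * S z m.+1 - v * S z p.+1 =
      (v * S z m.+1 - Gpoly M.+1 z) - (v * S z p.+1 - Gpoly M.+1 z) by ring.
    apply: le_trans (ler_normB _ _) _; apply: le_trans (lerD (psum M m hy) (psum M p hy)) _.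
    rewrite -rmorphD lecR.
    have mono m' : (M <= m')%N -> r ^+ m' <= r ^+ M.
      by move=> h; case/andP: r_bounds => r0 r1; apply: ler_wiXn2l => //; apply: ltW.
    have h1 := ler_wpM2l D00 (mono m Mm); have h2 := ler_wpM2l D00 (mono p Mp).
    by rewrite -[4 * D0 * _]mulrA; lra.
  have := hM M (leqnn _); rewrite -(ltr_pM2l vn0).
  have -> : vn * (4 * D0 / vn * r ^+ M) = 4 * D0 * r ^+ M by field; rewrite gt_eqF.
  rewrite -ltcR [(vn * t)%:C]rmorphM /= -vE => h; have := le_lt_trans e1 h.
  by rewrite ltr_pM2l // normr_gt0.
rewrite (cvg_lim (@norm_hausdorff _ _) hl).
rewrite normcE2 lecR; apply/ler_addgt0Pr => t t0.
have t2 : 0 < t / 2 by rewrite divr_gt0.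
have [K1 hK1] := geometric_small D0 r_bounds t2.
have tv : 0 < ((t / 2) / vn)%:C :> R[i] by rewrite ltcR divr_gt0.
have /cvgrPdist_lt /(_ _ tv) [K2 _ hK2] := hl.
pose K := maxn K1 K2.
have a1 : `|v| * `|l - S z K.+1| <= (t / 2)%:C.
  have := hK2 K.+1; rewrite /= sE => /(_ (leq_trans (leq_maxr _ _) (leqnSn _))) h.
  apply: le_trans (ler_wpM2l (normr_ge0 v) (ltW h)) _.
  by rewrite vE -rmorphM lecR mulrC divfK // gt_eqF.
have a2 := psum N K hy.
rewrite -lecR -normcE2.
have -> : v * l - Gpoly N.+1 z = v * (l - S z K.+1) + (v * S z K.+1 - Gpoly N.+1 z) by ring.
apply: le_trans (ler_normD _ _) _; rewrite normrM.
apply: le_trans (lerD a1 a2) _; rewrite -rmorphD lecR.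
by have := hK1 K (leq_maxl _ _); lra.
Qed.

End GApprox.

(** * Means over the circle *)

Section CircleMean.
Variable R : realType.
Implicit Types (f g : R -> R) (t : R).

Definition J f : R := (2 * pi)^-1 * \int[lebesgue_measure]_(t in `[0, 2 * pi]) f t.

Lemma twopi_gt0 : 0 < 2 * pi :> R.
Proof. by rewrite mulr_gt0 ?pi_gt0. Qed.

Lemma cont_integrable f (a b : R) : continuous f ->
  lebesgue_measure.-integrable `[a, b] (EFin \o f).
Proof.
move=> cf; apply: continuous_compact_integrable; first exact: segment_compact.
exact: continuous_subspaceT.
Qed.

Lemma J_lin f g (c : R) : continuous f -> continuous g ->
  J (fun t => f t + c * g t) = J f + c * J g.
Proof.
move=> cf cg; have ccg : continuous (fun t => c * g t).
  by move=> x; apply: cvgMl_tmp; apply: cg.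
rewrite /J RintegralD ?cont_integrable //.
by rewrite RintegralZl ?cont_integrable // mulrDr mulrCA.
Qed.

Lemma eq_J f g : f =1 g -> J f = J g.
Proof. by move=> fg; congr J; apply/funext. Qed.

Lemma J_cst (c : R) : J (fun=> c) = c.
Proof.
rewrite /J Rintegral_cst //= lebesgue_measure_itv /= lte_fin twopi_gt0 oppr0 addr0 /=.
by rewrite mulrCA mulVf ?mulr1 // gt_eqF ?twopi_gt0.
Qed.

Lemma J_le f (B : R) : continuous f -> (forall t, `|f t| <= B) -> `|J f| <= B.
Proof.
move=> cf hf; rewrite normrM ger0_norm ?invr_ge0 ?(ltW twopi_gt0) //.
have cN : continuous (fun t => `|f t|).
  by move=> x; apply: cvg_norm; apply: cf.
rewrite -[leRHS]J_cst; apply: ler_wpM2l; first by rewrite invr_ge0 ?(ltW twopi_gt0).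
apply: le_trans (le_normr_Rintegral _ _) _ => //; first exact: cont_integrable.
by apply: le_Rintegral; rewrite ?cont_integrable // => x; apply: cvg_cst.
Qed.

Definition cosm (m : nat) t : R := cos (m%:R * t).

Lemma cont_cosm m : continuous (cosm m).
Proof.
move=> x; apply: continuous_comp; last exact: continuous_cos.
by apply: cvgMl_tmp; apply: cvg_id.
Qed.

Lemma J_cosm m : J (cosm m.+1) = 0.
Proof.
pose F t := sin (m.+1%:R * t) / m.+1%:R.
have dF t : is_derive t 1 F (cosm m.+1 t).
  rewrite /F /cosm.
  apply: trigger_derive; rewrite /GRing.scale /=.
  by field.
have h : (\int[lebesgue_measure]_(t in `[0%R, (2 * pi)%R]) (cosm m.+1 t)%:E = (F (2 * pi)%R)%:E - (F 0%R)%:E)%E.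
  apply: continuous_FTC2; first exact: twopi_gt0.
  - by apply: continuous_subspaceT; apply: cont_cosm.
  - have cF : continuous F.
      by move=> x; apply: differentiable_continuous; apply/derivable1_diffP; case: (dF x).
    split.
    + by move=> x _; case: (dF x).
    + by apply: cvg_at_right_filter; apply: cF.
    + by apply: cvg_at_left_filter; apply: cF.
  - by move=> x _; rewrite derive1E; apply: derive_val.
rewrite /J /Rintegral h /F mulr0 sin0 mul0r.
have -> : sin (m.+1%:R * (2 * pi)) = 0 :> R.
  elim: m.+1 => [|k IH]; first by rewrite mul0r sin0.
  by rewrite -natr1 mulrDl mul1r [X in _ + X]mulr_natl sinD2pi.
by rewrite mul0r /= subrr mulr0.
Qed.

Lemma unif_limit_continuous f :
  (forall e, 0 < e -> exists2 g, continuous g & forall t, `|f t - g t| <= e) -> continuous f.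
Proof.
move=> hf x; apply/cvgrPdist_lt => e e0.
have e4 : 0 < e / 4 by rewrite divr_gt0.
have [g cg hg] := hf _ e4.
have /cvgrPdist_lt /(_ _ e4) := cg x; apply: filterS => y hy.
have -> : f x - f y = (f x - g x) + (g x - g y) - (f y - g y) by ring.
have h1 := hg x; have h2 := hg y.
apply: le_lt_trans (ler_normB _ _) _; have := ler_normD (f x - g x) (g x - g y).
by lra.
Qed.

End CircleMean.

Section Circle.
Variable R : realType.
Implicit Types t : R.

Definition circ t : R[i] := cos t +i* sin t.

Lemma circ_norm t : `|circ t| = 1.
Proof. by rewrite normcE2 /nz /= cos2Dsin2 sqrtr1. Qed.

Lemma circD t1 t2 : circ (t1 + t2) = circ t1 * circ t2.
Proof. by apply/eqP; rewrite eq_complex /= cosD sinD addrC !eqxx /= addrC mulrC. Qed.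

Lemma circ0 : circ 0 = 1.
Proof. by rewrite /circ cos0 sin0. Qed.

Lemma circX m t : circ t ^+ m = circ (m%:R * t).
Proof.
elim: m => [|m IH]; first by rewrite mul0r circ0 expr0.
by rewrite exprS IH -circD -[m.+1%:R]nat1r mulrDl mul1r.
Qed.

Lemma circV t : (circ t)^-1 = circ (- t).
Proof.
have h : circ t * circ (- t) = 1 by rewrite -circD subrr circ0.
have c0 : circ t != 0.
  by apply/eqP => e; move/eqP: h; rewrite e mul0r eq_sym oner_eq0.
by rewrite -[RHS]mul1r -(mulVf c0) -mulrA h mulr1.
Qed.

Lemma circ_add_inv t : circ t + (circ t)^-1 = (2 * cos t)%:C.
Proof.
rewrite circV /circ cosN sinN; apply/eqP; rewrite eq_complex /=.
by rewrite subrr eqxx andbT; apply/eqP; ring.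
Qed.

End Circle.

(** * Fourier coefficients of the density *)

Section CircularDensity.
Variables (R : realType) (q : R).
Hypothesis q_bounds : -1 < q < 0.
Implicit Types t : R.
Let r : R := `|q|.

(** For [k = 0] the truncated predecessor gives [qtanh q 0 = 0], so [gr 0 = 1]: the density has
    total mass 1. *)
Definition gr k : R := (1 + q) / (1 - q) * (qtanh q k.+1 - qtanh q k.-1).
Definition Fpoly N t : R := \sum_(k < N) (-1) ^+ k * gr k * cosm (2 * k) t.

Lemma GcoefE k : Gcoef q k = (gr k)%:C.
Proof.
have hd (a b : R) : (a / b)%:C = a%:C / b%:C by apply: fmorph_div.
have hB (a b : R) : (a - b)%:C = a%:C - b%:C by apply: rmorphB.
have hD (a b : R) : (a + b)%:C = a%:C + b%:C by apply: rmorphD.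
have hM (a b : R) : (a * b)%:C = a%:C * b%:C by apply: rmorphM.
have h i : tanhq q%:C i = (qtanh q i)%:C by rewrite /tanhq /qtanh hd hB hD rmorphXn.
by rewrite /Gcoef !h /gr hM hB hd hD [(1 - q)%:C]hB.
Qed.

Lemma Gpoly_sym N t :
  2^-1 * (Gpoly q N (circ t) + Gpoly q N (circ t)^-1) = (Fpoly N t)%:C.
Proof.
rewrite /Gpoly -big_split mulr_sumr /Fpoly rmorph_sum; apply: eq_bigr => k _ /=.
rewrite GcoefE -mulrDl circV.
have e s : (- circ s ^+ 2) ^+ k = (-1) ^+ k * circ ((2 * k)%:R * s).
  by rewrite [LHS]exprNn -exprM circX.
rewrite !e mulrN -circV -mulrDr circ_add_inv /cosm.
rewrite !rmorphM rmorphXn rmorphN rmorph1 rmorph_nat /=.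
move: ((cos _)%:C) (_%:C * _%:C * _%:C) ((-1) ^+ k) => a b c.
by field.
Qed.

Lemma F_approx : exists2 D : R, 0 <= D &
  forall t N, `|F q (circ t) - (Fpoly N.+1 t)%:C| <= (D * r ^+ N)%:C.
Proof.
have [D D0 hD] := G_approx q_bounds; exists D => // t N.
have h1 := hD _ N (circ_norm t); have h2 := hD _ N (circ_norm (- t)).
rewrite -circV in h2; rewrite -Gpoly_sym /F -mulrBr normrM.
have -> (a b c d : R[i]) : a + b - (c + d) = (a - c) + (b - d) by ring.
have -> : `|2^-1 : R[i]| = 2^-1 by rewrite normfV ger0_norm.
have := le_trans (ler_normD _ _) (lerD h1 h2).
rewrite -/r; move: (_%:C) (`|_|) => a b h.
by rewrite ler_pdivrMl // mulr_natl mulr2n.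
Qed.

Definition Fr t : R := complex.Re (F q (circ t)).

Lemma Fr_approx : exists2 D : R, 0 <= D &
  forall t N, `|Fr t - Fpoly N.+1 t| <= D * r ^+ N.
Proof.
have [D D0 hD] := F_approx; exists D => // t N.
have := hD t N; rewrite normcE2 lecR; apply: le_trans.
rewrite /Fr; case: (F q (circ t)) => a b /=.
by rewrite -sqrtr_sqr ler_sqrt ?nz_ge0 // /nz /= lerDl sqr_ge0.
Qed.

(** The cosine polynomials that approximate F have real coefficients. *)
Lemma F_real t : F q (circ t) = (Fr t)%:C.
Proof.
have [D D0 hD] := F_approx.
suff : complex.Im (F q (circ t)) = 0 by rewrite /Fr; case: (F q (circ t)) => a b /= ->.
apply/eqP; rewrite -normr_eq0 eq_le normr_ge0 andbT.
apply/ler_addgt0Pr => e e0; rewrite add0r.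
have [K hK] := geometric_small D (r_bounds q_bounds) e0.
apply: le_trans (ltW (hK K (leqnn _))).
have := hD t K; rewrite normcE2 lecR; apply: le_trans.
case: (F q (circ t)) => a b /=.
by rewrite -sqrtr_sqr ler_sqrt ?nz_ge0 // /nz /= subr0 lerDr sqr_ge0.
Qed.

Lemma contM (f g : R -> R) : continuous f -> continuous g -> continuous (fun t => f t * g t).
Proof. by move=> cf cg x; apply: cvgM; [apply: cf|apply: cg]. Qed.

Lemma contD (f g : R -> R) : continuous f -> continuous g -> continuous (fun t => f t + g t).
Proof. by move=> cf cg x; apply: cvgD; [apply: cf|apply: cg]. Qed.

Lemma cont_cst (c : R) : continuous (fun _ : R => c).
Proof. by move=> x; apply: cvg_cst. Qed.

Lemma cont_sum (n : nat) (f : nat -> R -> R) : (forall k, continuous (f k)) ->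
  continuous (fun t => \sum_(k < n) f k t).
Proof.
move=> cf; elim: n => [|n IH].
  have -> : (fun t => \sum_(k < 0) f k t) = fun=> 0 by apply/funext => t; rewrite big_ord0.
  exact: cont_cst.
have -> : (fun t => \sum_(k < n.+1) f k t) = fun t => \sum_(k < n) f k t + f n t.
  by apply/funext => t; rewrite big_ord_recr.
exact: contD.
Qed.

Lemma J_sum (n : nat) (f : nat -> R -> R) : (forall k, continuous (f k)) ->
  J (fun t => \sum_(k < n) f k t) = \sum_(k < n) J (f k).
Proof.
move=> cf; elim: n => [|n IH].
  rewrite big_ord0 -[RHS](@J_cst R); apply: eq_J => t; exact: big_ord0.
rewrite big_ord_recr /= -IH -[X in _ + X]mul1r -J_lin //; last exact: cont_sum.
by apply: eq_J => t; rewrite big_ord_recr mul1r.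
Qed.

Lemma JZ (c : R) f : continuous f -> J (fun t => c * f t) = c * J f.
Proof.
move=> cf; rewrite -[RHS]add0r -(@J_cst R 0) -J_lin //; last exact: cont_cst.
by apply: eq_J => t; rewrite add0r.
Qed.

Lemma cont_Fpoly N : continuous (Fpoly N).
Proof.
apply: (@cont_sum N (fun k t => (-1) ^+ k * gr k * cosm (2 * k) t)) => k.
by apply: contM; [apply: cont_cst|apply: cont_cosm].
Qed.

Lemma cont_Fr : continuous Fr.
Proof.
have [D D0 hD] := Fr_approx; apply: unif_limit_continuous => e e0.
have [K hK] := geometric_small D (r_bounds q_bounds) e0.
exists (Fpoly K.+1); first exact: cont_Fpoly.
by move=> t; apply: le_trans (hD t K) (ltW (hK K _)).
Qed.

Lemma cosm_norm m t : `|cosm m t| <= 1.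
Proof. by rewrite ler_norml cos_geN1 cos_le1. Qed.

Lemma Fr_bounded : exists B : R, forall t, `|Fr t| <= B.
Proof.
have [D D0 hD] := Fr_approx; exists (D + `|gr 0|) => t.
have := hD t 0; rewrite expr0 mulr1 /Fpoly big_ord1 expr0 mul1r => h.
rewrite -(subrK (gr 0 * cosm (2 * 0) t) (Fr t)); apply: le_trans (ler_normD _ _) _.
apply: lerD => //; rewrite normrM -[leRHS]mulr1.
by apply: ler_pM; rewrite ?normr_ge0 ?cosm_norm.
Qed.

Lemma J_cosm_mul (a b : nat) :
  J (fun t => cosm a t * cosm b t) = if a == b then (if a == 0 then 1 else 2^-1) else 0.
Proof.
wlog ab : a b / (a <= b)%N => [h|].
  case/orP: (leq_total a b) => [|ba]; first exact: h.
  rewrite eq_sym -(eq_J (fun t => mulrC (cosm b t) (cosm a t))) h //.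
  by case: eqP => [->|].
have -> : J (fun t => cosm a t * cosm b t) =
    J (fun t => 2^-1 * cosm (b - a) t + 2^-1 * cosm (b + a) t).
  apply: eq_J => t; rewrite /cosm natrB // natrD mulrBl mulrDl cosB cosD.
  by field.
have cZ m : continuous (fun t : R => 2^-1 * cosm m t).
  by apply: contM; [apply: cont_cst|apply: cont_cosm].
rewrite J_lin ?JZ //; try exact: cont_cosm.
have J0 : J (cosm 0) = 1 :> R.
  by rewrite -[RHS]J_cst; apply: eq_J => t; rewrite /cosm mul0r cos0.
case: (eqVneq a b) => [->|anb].
  by rewrite subnn J0; case: (b) => [|c]; rewrite ?J0 ?addnS ?J_cosm; field.
have [k ->] : exists k, (b - a)%N = k.+1 by exists (b - a).-1; lia.
have [k' ->] : exists k, (b + a)%N = k.+1 by exists (b + a).-1; lia.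
by rewrite !J_cosm; ring.
Qed.

Definition fcoef (m : nat) : R :=
  if odd m then 0 else (-1) ^+ m./2 * gr m./2 * (if m == 0 then 1 else 2^-1).

Lemma J_Fpoly N m : (m < N)%N -> J (fun t => Fpoly N t * cosm m t) = fcoef m.
Proof.
move=> mN.
have -> : J (fun t => Fpoly N t * cosm m t) =
   \sum_(k < N) (-1) ^+ k * gr k * J (fun t => cosm (2 * k) t * cosm m t).
  have ck k : continuous (fun t : R => cosm (2 * k) t * cosm m t).
    by apply: contM; apply: cont_cosm.
  rewrite (eq_bigr (fun k : 'I_N => J (fun t => (-1) ^+ k * gr k * (cosm (2 * k) t * cosm m t)))).
    rewrite -(@J_sum N (fun k t => (-1) ^+ k * gr k * (cosm (2 * k) t * cosm m t))).
      by apply: eq_J => t; rewrite /Fpoly mulr_suml; apply: eq_bigr => k _; rewrite [RHS]mulrA.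
    by move=> k; apply: contM; [apply: cont_cst|].
  by move=> k _; rewrite JZ.
rewrite /fcoef; case: ifP => om.
  apply: big1 => k _; rewrite J_cosm_mul; case: eqP => [e|_]; last by rewrite mulr0.
  by move: om; rewrite -e mul2n odd_double.
have em : (2 * m./2 = m)%N by rewrite mul2n -[RHS]odd_double_half om.
have hm : (m./2 < N)%N by lia.
rewrite (bigD1 (Ordinal hm)) //= big1 ?addr0 => [|k].
  by rewrite J_cosm_mul em eqxx.
rewrite -val_eqE /= => kn; rewrite J_cosm_mul; case: eqP => [e|_]; last by rewrite mulr0.
by exfalso; move: kn; rewrite -e mul2n doubleK eqxx.
Qed.

(** From the degree [m] on, the truncations all have the same [m]-th cosine coefficient, so the
    approximation error can be sent to 0. *)
Lemma J_Fr m : J (fun t => Fr t * cosm m t) = fcoef m.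
Proof.
have [D D0 hD] := Fr_approx.
apply/eqP; rewrite -subr_eq0 -normr_eq0 eq_le normr_ge0 andbT.
apply/ler_addgt0Pr => e e0; rewrite add0r.
have [K hK] := geometric_small D (r_bounds q_bounds) e0.
pose N := maxn K m; have hN : (m < N.+1)%N by rewrite ltnS leq_maxr.
apply: le_trans (ltW (hK N (leq_maxl _ _))).
have c1 : continuous (fun t => Fr t * cosm m t).
  by apply: contM; [apply: cont_Fr|apply: cont_cosm].
have c2 : continuous (fun t => Fpoly N.+1 t * cosm m t).
  by apply: contM; [apply: cont_Fpoly|apply: cont_cosm].
rewrite -(J_Fpoly hN) -mulN1r -J_lin //; apply: J_le.
  by apply: contD => //; apply: contM => //; apply: cont_cst.
move=> t; rewrite mulN1r -mulrBl normrM -[leRHS]mulr1.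
by apply: ler_pM; rewrite ?normr_ge0 ?hD ?cosm_norm.
Qed.

End CircularDensity.

(** * Orthogonal polynomials of the density *)

Section QUltraspherical.
Variables (R : realType) (q : R).
Hypothesis q_bounds : -1 < q < 0.
Implicit Types (x t : R) (r k s : nat).

(* Continuous q-ultraspherical polynomials with parameter [beta = - q]. *)
Fixpoint qpol r x : R :=
  match r with
  | 0 => 1
  | r1.+1 => match r1 with
    | 0 => x
    | r2.+1 => x * qpol r1 x - qtanh q r2.+1 * qtanh q r2.+2 * qpol r2 x
    end
  end.

Lemma qpol_SS r x :
  qpol r.+2 x = x * qpol r.+1 x - qtanh q r.+1 * qtanh q r.+2 * qpol r x.
Proof. by []. Qed.

(** The quotient (-q; q)_k / (q; q)_k of q-shifted factorials. *)
Fixpoint qb k : R := if k is k'.+1 then qb k' / qtanh q k else 1.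

Lemma qtanh_neq0 k : qtanh q k.+1 != 0.
Proof.
rewrite mulf_neq0 ?invr_neq0 ?addr1_expq_neq0 //.
exact: subr1_expq_neq0.
Qed.

Lemma qb_neq0 k : qb k != 0.
Proof. by elim: k => [|k IH] /=; rewrite ?oner_neq0 // mulf_neq0 ?invr_neq0 ?qtanh_neq0. Qed.

Lemma qtanhD a b : qtanh q (a + b) * (1 + qtanh q a * qtanh q b) = qtanh q a + qtanh q b.
Proof.
rewrite /qtanh exprD.
have ha := addr1_expq_neq0 q_bounds a; have hb := addr1_expq_neq0 q_bounds b.
have hab := addr1_expq_neq0 q_bounds (a + b); rewrite exprD in hab.
by move: (q ^+ a) (q ^+ b) ha hb hab => x y ha hb hab; field; rewrite ha hb hab.
Qed.

(** Integer frequencies, because r - 2k changes sign along the cosine expansion. *)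
Definition cosz (m : int) t : R := cos (m%:~R * t).

Lemma cosz_abs m t : cosz m t = cosm `|m|%N t.
Proof.
rewrite /cosz /cosm; case: m => [m|m] //.
by rewrite NegzE mulrNz mulNr cosN abszN.
Qed.

Lemma two_cos_cosz m t : 2 * cos t * cosz m t = cosz (m + 1) t + cosz (m - 1) t.
Proof.
rewrite /cosz; have -> : (m + 1)%:~R * t = m%:~R * t + t by rewrite intrD mulrDl mul1r.
have -> : (m - 1)%:~R * t = m%:~R * t - t by rewrite intrB mulrBl mul1r.
by rewrite cosD cosB; ring.
Qed.

(** The coefficients of Rogers' expansion of the q-ultraspherical polynomials, divided by [qb r] to
    make the polynomials monic. *)
Definition gam r k : R := qb k * qb (r - k) / qb r.

Lemma gam0 r : gam r 0 = 1.
Proof. by rewrite /gam subn0 mul1r divff // qb_neq0. Qed.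

Lemma gamn r : gam r r = 1.
Proof. by rewrite /gam subnn mulr1 divff // qb_neq0. Qed.

(** After division by the common factors this is the addition law [qtanhD] at [k.+1] and
    [(r - k).+1], whose sum is [r.+2]. *)
Lemma gam_rec r k : (k <= r)%N ->
  gam r.+2 k.+1 = gam r.+1 k.+1 + gam r.+1 k - qtanh q r.+1 * qtanh q r.+2 * gam r k.
Proof.
move=> kr; rewrite /gam !subSS.
have -> : (r.+1 - k)%N = (r - k).+1 by lia.
rewrite /=; have := qtanhD k.+1 (r - k).+1.
have -> : (k.+1 + (r - k).+1)%N = r.+2 by lia.
have h1 := qtanh_neq0 k; have h2 := qtanh_neq0 (r - k); have h3 := qtanh_neq0 r.
have h4 := qtanh_neq0 r.+1; have h5 := qb_neq0 r.
move: (qtanh q k.+1) (qtanh q (r - k).+1) (qtanh q r.+1) (qtanh q r.+2) (qb k)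
  (qb (r - k)) (qb r) h1 h2 h3 h4 h5 => c1 c2 c3 c4 b1 b2 b3 h1 h2 h3 h4 h5 e.
have -> : b1 / c1 * (b2 / c2) / (b3 / c3 / c4) = b1 * b2 * c3 * (c4 / (c1 * c2)) / b3.
  by field; rewrite h1 h2 h3 h4 h5.
have -> : c4 / (c1 * c2) = (c1 + c2) / (c1 * c2) - c4.
  by rewrite -e; field; rewrite h1 h2.
by field; rewrite h1 h2 h3 h5.
Qed.

Lemma qpol_cos r t :
  qpol r (2 * cos t) = \sum_(k < r.+1) gam r k * cosz (r%:Z - (2 * k)%:Z) t.
Proof.
suff [] : qpol r (2 * cos t) = \sum_(k < r.+1) gam r k * cosz (r%:Z - (2 * k)%:Z) t /\
  qpol r.+1 (2 * cos t) = \sum_(k < r.+2) gam r.+1 k * cosz (r.+1%:Z - (2 * k)%:Z) t by [].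
elim: r => [|r [IH0 IH1]].
  split; first by rewrite big_ord1 gam0 /= /cosz subrr mul0r cos0 mul1r.
  rewrite !big_ord_recr big_ord0 /= gam0 gamn add0r !mul1r !cosz_abs muln0 muln1.
  by rewrite /cosm (_ : `|1%:Z - 0%:Z|%N = 1%N) // (_ : `|1%:Z - 2%:Z|%N = 1%N) // mul1r; ring.
split=> //; rewrite qpol_SS IH1 IH0.
pose f k := cosz (r.+2%:Z - (2 * k)%:Z) t.
have e1 : 2 * cos t * (\sum_(k < r.+2) gam r.+1 k * cosz (r.+1%:Z - (2 * k)%:Z) t) =
    \sum_(k < r.+2) gam r.+1 k * f k + \sum_(k < r.+2) gam r.+1 k * f k.+1.
  rewrite mulr_sumr -big_split; apply: eq_bigr => k _ /=.
  rewrite mulrCA two_cos_cosz mulrDr /f; congr (_ * cosz _ t + _ * cosz _ t); lia.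
have e2 : \sum_(k < r.+1) gam r k * cosz (r%:Z - (2 * k)%:Z) t =
    \sum_(k < r.+1) gam r k * f k.+1.
  by apply: eq_bigr => k _; rewrite /f; congr (_ * cosz _ t); lia.
have e3 : \sum_(k < r.+3) gam r.+2 k * cosz (r.+2%:Z - (2 * k)%:Z) t =
    f 0%N + \sum_(k < r.+1) gam r.+2 k.+1 * f k.+1 + f r.+2.
  by rewrite big_ord_recl big_ord_recr /= gam0 mul1r addrA [bump 0 r.+1]/= gamn mul1r.
have e4 : \sum_(k < r.+2) gam r.+1 k * f k = f 0%N + \sum_(k < r.+1) gam r.+1 k.+1 * f k.+1.
  by rewrite big_ord_recl gam0 mul1r.
have e5 : \sum_(k < r.+2) gam r.+1 k * f k.+1 = \sum_(k < r.+1) gam r.+1 k * f k.+1 + f r.+2.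
  by rewrite big_ord_recr /= gamn mul1r.
have e6 : \sum_(k < r.+1) gam r.+2 k.+1 * f k.+1 =
  \sum_(k < r.+1) gam r.+1 k.+1 * f k.+1 + \sum_(k < r.+1) gam r.+1 k * f k.+1
  - qtanh q r.+1 * qtanh q r.+2 * \sum_(k < r.+1) gam r k * f k.+1.
  rewrite mulr_sumr -sumrN -!big_split; apply: eq_bigr => k _ /=.
  by rewrite gam_rec -1?ltnS //; ring.
by rewrite e1 e2 e3 e4 e5 e6; ring.
Qed.

(** The difference c_(j+1) - c_(j-1) as a rational function of x = q^j. In this form it makes sense
    for negative j and is invariant under inversion of x. *)
Definition qW x : R := 2 * x * (q^-1 - q) / ((1 + q * x) * (1 + x / q)).

Lemma qadd_neq0 a b : q ^+ a + q ^+ b != 0.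
Proof.
wlog ab : a b / (a <= b)%N => [h|].
  by case/orP: (leq_total a b) => h'; [|rewrite addrC]; apply: h.
rewrite -(subnKC ab) exprD -[X in X + _]mulr1 -mulrDr mulf_neq0 //.
  by rewrite expf_neq0 // q_neq0.
exact: addr1_expq_neq0.
Qed.

Lemma qW_tanh j : qtanh q j.+2 - qtanh q j = qW (q ^+ j.+1).
Proof.
rewrite /qtanh /qW; have := addr1_expq_neq0 q_bounds j.+2.
have := addr1_expq_neq0 q_bounds j; have q0 := q_neq0 q_bounds.
rewrite !exprS; move: (q ^+ j) => x h1 h2.
by field; rewrite h1 h2 q0.
Qed.

(** The case [j = 0] fits the formula: there c_(-1) = - c_1 would double the value, which the weight
    1 instead of 1/2 makes up for. *)
Lemma gr_qW j : gr q j * (if j == 0 then 1 else 2^-1) = (1 + q) / (1 - q) * qW (q ^+ j) / 2.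
Proof.
have q0 := q_neq0 q_bounds.
have h1 := subq_neq0 q_bounds; have h2 := addq_neq0 q_bounds.
rewrite /gr; case: j => [|j] /=; last by rewrite qW_tanh mulrA.
have e : 1 + 1 / q = (1 + q) / q by field.
rewrite /qtanh /qW expr0 expr1 subrr mul0r subr0 !mulr1 e.
by field; rewrite ?h1 ?h2 ?q0.
Qed.

Lemma qW_inv x : x != 0 -> 1 + q * x != 0 -> q + x != 0 -> qW x^-1 = qW x.
Proof.
move=> x0 h1 h2; have q0 := q_neq0 q_bounds; rewrite /qW.
have e1 : 1 + q / x = (q + x) / x by field.
have e2 : 1 + x^-1 / q = (1 + q * x) / (q * x) by field; rewrite q0 x0.
have e3 : 1 + x / q = (q + x) / q by field.
rewrite e1 e2 e3; field.
by rewrite h1 h2 x0 q0.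
Qed.

(** [qW_inv] removes the absolute value, which leaves a rational function of q^k suited to summation
    over k. *)
Lemma fcoef_qW s k : fcoef q (2 * `|s%:Z - k%:Z|)%N =
  (-1) ^+ (s + k) * ((1 + q) / (1 - q) * qW (q ^+ k / q ^+ s) / 2).
Proof.
rewrite /fcoef mul2n odd_double doubleK double_eq0 -mulrA gr_qW.
have q0 := q_neq0 q_bounds.
have -> : (-1) ^+ `|s%:Z - k%:Z| = (-1) ^+ (s + k) :> R.
  by rewrite -signr_odd -[RHS]signr_odd; congr (_ ^+ nat_of_bool _); lia.
congr (_ * (_ * _ / 2)).
case/orP: (leq_total s k) => h.
  have [d ->] : exists d, k = (s + d)%N by exists (k - s)%N; rewrite subnKC.
  have -> : `|s%:Z - (s + d)%:Z|%N = d by lia.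
  by rewrite exprD mulrC mulKf // expf_neq0.
have [d ->] : exists d, s = (k + d)%N by exists (s - k)%N; rewrite subnKC.
have -> : `|(k + d)%:Z - k%:Z|%N = d by lia.
have -> : q ^+ k / q ^+ (k + d) = (q ^+ d)^-1.
  by rewrite exprD invfM mulrA divff ?mul1r // expf_neq0.
rewrite qW_inv ?expf_neq0 // -?exprS ?addr1_expq_neq0 //.
by rewrite -[X in X + _]expr1 qadd_neq0.
Qed.

(** Indefinite summation: the right-hand side B_K satisfies that B_K - B_(K-1) is the summand at K.
    At [K = 2 * s.+1] the factor [1 - q ^+ (2 * s.+1 - K)] is 0. *)
Lemma orth_partial s K : (K <= 2 * s.+1)%N ->
  \sum_(k < K.+1) (-1) ^+ k * (qb k * qb (2 * s.+1 - k)) * qW (q ^+ k / q ^+ s.+1) =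
  (-1) ^+ K * (1 + q ^+ K.+1) * (1 - q ^+ (2 * s.+1 - K)) * (qb K * qb (2 * s.+1 - K)) *
  (2 * (q^-1 - q) / ((1 + q) * (1 - q ^+ s.+1) * (1 + q ^+ s.+2)) *
   (q ^+ K.+1 / q ^+ s.+1 / ((1 + q ^+ K.+1 / q ^+ s.+1) * (1 + q ^+ K.+1 / q ^+ s.+1 / q)))).
Proof.
have q0 := q_neq0 q_bounds; have q1 := addq_neq0 q_bounds.
have hS1 := subr1_expq_neq0 q_bounds s; have hS2 := addr1_expq_neq0 q_bounds s.+2.
have S0 : q ^+ s.+1 != 0 by rewrite expf_neq0.
(* The telescoping identity, with x = q^k and y = q^(2(s+1) - k). The first product is B_k and the
   second is - B_(k-1), once the alternating sign and the factors [qb] are divided out; at x = 1 the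
   second vanishes, which starts the induction. *)
have key (x y : R) : x != 0 -> q ^+ s.+1 + x != 0 -> q ^+ s.+1 + q * x != 0 ->
   q ^+ s.+1 * q + x != 0 -> y = (q ^+ s.+1) ^+ 2 / x ->
   qW (x / q ^+ s.+1) =
   (1 + q * x) * (1 - y) * (2 * (q^-1 - q) / ((1 + q) * (1 - q ^+ s.+1) * (1 + q ^+ s.+2)) *
     (q * x / q ^+ s.+1 / ((1 + q * x / q ^+ s.+1) * (1 + q * x / q ^+ s.+1 / q))))
  + (1 - x) * (1 + q * y) * (2 * (q^-1 - q) / ((1 + q) * (1 - q ^+ s.+1) * (1 + q ^+ s.+2)) *
     (x / q ^+ s.+1 / ((1 + x / q ^+ s.+1) * (1 + x / q ^+ s.+1 / q)))).
  rewrite [q ^+ s.+2]exprS in hS2 *; rewrite /qW.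
  move: (q ^+ s.+1) S0 hS1 hS2 => S S0 hS1 hS2 x0 h1 h2 h3 ->.
  have e1 : 1 + q * (x / S) = (S + q * x) / S by field.
  have e2 : 1 + x / S / q = (S * q + x) / (S * q) by field; rewrite S0 q0.
  have e3 : 1 + q * x / S = (S + q * x) / S by field.
  have e4 : 1 + q * x / S / q = (S + x) / S by field; rewrite S0 q0.
  have e5 : 1 + x / S = (S + x) / S by field.
  rewrite e1 e2 e3 e4 e5.
  by field; rewrite ?x0 ?S0 ?q0 ?q1 ?h1 ?h2 ?h3 ?hS1 ?hS2.
elim: K => [_|K IH hK].
  have y1 : q ^+ (2 * s.+1) = (q ^+ s.+1) ^+ 2 / 1 by rewrite divr1 mulnC exprM.
  rewrite big_ord1 subn0 !expr0 (key 1 (q ^+ (2 * s.+1))) ?oner_neq0 //.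
  - by rewrite subrr !mul0r addr0 expr1 /= mulr1; ring.
  - by rewrite addrC addr1_expq_neq0.
  - by rewrite mulr1 -[X in _ + X]expr1 qadd_neq0.
  - by rewrite -exprSr addrC addr1_expq_neq0.
rewrite big_ord_recr /= IH; last by lia.
pose m := (2 * s.+1 - K.+1)%N; have -> : (2 * s.+1 - K)%N = m.+1 by rewrite /m; lia.
rewrite -/m.
have ym : q ^+ m = (q ^+ s.+1) ^+ 2 / q ^+ K.+1.
  have : q ^+ m * q ^+ K.+1 = (q ^+ s.+1) ^+ 2 by rewrite -exprD -exprM /m; congr (_ ^+ _); lia.
  by move=> <-; rewrite mulfK // expf_neq0.
rewrite (key (q ^+ K.+1) (q ^+ m)) ?expf_neq0 ?qadd_neq0 -?exprS -?exprSr ?qadd_neq0 //.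
rewrite /= /qtanh.
have hb1 := addr1_expq_neq0 q_bounds K.+1; have hb2 := subr1_expq_neq0 q_bounds m.
have hb3 := subr1_expq_neq0 q_bounds K; have hb4 := addr1_expq_neq0 q_bounds m.+1.
rewrite [(-1) ^+ K.+1]exprS.
move: (2 * (q^-1 - q) / _) (q ^+ K.+1 / q ^+ s.+1 / _) (q ^+ K.+2 / q ^+ s.+1 / _) => A0 A B.
move: ((-1) ^+ K) (qb K) (qb m) (q ^+ K.+1) (q ^+ m.+1) (q ^+ K.+2) (q ^+ m) hb1 hb2 hb3 hb4.
move=> c1 c2 c3 x1 x2 x3 x4 hb1 hb2 hb3 hb4.
by field; rewrite ?hb1 ?hb2 ?hb3 ?hb4.
Qed.

Lemma J_qpol_sum r : J (fun t => Fr q t * qpol r (2 * cos t)) =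
  \sum_(k < r.+1) gam r k * fcoef q `|r%:Z - (2 * k)%:Z|%N.
Proof.
have cf k : continuous (fun t => gam r k * (Fr q t * cosm `|r%:Z - (2 * k)%:Z|%N t)).
  apply: contM; first exact: cont_cst.
  by apply: contM; [apply: cont_Fr|apply: cont_cosm].
rewrite (@eq_J _ _ (fun t => \sum_(k < r.+1) gam r k * (Fr q t * cosm `|r%:Z - (2 * k)%:Z|%N t))).
  rewrite (@J_sum R r.+1 (fun k t => gam r k * (Fr q t * cosm `|r%:Z - (2 * k)%:Z|%N t))) //.
  apply: eq_bigr => k _; rewrite JZ ?J_Fr //.
  by apply: contM; [apply: cont_Fr|apply: cont_cosm].
move=> t; rewrite qpol_cos mulr_sumr; apply: eq_bigr => k _.
by rewrite cosz_abs mulrCA.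
Qed.

(** Odd degrees vanish because F has even frequencies only, and positive even degrees by
    [orth_partial] at its last index. Orthogonality to constants is all that [moment_unique] asks
    for. *)
Lemma J_qpol r : J (fun t => Fr q t * qpol r (2 * cos t)) = (r == 0)%:R.
Proof.
rewrite J_qpol_sum; case: (boolP (odd r)) => [or|er].
  have -> : (r == 0) = false by apply/eqP => e; rewrite e in or.
  apply: big1 => k _; rewrite /fcoef.
  by rewrite (_ : odd `|r%:Z - (2 * k)%:Z| = true) ?mulr0 //; lia.
have [s ->] : exists s, r = (2 * s)%N by exists r./2; rewrite mul2n -[LHS]odd_double_half (negbTE er).
have e (k : nat) : `|(2 * s)%:Z - (2 * k)%:Z|%N = (2 * `|s%:Z - k%:Z|)%N by lia.
under eq_bigr => k _ do rewrite e fcoef_qW.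
case: s e => [|s] _.
  rewrite big_ord1 gam0 mul1r !expr0 mul1r -[_ / 1]/(q ^+ 0 / 1) expr0 divr1.
  have := gr_qW 0; rewrite expr0 => <-.
  rewrite /= mulr1 /gr /qtanh expr0 expr1 subrr mul0r subr0.
  by field; rewrite ?subq_neq0 ?addq_neq0.
have -> : (2 * s.+1 == 0)%N = false by lia.
have := orth_partial (leqnn (2 * s.+1)); rewrite subnn expr0 subrr mulr0 !mul0r => h.
rewrite (eq_bigr (fun k : 'I_(2 * s.+1).+1 =>
    (-1) ^+ s.+1 * ((1 + q) / (1 - q)) / 2 / qb (2 * s.+1) *
    ((-1) ^+ k * (qb k * qb (2 * s.+1 - k)) * qW (q ^+ k / q ^+ s.+1)))) => [|k _].
  by rewrite -mulr_sumr h mulr0.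
rewrite /gam exprD; ring.
Qed.

Definition circ_moment (t r : nat) : R :=
  J (fun x => Fr q x * ((2 * cos x) ^+ t * qpol r (2 * cos x))).

Lemma cont_2cos : continuous (fun x : R => 2 * cos x).
Proof. by move=> x; apply: cvgMl_tmp; apply: continuous_cos. Qed.

Lemma cont_exp (f : R -> R) n : continuous f -> continuous (fun x => f x ^+ n).
Proof.
move=> cf; elim: n => [|n IH].
  by under eq_fun do rewrite expr0; apply: cont_cst.
by under eq_fun do rewrite exprS; apply: contM.
Qed.

Lemma cont_qpol r : continuous (fun x => qpol r (2 * cos x)).
Proof.
suff [] : continuous (fun x => qpol r (2 * cos x)) /\ continuous (fun x => qpol r.+1 (2 * cos x)) by [].
elim: r => [|r [c0 c1]]; first by split; [apply: cont_cst|apply: cont_2cos].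
split=> //; under eq_fun do rewrite qpol_SS -mulNr.
apply: contD; first by apply: contM; [apply: cont_2cos|].
by apply: contM; [apply: cont_cst|].
Qed.

Lemma cont_moment (t r : nat) : continuous (fun x => Fr q x * ((2 * cos x) ^+ t * qpol r (2 * cos x))).
Proof.
apply: contM; first exact: cont_Fr.
by apply: contM; [apply: cont_exp; apply: cont_2cos|apply: cont_qpol].
Qed.

Lemma circ_moment_S0 (t : nat) : circ_moment t.+1 0 = circ_moment t 1.
Proof. by apply: eq_J => x; rewrite /= mulr1 exprSr. Qed.

Lemma circ_moment_SS (t r : nat) :
  circ_moment t.+1 r.+1 = circ_moment t r.+2 + qtanh q r.+1 * qtanh q r.+2 * circ_moment t r.
Proof.
rewrite /circ_moment -J_lin; try exact: cont_moment.
by apply: eq_J => x; rewrite qpol_SS exprS; ring.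
Qed.

Lemma circ_moment_0 r : circ_moment 0 r = (r == 0)%:R.
Proof. by rewrite -J_qpol; apply: eq_J => x; rewrite expr0 mul1r. Qed.

End QUltraspherical.

(** * Functional calculus *)

Section RealToComplex.
Variable R : realType.

Lemma continuous_realC (f : R -> R) :
  continuous f -> continuous (fun x => (f x)%:C : R[i]^o).
Proof.
move=> cf x; apply/cvgrPdist_lt => e e0.
have [r -> r0] := gt0_complexP e0.
have /cvgrPdist_lt /(_ _ r0) := cf x; apply: filterS => y.
by rewrite -rmorphB norm_realC ltcR.
Qed.

Lemma continuous_Re (f : R -> R[i]^o) :
  continuous f -> continuous (fun x => complex.Re (f x)).
Proof.
move=> cf x; apply/cvgrPdist_lt => e e0.
have e0' : 0 < e%:C :> R[i] by rewrite ltcR.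
have /cvgrPdist_lt /(_ _ e0') := cf x; apply: filterS => y hy.
rewrite -ltcR; apply: le_lt_trans hy.
by rewrite -raddfB; apply: normc_ge_Re.
Qed.

Lemma continuous_Im (f : R -> R[i]^o) :
  continuous f -> continuous (fun x => complex.Im (f x)).
Proof.
move=> cf x; apply/cvgrPdist_lt => e e0.
have e0' : 0 < e%:C :> R[i] by rewrite ltcR.
have /cvgrPdist_lt /(_ _ e0') := cf x; apply: filterS => y hy.
rewrite -ltcR; apply: le_lt_trans hy.
rewrite -raddfB normcE2 lecR -sqrtr_sqr; apply: ler_wsqrtr.
by rewrite lerDr sqr_ge0.
Qed.

Lemma small_complex_eq0 (z : R[i]) :
  (forall e : R, 0 < e -> exists2 s : R, z = s%:C & `|s| <= e) -> z = 0.
Proof.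
move=> hz; have [s zs _] := hz 1 ltr01.
suff /eqP : `|s| = 0 by rewrite normr_eq0 zs => /eqP ->.
apply/eqP.
rewrite eq_le normr_ge0 andbT; apply/ler_addgt0Pr => e e0; rewrite add0r.
by have [s' + hs] := hz e e0; rewrite zs => /complexI ->.
Qed.

End RealToComplex.

Section FunctionalCalculus.
Variables (R : realType) (A : cstarAlgType R) (w : A) (Phi : (R -> R[i]^o) -> A).
Hypothesis fc : is_functional_calculus w Phi.
Implicit Types (f g : R -> R) (x e : R).

Definition fcR f : A := Phi (fun x => (f x)%:C).

Lemma continuous_within (f : R -> R[i]^o) :
  continuous f -> {within spectrum w, continuous f}.
Proof. exact: continuous_subspaceT. Qed.

Lemma cont_spec f : continuous f ->
  {within spectrum w, continuous (fun x => (f x)%:C : R[i]^o)}.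
Proof. by move=> cf; apply/continuous_within/continuous_realC. Qed.

(** The calculus is isometric for the supremum over the spectrum, so [Phi] sees only values
    there. *)
Lemma fc_ext (f g : R -> R[i]^o) : continuous f -> continuous g ->
  (forall x, spectrum w x -> f x = g x) -> Phi f = Phi g.
Proof.
move=> /continuous_within cf /continuous_within cg fg.
suff h : Phi (fun x => (-1) * f x + g x) = 0.
  by apply/esym/eqP; rewrite -subr_eq0 addrC -scaleN1r -(fc_lin fc) // h.
apply: cnorm0_eq0; rewrite (fc_norm fc); last first.
  move=> x; apply: cvgD; last exact: cg.
  by apply: cvgMl_tmp; apply: cf.
set B := [set _ | _ in _].
have hB : B `<=` [set 0].
  move=> _ [x /= sx <-]; rewrite fg //.
  rewrite -[LHS]/(complex.Re `|-1 * g x + g x : R[i]|).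
  by rewrite mulN1r addNr normr0.
(* An empty spectrum falls under the convention that the supremum of the empty set is 0. *)
have /subset_set1 [->|->] := hB; [exact: sup0|exact: sup1].
Qed.

Lemma fcR_lin f g x : continuous f -> continuous g ->
  fcR (fun y => x * f y + g y) = x%:C *: fcR f + fcR g.
Proof.
move=> cf cg; rewrite /fcR -(fc_lin fc); try exact: cont_spec.
by congr Phi; apply/funext => y; rewrite rmorphD rmorphM.
Qed.

Lemma fcR_cst x : fcR (fun=> x) = x%:C *: 1.
Proof.
have c0 y : continuous (fun _ : R => y : R[i]^o) by move=> z; apply: cvg_cst.
have z0 : Phi (fun=> 0) = 0.
  transitivity (Phi (fun=> (-1) * 1 + 1)).
    by congr Phi; apply/funext => y; rewrite mulr1 addNr.
  rewrite (fc_lin fc); try exact: continuous_within.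
  by rewrite (fc_1 fc) scaleN1r addNr.
rewrite -(fc_1 fc) -[RHS]addr0 -z0 -(fc_lin fc); try exact: continuous_within.
by congr Phi; apply/funext => y; rewrite mulr1 addr0.
Qed.

Lemma spectrum_bounded : exists M : R, forall x, spectrum w x -> `|x| <= M.
Proof.
set B := [set complex.Re `|x%:C : R[i]| | x in spectrum w].
have nB : cnorm w = sup B.
  rewrite -{1}(fc_id fc) (fc_norm fc) //.
  exact: (@cont_spec (fun x => x) (fun x => cvg_id)).
have BE x : spectrum w x -> B `|x| by move=> sx; exists x => //; rewrite norm_realC.
have [hB|hB] := pselect (has_sup B).
  by exists (sup B) => x /BE; apply: ub_le_sup; case: hB.
(* If the set is empty or unbounded, its [sup] is 0 by convention; then [w = 0], and only 0 can lie
   in its spectrum. *)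
have w0 : w = 0 by apply: cnorm0_eq0; rewrite nB sup_out.
exists 0 => x sx; rewrite normr_le0; apply/eqP; apply: contrapT => /eqP x0.
apply: sx; exists (x^-1%:C%:A); rewrite w0 subr0 -!scalerAl !mul1r !scalerA.
by rewrite -!rmorphM mulVf // mulfV // rmorph1 scale1r.
Qed.

Variable h : {scalar A}.
Hypothesis st : is_state h.

Lemma state_fcR_ge0 f : continuous f -> (forall x, spectrum w x -> 0 <= f x) ->
  0 <= h (fcR f).
Proof.
move=> cf f0; have [_ hp] := st.
(* [f] is the square of [s] only where it is nonnegative, which includes the spectrum; [fc_ext]
   makes this sufficient. *)
pose s x := Num.sqrt (f x).
have cs : continuous s.
  by move=> x; apply: continuous_comp; [apply: cf|apply: sqrt_continuous].
have -> : fcR f = star (fcR s) * fcR s; last exact: hp.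
have cs' := cont_spec cs.
rewrite /fcR -(fc_star fc) //.
have -> : (fun x => ((s x)%:C : R[i]^o)^*%C) = (fun x => (s x)%:C : R[i]^o).
  by apply/funext => x; rewrite conjc_real.
rewrite -(fc_M fc) //.
have -> : (fun x => ((s x)%:C : R[i]^o) * (s x)%:C) = (fun x => (s x * s x)%:C : R[i]^o).
  by apply/funext => x; rewrite rmorphM.
apply: fc_ext => [| |x /f0 fx]; last by rewrite -expr2 sqr_sqrtr.
  exact: continuous_realC.
by apply: continuous_realC => x; apply: cvgM; apply: cs.
Qed.

(** Both [e + f] and [e - f] are nonnegative on the spectrum, so the state takes nonnegative values
    on them; this gives at once that the value on [f] is real and that it is bounded by [e]. *)
Lemma state_fcR_le f e : continuous f -> (forall x, spectrum w x -> `|f x| <= e) ->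
  exists2 r : R, h (fcR f) = r%:C & `|r| <= e.
Proof.
move=> cf hf; have [h1 _] := st.
have ce : continuous (fun _ : R => e) by move=> x; apply: cvg_cst.
have key c : c = 1 \/ c = -1 -> 0 <= c%:C * h (fcR f) + e%:C.
  move=> hc; have -> : c%:C * h (fcR f) + e%:C = h (fcR (fun x => c * f x + e)).
    by rewrite fcR_lin // fcR_cst linearD !linearZ /= h1 mulr1.
  apply: state_fcR_ge0 => [x|x /hf]; first by apply: cvgD; [apply: cvgMl_tmp; apply: cf|apply: cvg_cst].
  by rewrite ler_norml => /andP[]; case: hc => ->; lra.
have /ge0_complexP [t ht t0] := key 1 (or_introl erefl).
have hft : h (fcR f) = (t - e)%:C by rewrite rmorphB /= -ht mul1r addrK.
exists (t - e) => //; have := key (-1) (or_intror erefl).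
rewrite hft -rmorphM -rmorphD /= lecR => h2.
by rewrite ler_norml; apply/andP; split; lra.
Qed.

Lemma fcR_sum (a : nat -> R) N :
  fcR (fun x => \sum_(k < N) a k * x ^+ k) = \sum_(k < N) (a k)%:C *: w ^+ k.
Proof.
have cX k : continuous (fun x => x ^+ k) by exact: exprn_continuous.
have fX k : fcR (fun x => x ^+ k) = w ^+ k.
  elim: k => [|k IH]; first by rewrite -[RHS](fc_1 fc).
  rewrite exprS -IH -{1}(fc_id fc) -(fc_M fc); last exact: cont_spec.
    by congr Phi; apply/funext => x; rewrite exprS rmorphM.
  exact: (@cont_spec (fun x => x) (fun x => cvg_id)).
elim: N => [|N IH].
  under eq_fun do rewrite big_ord0.
  by rewrite fcR_cst scale0r big_ord0.
under eq_fun do rewrite big_ord_recr /= addrC.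
rewrite fcR_lin ?fX ?IH ?big_ord_recr 1?addrC //.
by apply: (@cont_sum R N (fun k x => a k * x ^+ k)) => k x; apply: cvgMl_tmp; apply: cX.
Qed.

End FunctionalCalculus.

(** * From moments to the density *)

Section MomentsDetermineDensity.
Variables (R : realType) (q : R).
Hypothesis q_bounds : -1 < q < 0.
Variables (A : cstarAlgType R) (w : A) (h : {scalar A}).
Hypothesis st : is_state h.
Hypothesis moments : forall t, h (w ^+ t) = (circ_moment q t 0)%:C.
Variable Phi : (R -> R[i]^o) -> A.
Hypothesis fc : is_functional_calculus w Phi.

Lemma cont_weighted (f : R -> R) : continuous f ->
  continuous (fun t => Fr q t * f (2 * cos t)).
Proof.
move=> cf; apply: contM; first exact: cont_Fr.
by move=> x; apply: continuous_comp; [apply: cont_2cos|apply: cf].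
Qed.

Lemma density_poly (p : {poly R}) :
  h (fcR Phi (fun x => p.[x])) = (J (fun t => Fr q t * p.[2 * cos t]))%:C.
Proof.
under eq_fun do rewrite horner_coef.
rewrite (fcR_sum fc) linear_sum /=.
have cE k : continuous (fun t => p`_k * (Fr q t * (2 * cos t) ^+ k)).
  apply: contM; first exact: cont_cst.
  exact: (@cont_weighted (fun x => x ^+ k) (@exprn_continuous R k)).
rewrite (@eq_J _ _ (fun t => \sum_(k < size p) p`_k * (Fr q t * (2 * cos t) ^+ k))).
  rewrite (@J_sum R (size p) (fun k t => p`_k * (Fr q t * (2 * cos t) ^+ k))) // rmorph_sum.
  apply: eq_bigr => k _; rewrite linearZ /= moments JZ.
    rewrite [RHS]rmorphM; congr (_ * _); congr (_%:C).
    by apply: eq_J => t; rewrite /= mulr1.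
  exact: (@cont_weighted (fun x => x ^+ k) (@exprn_continuous R k)).
by move=> t; rewrite horner_coef mulr_sumr; apply: eq_bigr => k _; rewrite mulrCA.
Qed.

Lemma density_real (f : R -> R) : continuous f ->
  h (fcR Phi f) = (J (fun t => Fr q t * f (2 * cos t)))%:C.
Proof.
move=> cf; apply/eqP; rewrite -subr_eq0; apply/eqP; apply: small_complex_eq0 => e e0.
have [M0 hM0] := spectrum_bounded fc.
have [B0 hB0] := Fr_bounded q_bounds.
(* The interval [-M, M] contains both the spectrum, for the state, and [-2, 2], the range of 2 cos
   t, for the integral. *)
pose M := `|M0| + 2; pose B := `|B0| + 1.
have M_gt0 : 0 < M by rewrite ltr_wpDl.
have B_gt0 : 0 < B by rewrite ltr_wpDl.
(* An approximation within [d] costs [d] under the state and at most [B * d] under the integral, in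
   total [e]. *)
pose d := e / (1 + B); have d0 : 0 < d by rewrite divr_gt0 // addr_gt0.
have [p hp] := weierstrass cf M_gt0 d0.
have cp : continuous (fun x => p.[x]) by exact: continuous_horner.
pose g x := (-1) * p.[x] + f x.
have cg : continuous g.
  by move=> x; apply: cvgD; [apply: cvgMl_tmp; apply: cp|apply: cf].
have gd x : `|x| <= M -> `|g x| <= d by rewrite /g mulN1r addrC; apply: hp.
have [|r hr rd] := @state_fcR_le _ _ _ _ fc h st g d cg.
  move=> x /hM0 hx; apply: gd; apply: le_trans hx _.
  by apply: le_trans (ler_norm _) _; rewrite lerDl.
exists (r - J (fun t => Fr q t * g (2 * cos t))).
  have e1 : h (fcR Phi g) = - h (fcR Phi (fun x => p.[x])) + h (fcR Phi f).
    by rewrite (fcR_lin fc) // linearD linearZ /= rmorphN1 mulN1r.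
  have e2 : J (fun t => Fr q t * g (2 * cos t)) =
     J (fun t => Fr q t * f (2 * cos t)) - J (fun t => Fr q t * p.[2 * cos t]).
    rewrite -mulN1r -J_lin; try exact: cont_weighted.
    by apply: eq_J => t; rewrite /g; ring.
  by rewrite rmorphB /= -hr e1 e2 density_poly rmorphB /=; ring.
have hJ : `|J (fun t => Fr q t * g (2 * cos t))| <= B * d.
  apply: J_le; first exact: cont_weighted.
  move=> t; rewrite normrM; apply: ler_pM => //.
    apply: le_trans (hB0 t) _; apply: le_trans (ler_norm _) _; by rewrite lerDl.
  apply: gd; rewrite normrM ger0_norm //; have : `|cos t| <= 1 :> R.
    by rewrite ler_norml cos_geN1 cos_le1.
  by move=> hc; rewrite /M; have := normr_ge0 M0; lra.
have -> : e = d + B * d by rewrite /d; field; rewrite gt_eqF // addr_gt0.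
by apply: le_trans (ler_normB _ _) _; lra.
Qed.

Lemma density_complex (phi : R -> R[i]^o) : continuous phi ->
  h (Phi phi) = circle_integral (fun z => F q z * phi (complex.Re (z + z^-1))).
Proof.
move=> cphi.
have cRe := continuous_Re cphi; have cIm := continuous_Im cphi.
have -> : Phi phi = 'i *: fcR Phi (fun x => complex.Im (phi x)) +
    fcR Phi (fun x => complex.Re (phi x)).
  rewrite /fcR -(fc_lin fc); try exact: cont_spec.
  by congr Phi; apply/funext => x; rewrite addrC [LHS]complexE complexiE.
rewrite linearD linearZ /= !density_real //.
have Fphi t : F q (circ t) * phi (complex.Re (circ t + (circ t)^-1)) =
   (Fr q t)%:C * phi (2 * cos t) by rewrite F_real // circ_add_inv.
have -> : circle_integral (fun z => F q z * phi (complex.Re (z + z^-1))) =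
    ((2 * pi)^-1)%:C *
    ((\int[lebesgue_measure]_(t in `[0, 2 * pi]) (Fr q t * complex.Re (phi (2 * cos t)))) +i*
     (\int[lebesgue_measure]_(t in `[0, 2 * pi]) (Fr q t * complex.Im (phi (2 * cos t))))).
  congr (_ * (_ +i* _)); apply: eq_Rintegral => t _; rewrite -/(circ t) Fphi.
    by case: (phi _) => a b /=; ring.
  by case: (phi _) => a b /=; ring.
by rewrite /J; apply/eqP; rewrite eq_complex /=; apply/andP; split; apply/eqP; ring.
Qed.

End MomentsDetermineDensity.

Theorem theorem4p2 (R : realType) (n : nat) (i j : 'I_n) (q : R)
    (A : cstarAlgType R) (u : 'M[A]_n)
    (AA : cstarAlgType R) (tens : A -> A -> AA) (Delta : {lrmorphism A -> AA})
    (haar : {scalar A}) :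
  (2 < n)%N ->
  -1 < q < 0 -> q + q^-1 = - n%:R ->
  is_Ao u ->
  is_min_tensor tens ->
  is_comultiplication u tens Delta ->
  is_Haar tens Delta haar ->
  has_circular_density haar ((Num.sqrt (n%:R + 2))%:C *: u i j) (F q).
Proof.
move=> n2 hq hn uAo [ts _] uD hH; split.
- by have [su _ _] := Ao_relations uAo; rewrite starZ su conjc_real.
- by move=> z _; rewrite /F invrK addrC.
have st : is_state haar by case: hH.
move=> Phi fc phi cphi; apply: (density_complex hq st _ fc cphi) => t.
apply: (haar_moments i j n2 hq hn uAo ts uD hH (m := circ_moment q)).
- exact: circ_moment_S0.
- exact: circ_moment_SS.
- exact: circ_moment_0.
Qed.
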